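(* Let $\bar x$ be the output of the two-phase method 2-AC-SPG described in the context, with $\mathcal R$ AC-SPG runs of $k$ iterations each, post-optimization sample size $\mathcal K$, batch sizes $b_t=\max\{1,\lceil(\tfrac{11I(t-1)}8+\tfrac78)\tfrac\alpha{\gamma_t}\rceil\}$ for some $\alpha>0$, and $b_t'\ge1$ (as further specified below for Estimator II). Then with probability at least $1-(\tfrac12)^{\mathcal R}-\tfrac{\mathcal R}{\lambda}$ (for $\lambda>0$), $$\|g_X(\bar x)\|^2\le\frac{8Q_k}{M_k}+\frac{6\lambda\sigma^2}{\mathcal K},$$ where $M_k:=\sum_{i=1}^m\sum_{t=2}^{s_i}(\tfrac{3t}{16}-\tfrac14)\tfrac1{\gamma_t^{(i)}}\ge\tfrac{(k-m)^2}{128\hat{\mathcal L}_{k-1}}$ and $$Q_k:=\begin{cases}\tfrac{(10+k-m)\hat{\mathcal L}D_X^2}{2}+\tfrac{k\,l\,D_X^2}{2}+\tfrac{k\sigma^2}{\alpha},&\text{when using Estimator I},\\[2pt]\tfrac{21\hat{\mathcal L}D_X^2}{4}+\tfrac{k\,l\,D_X^2}{2}+\tfrac{k\sigma^2}{\alpha},&\text{when using Estimator II with }b_t'\ge2\log_{1/\beta}(k+1).\end{cases}$$ Consequently, by choosing $\mathcal R=\lceil\log_2(\tfrac2\delta)\rceil$ and $\lambda=\tfrac{2\lceil\log_2(2/\delta)\rceil}{\delta}$ (for $\delta\in(0,1)$), with probability at least $1-\delta$, $$\|g_X(\bar x)\|^2\le\frac{8Q_k}{M_k}+\frac{12\lceil\log_2(2/\delta)\rceil\sigma^2}{\delta\mathcal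 K}.$$
   Context: $\|\cdot\|$, $\langle\cdot,\cdot\rangle$ are Euclidean; convention $\tfrac00=0$. $X\subseteq\mathbb R^n$ is a convex compact set with diameter $D_X=\max_{x,y\in X}\|x-y\|$; $f:X\to\mathbb R$ is continuously differentiable with $\|\nabla f(x)-\nabla f(y)\|\le L\|x-y\|$ for all $x,y\in X$ (hence $f(x)-f(y)-\langle\nabla f(y),x-y\rangle\le\tfrac L2\|x-y\|^2$), and, for some $l\in[0,L]$, $f(x)-f(y)-\langle\nabla f(y),x-y\rangle\ge-\tfrac l2\|x-y\|^2$ for all $x,y\in X$. Stochastic oracle: given $x\in X$ it returns $\mathcal F(x,\xi)$ and $\mathcal G(x,\xi)=\nabla\mathcal F(x,\xi)$, $\xi\in\Xi$ random; all samples are i.i.d. Assumptions, for all $x,y\in X$: $\mathbb E_\xi[\mathcal F(x,\xi)]=f(x)$, $\mathbb E_\xi[\mathcal G(x,\xi)]=\nabla f(x)$; $\mathbb E_\xi\|\mathcal G(x,\xi)-\nabla f(x)\|^2\le\sigma^2$ with $\sigma^2>0$; for each $\xi\in\Xi$ there is $\mathcal L(\xi)\ge0$ with $\|\mathcal G(x,\xi)-\mathcal G(y,\xi)\|\le\mathcal L(\xi)\|x-y\|$ and $\mathcal F(x,\xi)-\mathcal F(y,\xi)-\langle\mathcal G(y,\xi),x-y\rangle\le\tfrac{\mathcal L(\xi)}2\|x-y\|^2$, where $\mathcal L(\xi)\le\hat{\mathcal L}$ almost surely and $\mathbb E[\mathcal L(\xi)^2]\le\bar{\mathcal L}^2$.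 For $x,y\in X$: $\mathcal L_{x,y}(\xi):=\frac{2(\mathcal F(x,\xi)-\mathcal F(y,\xi)-\langle\nabla\mathcal F(y,\xi),x-y\rangle)}{\|x-y\|^2}$ and $L_{x,y}:=\frac{2(f(x)-f(y)-\langle\nabla f(y),x-y\rangle)}{\|x-y\|^2}$. Local Lipschitz estimators, from $b_t'$ i.i.d. samples $\bar\xi^t_1,\dots,\bar\xi^t_{b_t'}$ ($t\ge1$), with $0<\bar{\mathcal L}_0\le\hat{\mathcal L}$ given. Estimator I: $\bar{\mathcal L}_t:=\tfrac1{b_t'}\sum_{j=1}^{b_t'}\mathcal L_{x_t,x_{t-1}}(\bar\xi^t_j)$. Estimator II: $\bar{\mathcal L}_t:=\max\{\bar{\mathcal L}_0,\max_{1\le j\le b_t'}\mathcal L_{x_t,x_{t-1}}(\bar\xi^t_j)\}$. $\beta:=\max_{x,y\in X}\mathbb P\big(\max\{\bar{\mathcal L}_0,\mathcal L_{x,y}(\xi)\}\le\tfrac12L_{x,y}\big)<1$. AC-SPG method: given $x_0\in X$, for $t=1,\dots,k$: draw i.i.d. samples $\xi^t_1,\dots,\xi^t_{b_t}$, set $\hat G_t(x)=\tfrac1{b_t}\sum_{j=1}^{b_t}\mathcal G(x,\xi_j^t)$, $\gamma_t:=4\hat{\mathcal L}_{t-1}$ with $\hat{\mathcal L}_{t-1}:=\max\{\bar{\mathcal L}_0,\dots,\bar{\mathcal L}_{t-1}\}$, and $x_t=\arg\min_{x\in X}\{\langle\hat G_t(x_{t-1}),x\rangle+\tfrac{\gamma_t}2\|x_{t-1}-x\|^2\}$;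 then draw i.i.d. samples $\bar\xi^t_1,\dots,\bar\xi^t_{b_t'}$ and compute $\bar{\mathcal L}_t$ by the chosen estimator. Segments of an AC-SPG run of $k$ iterations: $x_0,x_1$ are in segment 1; for $t\ge2$ a new segment starts at $x_t$ whenever $\bar{\mathcal L}_t>\tfrac32\hat{\mathcal L}_{t-1}$. So $\{x_0,\dots,x_k\}=\{x_0^{(1)},x_1^{(1)},\dots,x_{s_1}^{(1)},x_1^{(2)},\dots,x_{s_2}^{(2)},\dots,x_1^{(m)},\dots,x_{s_m}^{(m)}\}$, $m$ being the number of segments ($m\le\lfloor\log_{3/2}(\hat{\mathcal L}/\bar{\mathcal L}_0)\rfloor+1$) and $s_i$ the length of segment $i$. $S(t)$ is the segment index and $I(t)$ the within-segment index of $x_t$, i.e. $x_t=x^{(S(t))}_{I(t)}$ (so $I(0)=0$, $I(1)=1$), and $\gamma^{(S(t))}_{I(t)}=\gamma_t$. Random output of a run: $W(t):=\tfrac{3I(t)}{16}-\tfrac14$ if $I(t)\ge2$ and $W(t):=0$ if $I(t)=1$; $x_{R(k)}$ is randomly selected from $\{x_1,\dots,x_{k-1}\}$ with $\mathbb P(x_{R(k)}=x_{t-1})=\big(\sum_{j=1}^k\tfrac{W(j)}{\gamma_j}\big)^{-1}\tfrac{W(t)}{\gamma_t}$. Projected gradient: $P_X(x,g,\gamma):=\gamma(x-x^+)$, $x^+=\arg\min_{u\in X}\{\langle g,u\rangle+\tfrac\gamma2\|x-u\|^2\}$. 2-AC-SPG method: Optimization phase: run AC-SPG independently $\mathcal R$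 times from $x_0$ for $k$ iterations, and let $\bar x_r=x_{R_r}$ be the random output of run $r$. Post-optimization phase: with $\mathcal K$ new i.i.d. samples $\xi_1,\dots,\xi_{\mathcal K}$ let $\bar G_{\mathcal K}(x)=\tfrac1{\mathcal K}\sum_{j=1}^{\mathcal K}\mathcal G(x,\xi_j)$, $\bar g_X(\bar x_r)=P_X(\bar x_r,\bar G_{\mathcal K}(\bar x_r),\gamma_{R_r+1})$, and output $\bar x\in\{\bar x_1,\dots,\bar x_{\mathcal R}\}$ with $\|\bar g_X(\bar x)\|=\min_{1\le r\le\mathcal R}\|\bar g_X(\bar x_r)\|$. Define $g_X(\bar x_r):=P_X(\bar x_r,\nabla f(\bar x_r),\gamma_{R_r+1})$, and $g_X(\bar x)$ analogously. *)

(* Defs.v *)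
From HB Require Import structures.
From mathcomp Require Import all_boot all_order all_algebra.
From mathcomp Require Import all_classical all_reals all_analysis.

Set Implicit Arguments.
Unset Strict Implicit.
Unset Printing Implicit Defensive.

Import Order.TTheory GRing.Theory Num.Theory.
Import numFieldNormedType.Exports.

Local Open Scope classical_set_scope.
Local Open Scope ring_scope.

Section Euclidean.
Variables (R : realType) (n : nat).
Implicit Types (u v x y g : 'rV[R]_n) (X : set 'rV[R]_n).

(* The library norm of ['rV_n] is the sup norm; it induces the same topology
   as the Euclidean norm used here. *)
Definition dotp u v : R := \sum_i u 0 i * v 0 i.
Definition enorm u : R := Num.sqrt (dotp u u).

Definition convex_in X := @convex_set R (convex_lmodType 'rV[R]_n) X.

Definition diam X : R := sup [set enorm (x - y) | x in X & y in X].

(* Differentiability relative to [X], which may have empty interior. *)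
Definition gradient_on X (f : 'rV[R]_n -> R) (df : 'rV[R]_n -> 'rV[R]_n) :=
  forall x, X x -> forall e, 0 < e -> \forall y \near within X (nbhs x),
    `|f y - f x - dotp (df x) (y - x)| <= e * enorm (y - x).

Definition lipschitz_map_on X (L : R) (g : 'rV[R]_n -> 'rV[R]_n) :=
  forall x y, X x -> X y -> enorm (g x - g y) <= L * enorm (x - y).

Definition bregman (f : 'rV[R]_n -> R) (df : 'rV[R]_n -> 'rV[R]_n) x y : R :=
  f x - f y - dotp (df y) (x - y).

(* Since [a / 0 = 0], the value at [x = y] is [0]. *)
Definition local_curv (f : 'rV[R]_n -> R) (df : 'rV[R]_n -> 'rV[R]_n) x y : R :=
  2 * bregman f df x y / enorm (x - y) ^+ 2.

Definition prox_obj x g (gamma : R) u : R :=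
  dotp g u + gamma / 2 * enorm (x - u) ^+ 2.

(* For [X] nonempty, convex and compact and [0 < gamma] the set below is a
   singleton; the default [x] is irrelevant. *)
Definition prox X x g (gamma : R) : 'rV[R]_n :=
  xget x [set u | X u /\
    forall v, X v -> prox_obj x g gamma u <= prox_obj x g gamma v].

Definition proj_grad X x g (gamma : R) : 'rV[R]_n :=
  gamma *: (x - prox X x g gamma).

End Euclidean.

Section Problem.
Variables (R : realType) (n : nat).

Record smooth_problem (X : set 'rV[R]_n) (f : 'rV[R]_n -> R)
    (df : 'rV[R]_n -> 'rV[R]_n) (L l : R) : Prop := SmoothProblem {
  sp_convex : convex_in X;
  sp_compact : compact X;
  sp_gradient : gradient_on X f df;
  sp_lipschitz : lipschitz_map_on X L df;
  sp_l_ge0 : 0 <= l;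
  sp_l_leL : l <= L;
  sp_lower : forall x y, X x -> X y ->
    - (l / 2) * enorm (x - y) ^+ 2 <= bregman f df x y
}.

(* [Lxi s] is the Lipschitz constant attached to the sample [s]; [hatL] bounds
   it almost surely and [barL ^+ 2] bounds its second moment. *)
Record stochastic_oracle d (Xi : measurableType d) (Pxi : probability Xi R)
    (X : set 'rV[R]_n) (f : 'rV[R]_n -> R) (df : 'rV[R]_n -> 'rV[R]_n)
    (F : 'rV[R]_n -> Xi -> R) (G : 'rV[R]_n -> Xi -> 'rV[R]_n)
    (Lxi : Xi -> R) (sigma hatL barL : R) : Prop := StochasticOracle {
  so_gradient : forall s, gradient_on X (F ^~ s) (G ^~ s);
  so_F_integrable : forall x, X x ->
    Pxi.-integrable setT (fun s => (F x s)%:E);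
  so_F_mean : forall x, X x -> (\int[Pxi]_s (F x s)%:E = (f x)%:E)%E;
  so_G_integrable : forall x, X x -> forall i,
    Pxi.-integrable setT (fun s => (G x s 0 i)%:E);
  so_G_mean : forall x, X x -> forall i,
    (\int[Pxi]_s (G x s 0 i)%:E = (df x 0 i)%:E)%E;
  so_sigma_gt0 : 0 < sigma ^+ 2;
  so_variance : forall x, X x ->
    (\int[Pxi]_s (enorm (G x s - df x) ^+ 2)%:E <= (sigma ^+ 2)%:E)%E;
  so_Lxi_meas : measurable_fun setT Lxi;
  so_Lxi_ge0 : forall s, 0 <= Lxi s;
  so_lipschitz : forall s, lipschitz_map_on X (Lxi s) (G ^~ s);
  so_upper : forall s x y, X x -> X y ->
    bregman (F ^~ s) (G ^~ s) x y <= Lxi s / 2 * enorm (x - y) ^+ 2;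
  so_Lxi_le : {ae Pxi, forall s, Lxi s <= hatL};
  so_Lxi_sq : (\int[Pxi]_s (Lxi s ^+ 2)%:E <= (barL ^+ 2)%:E)%E
}.

End Problem.

Inductive estimator := EstimatorI | EstimatorII.

Section ACSPG.
Variables (R : realType) (n : nat) (Xi : Type).

(* Status after an iteration [t]: the iterate x_t, the estimates
   \bar L_t and \hat L_t = max (\bar L_0, ..., \bar L_t), the segment index
   S(t) and the within-segment index I(t). *)
Record state := State {
  iterate : 'rV[R]_n;
  Lbar : R;
  Lhat : R;
  segment : nat;
  seg_index : nat
}.

Definition estimate (est : estimator) (F : 'rV[R]_n -> Xi -> R)
    (G : 'rV[R]_n -> Xi -> 'rV[R]_n) (Lbar0 : R) (b : nat)
    (xib : nat -> Xi) (x y : 'rV[R]_n) : R :=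
  let Ls j := local_curv (F ^~ (xib j)) (G ^~ (xib j)) x y in
  match est with
  | EstimatorI => (\sum_(j < b) Ls j) / b%:R
  | EstimatorII => \big[Num.max/Lbar0]_(j < b) Ls j
  end.

Definition minibatch (G : 'rV[R]_n -> Xi -> 'rV[R]_n) (b : nat)
    (xi : nat -> Xi) (x : 'rV[R]_n) : 'rV[R]_n :=
  b%:R^-1 *: \sum_(j < b) G x (xi j).

(* The batch consists of the samples with indices [j < batch_size]. *)
Definition batch_size (alpha gamma : R) (idx : nat) : nat :=
  maxn 1 `|Num.ceil ((11 * idx%:R / 8 + 7 / 8) * (alpha / gamma))|%N.

Definition acspg_step (X : set 'rV[R]_n) (F : 'rV[R]_n -> Xi -> R)
    (G : 'rV[R]_n -> Xi -> 'rV[R]_n) (est : estimator) (Lbar0 alpha : R)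
    (b' : nat) (t : nat) (xi xib : nat -> Xi) (s : state) : state :=
  let gamma := 4 * Lhat s in
  let b := batch_size alpha gamma (seg_index s) in
  let x := prox X (iterate s) (minibatch G b xi (iterate s)) gamma in
  let Lb := estimate est F G Lbar0 b' xib x (iterate s) in
  let new := (2 <= t)%N && (3 / 2 * Lhat s < Lb) in
  State x Lb (Num.max (Lhat s) Lb)
    (if new then (segment s).+1 else segment s)
    (if new then 1%N else (seg_index s).+1).

Fixpoint acspg (X : set 'rV[R]_n) (F : 'rV[R]_n -> Xi -> R)
    (G : 'rV[R]_n -> Xi -> 'rV[R]_n) (est : estimator) (Lbar0 alpha : R)
    (b' : nat -> nat) (x0 : 'rV[R]_n) (xi xib : nat -> nat -> Xi)
    (t : nat) : state :=
  match t with
  | 0%N => State x0 Lbar0 Lbar0 1 0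
  | t'.+1 => acspg_step X F G est Lbar0 alpha (b' t) t (xi t) (xib t)
               (acspg X F G est Lbar0 alpha b' x0 xi xib t')
  end.

Implicit Types st : nat -> state.

(* Meaningful for [1 <= t]. *)
Definition gam st (t : nat) : R := 4 * Lhat (st t.-1).

Definition weight st (t : nat) : R :=
  if (2 <= seg_index (st t))%N then 3 * (seg_index (st t))%:R / 16 - 1 / 4 else 0.

Definition weight_sum st (k : nat) : R :=
  \sum_(1 <= j < k.+1) weight st j / gam st j.

Definition output_prob st (k t : nat) : R :=
  (weight_sum st k)^-1 * (weight st t / gam st t).

Definition nseg st (k : nat) : nat := segment (st k).

(* x_0 does not count towards the length of the first segment. *)
Definition seg_len st (k i : nat) : nat :=
  count (fun t => segment (st t) == i) (iota 1 k).

(* \gamma^{(i)}_j: the stepsize of the unique iteration t with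
   S(t) = i and I(t) = j. *)
Definition seg_gam st (k i j : nat) : R :=
  gam st (find (fun t => (segment (st t) == i) && (seg_index (st t) == j))
               (iota 0 k.+1)).

Definition M_ st (k : nat) : R :=
  \sum_(1 <= i < (nseg st k).+1) \sum_(2 <= t < (seg_len st k i).+1)
    (3 * t%:R / 16 - 1 / 4) / seg_gam st k i t.

Definition Q_ (est : estimator) st (k : nat) (hatL D l sigma alpha : R) : R :=
  match est with
  | EstimatorI => (10 + k%:R - (nseg st k)%:R) * hatL * D ^+ 2 / 2
  | EstimatorII => 21 * hatL * D ^+ 2 / 4
  end + k%:R * l * D ^+ 2 / 2 + k%:R * sigma ^+ 2 / alpha.

End ACSPG.

Section Estimator_condition.
Variables (R : realType) (n : nat) (d : measure_display)
  (Xi : measurableType d) (Pxi : probability Xi R).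

Definition beta (X : set 'rV[R]_n) (f : 'rV[R]_n -> R)
    (df : 'rV[R]_n -> 'rV[R]_n) (F : 'rV[R]_n -> Xi -> R)
    (G : 'rV[R]_n -> Xi -> 'rV[R]_n) (Lbar0 : R) : R :=
  sup [set fine (Pxi [set s |
         Num.max Lbar0 (local_curv (F ^~ s) (G ^~ s) x y)
           <= local_curv f df x y / 2]) | x in X & y in X].

(* log_{1/beta} a = ln a / ln (1/beta); when beta = 0 this evaluates to
   [_ / 0 = 0], the value obtained in the limit beta -> 0. *)
Definition estimator_condition (est : estimator) (b' : nat -> nat) (k : nat)
    (beta : R) : Prop :=
  match est with
  | EstimatorI => True
  | EstimatorII => beta < 1 /\ forall t, (1 <= t <= k)%N ->
      2 * (ln k.+1%:R / ln beta^-1) <= (b' t)%:R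
  end.

End Estimator_condition.

Section Randomness.
Variables (R : realType) (d dXi : measure_display)
  (Omega : measurableType d) (P : probability Omega R)
  (Xi : measurableType dXi) (Pxi : probability Xi R).

(* Mutual independence of the classes of events [C i]. *)
Definition mutually_independent (I : eqType) (C : I -> set (set Omega)) :=
  forall (J : seq I) (E : I -> set Omega), uniq J ->
    (forall i, i \in J -> C i (E i)) ->
    P (\big[setI/setT]_(i <- J) E i) = (\prod_(i <- J) P (E i))%E.

Definition rv_events (Y : Omega -> Xi) : set (set Omega) :=
  preimage_set_system setT Y measurable.

Definition iid_samples (I : eqType) (Y : I -> Omega -> Xi) : Prop :=
  [/\ forall i, measurable_fun setT (Y i),
      forall i B, measurable B -> P (Y i @^-1` B) = Pxi B
    & mutually_independent (fun i => rv_events (Y i))].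

(* [xi t j] and [xib t j] are the samples of one run used at iteration [t],
   for the stochastic gradient and for the Lipschitz estimator. *)
Definition run_sample (xi xib : nat -> nat -> Omega -> Xi)
    (i : (nat * nat) + (nat * nat)) : Omega -> Xi :=
  match i with
  | inl (t, j) => xi t j
  | inr (t, j) => xib t j
  end.

Definition sample_events (I : Type) (Y : I -> Omega -> Xi) : set (set Omega) :=
  <<s \bigcup_i rv_events (Y i) >>.

(* Events of a run: its samples together with its random output index. *)
Definition run_events (I : Type) (Y : I -> Omega -> Xi) (rho : Omega -> nat) :
    set (set Omega) :=
  <<s (\bigcup_i rv_events (Y i)) `|` [set [set w | rho w = s] | s in setT] >>.

(* [rho] is the random index R(k) of a run with trajectory [st] and samples
   [Y]: conditionally on the samples, it equals [t - 1] with probability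
   [output_prob (st w) k t].  This law is undefined when all weights vanish;
   nothing but the range of [rho] is required there. *)
Definition random_output (n : nat) (I : Type) (Y : I -> Omega -> Xi)
    (st : Omega -> nat -> state R n) (k : nat) (rho : Omega -> nat) : Prop :=
  [/\ measurable_fun setT rho,
      forall w, (1 <= rho w <= k.-1)%N
    & forall A, sample_events Y A -> A `<=` [set w | 0 < weight_sum (st w) k] ->
      forall t, (1 <= t <= k)%N ->
        P (A `&` [set w | rho w = t.-1])
        = (\int[P]_(w in A) (output_prob (st w) k t)%:E)%E].

(* [None] is the block of post-optimization samples, [Some r] the r-th run. *)
Definition phase_events (N K : nat)
    (xi xib : 'I_N -> nat -> nat -> Omega -> Xi) (rho : 'I_N -> Omega -> nat)
    (zeta : 'I_K -> Omega -> Xi) (i : option 'I_N) : set (set Omega) :=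
  match i with
  | None => sample_events zeta
  | Some r => run_events (run_sample (xi r) (xib r)) (rho r)
  end.

Record two_phase_randomness (n N K k : nat)
    (xi xib : 'I_N -> nat -> nat -> Omega -> Xi) (rho : 'I_N -> Omega -> nat)
    (zeta : 'I_K -> Omega -> Xi) (st : 'I_N -> Omega -> nat -> state R n) :
    Prop := TwoPhaseRandomness {
  tp_run_iid : forall r, iid_samples (run_sample (xi r) (xib r));
  tp_post_iid : iid_samples zeta;
  tp_output : forall r,
    random_output (run_sample (xi r) (xib r)) (st r) k (rho r);
  tp_independent : mutually_independent (phase_events xi xib rho zeta)
}.

End Randomness.

Section TwoPhase.
Variables (R : realType) (n : nat) (Omega Xi : Type) (N K : nat).

Definition trajectory (X : set 'rV[R]_n) (F : 'rV[R]_n -> Xi -> R)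
    (G : 'rV[R]_n -> Xi -> 'rV[R]_n) (est : estimator) (Lbar0 alpha : R)
    (b' : nat -> nat) (x0 : 'rV[R]_n)
    (xi xib : 'I_N -> nat -> nat -> Omega -> Xi) (r : 'I_N) (w : Omega) :
    nat -> state R n :=
  acspg X F G est Lbar0 alpha b' x0
    (fun t j => xi r t j w) (fun t j => xib r t j w).

Implicit Types (st : 'I_N -> Omega -> nat -> state R n)
  (rho : 'I_N -> Omega -> nat) (zeta : 'I_K -> Omega -> Xi).

Definition candidate st rho (r : 'I_N) (w : Omega) : 'rV[R]_n :=
  iterate (st r w (rho r w)).

Definition post_grad (G : 'rV[R]_n -> Xi -> 'rV[R]_n) zeta (w : Omega)
    (x : 'rV[R]_n) : 'rV[R]_n :=
  K%:R^-1 *: \sum_(j < K) G x (zeta j w).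

(* Projected gradient of the r-th candidate for the gradient map [g]. *)
Definition candidate_pg (X : set 'rV[R]_n) (g : 'rV[R]_n -> 'rV[R]_n) st rho
    (r : 'I_N) (w : Omega) : 'rV[R]_n :=
  proj_grad X (candidate st rho r w) (g (candidate st rho r w))
    (gam (st r w) (rho r w).+1).

(* The output is the candidate of run [sel w]; ties are broken arbitrarily. *)
Definition selects_best (X : set 'rV[R]_n) (G : 'rV[R]_n -> Xi -> 'rV[R]_n)
    zeta st rho (sel : Omega -> 'I_N) : Prop :=
  forall w r,
    enorm (candidate_pg X (post_grad G zeta w) st rho (sel w) w)
    <= enorm (candidate_pg X (post_grad G zeta w) st rho r w).

(* 8 Q_k / M_k for the run where it is largest.  Division is that of the
   extended reals, so the ratio is +oo for a run with M_k = 0. *)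
Definition ratio_bound (est : estimator) st (k : nat)
    (hatL D l sigma alpha : R) (w : Omega) : \bar R :=
  \big[maxe/-oo%E]_(r < N)
    ((8 * Q_ est (st r w) k hatL D l sigma alpha)%:E / (M_ (st r w) k)%:E)%E.

End TwoPhase.

Definition ceil_log2 (R : realType) (x : R) : int := Num.ceil (ln x / ln 2).

(* Main.v *)
Require Import Defs.
From HB Require Import structures.
From mathcomp Require Import all_boot all_order all_algebra.
From mathcomp Require Import all_classical all_reals all_analysis.
From mathcomp Require Import measurable_realfun.
From mathcomp Require Import ring lra zify.

Set Implicit Arguments.
Unset Strict Implicit.
Unset Printing Implicit Defensive.

Import Order.TTheory GRing.Theory Num.Theory.
Import numFieldNormedType.Exports.

Local Open Scope classical_set_scope.
Local Open Scope ring_scope.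

(** The analysis of one run rests on a potential. Let [u] minimise [f] on [X] and
    let [dlt] be the error of the stochastic gradient of a step. Inside a segment
    the descent inequality with weight [I] plus the comparison with [u] with weight
    one ([step_continue]) makes [I * (f x - f u)] telescope: each step gains the
    squared projected gradient with weight [W / gamma] and pays for [dlt], for the
    concavity [l], and for the part of the curvature exceeding [3/8 * gamma]. At a
    restart the gap [f x - f u] is dropped, being nonnegative, and a new segment
    begins at a cost proportional to [Lhat * D^2]; as [Lhat] grows by the factor
    3/2 at each restart, these costs add up to a multiple of the last one
    ([potential]).

    Since the stepsizes, the batches and the segments are random, so are [Q_k] and
    [M_k], and Markov's inequality is applied not to the run but to the output index
    for given samples: [failure_prob] is the probability that it picks a candidate
    with [3 * M_k * |g|^2 > 8 * Q_k]. The normalisation of the output law cancels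
    [M_k]. With the second estimator [Q_k] is deterministic and this suffices
    ([failure_prob_max]). With the first one [Q_k] depends on the number of
    segments, which is not known while the errors occur; therefore the step from
    [x_(t-1)] is multiplied by a weight that depends on the segment of [x_(t-1)]
    only, and increases with it. Markov's inequality then loses the ratio of the
    weights of the last segment and of that of the first failing candidate; but if
    that candidate lies [j] segments before the last, then [Lhat] still grows by
    [(3/2)^j] after it and the failing candidates are exponentially unlikely to be
    picked ([first_failure_bound], [late_failure], [failure_prob_average]).

    What remains is a sum of errors. Given the past, the gradient errors are covered
    by the term [k * sigma^2 / alpha] of [Q_k], thanks to the batch sizes; the excess
    of the curvature over its unbiased estimate is centred (first estimator); all
    curvature samples of a step fall below half of its curvature with probability
    at most [beta ^ b'_t <= (k+1)^-2] (second estimator).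
    Conditional expectations are replaced by integrating over one sample
    while all the others are frozen, which independence and Fubini's theorem permit
    ([freeze_mean]). Hence a run fails with probability at most 1/2
    ([run_fails_prob]), and all runs do with probability at most [(1/2)^N].

    Given the runs, the post-optimization gradient at a candidate is the mean of [K]
    independent unbiased gradients, so that its squared error exceeds
    [lambda * sigma^2 / K] with probability at most [1 / lambda]. When all these
    errors are small, the selected candidate is nearly as good as any other, in
    particular as one whose run did not fail ([selection_bound]). *)

(** * Euclidean geometry and projected gradient steps *)

Section EuclideanFacts.
Context {R : realType} {n : nat}.
Implicit Types (u v w x y g : 'rV[R]_n) (X : set 'rV[R]_n) (a b c : R).

Lemma dotpC u v : dotp u v = dotp v u.
Proof. by apply: eq_bigr => i _; rewrite mulrC. Qed.

Lemma dotpDl u v w : dotp (u + v) w = dotp u w + dotp v w.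
Proof. by rewrite -big_split; apply: eq_bigr => i _; rewrite mxE mulrDl. Qed.

Lemma dotpDr u v w : dotp w (u + v) = dotp w u + dotp w v.
Proof. by rewrite dotpC dotpDl !(dotpC w). Qed.

Lemma dotpZl a u v : dotp (a *: u) v = a * dotp u v.
Proof. by rewrite mulr_sumr; apply: eq_bigr => i _; rewrite mxE mulrA. Qed.

Lemma dotpZr a u v : dotp u (a *: v) = a * dotp u v.
Proof. by rewrite dotpC dotpZl dotpC. Qed.

Lemma dotpNl u v : dotp (- u) v = - dotp u v.
Proof. by rewrite -scaleN1r dotpZl mulN1r. Qed.

Lemma dotpNr u v : dotp u (- v) = - dotp u v.
Proof. by rewrite dotpC dotpNl dotpC. Qed.

Lemma dotpBl u v w : dotp (u - v) w = dotp u w - dotp v w.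
Proof. by rewrite dotpDl dotpNl. Qed.

Lemma dotp0l u : dotp 0 u = 0.
Proof. by rewrite -(scale0r 0) dotpZl mul0r. Qed.

Lemma dotp0r u : dotp u 0 = 0.
Proof. by rewrite dotpC dotp0l. Qed.

Lemma dotp_suml (I : Type) (s : seq I) (P : pred I) (h : I -> 'rV[R]_n) v :
  dotp (\sum_(i <- s | P i) h i) v = \sum_(i <- s | P i) dotp (h i) v.
Proof.
elim/big_rec2 : _ => [|i a b _ <-]; first exact: dotp0l.
by rewrite dotpDl.
Qed.

Lemma dotp_sumr (I : Type) (s : seq I) (P : pred I) (h : I -> 'rV[R]_n) v :
  dotp v (\sum_(i <- s | P i) h i) = \sum_(i <- s | P i) dotp v (h i).
Proof. by rewrite dotpC dotp_suml; apply: eq_bigr => i _; rewrite dotpC. Qed.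

Lemma dotp_ge0 u : 0 <= dotp u u.
Proof. by apply: sumr_ge0 => i _; rewrite -expr2 sqr_ge0. Qed.

Lemma dotp_eq0 u : (dotp u u == 0) = (u == 0).
Proof.
apply/idP/eqP => [|->]; last by rewrite dotp0l.
rewrite psumr_eq0; last by move=> i _; rewrite -expr2 sqr_ge0.
move=> /allP u0; apply/rowP => i; rewrite mxE.
by have := u0 i (mem_index_enum _); rewrite -expr2 sqrf_eq0 => /eqP.
Qed.

Lemma enorm_ge0 u : 0 <= enorm u.
Proof. exact: sqrtr_ge0. Qed.

Lemma enorm_sqr u : enorm u ^+ 2 = dotp u u.
Proof. by rewrite sqr_sqrtr// dotp_ge0. Qed.

Lemma enorm0 : enorm (0 : 'rV[R]_n) = 0.
Proof. by rewrite /enorm dotp0l sqrtr0. Qed.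

Lemma enorm_eq0 u : (enorm u == 0) = (u == 0).
Proof. by rewrite -(@sqrf_eq0 _ (enorm u)) enorm_sqr dotp_eq0. Qed.

Lemma enormN u : enorm (- u) = enorm u.
Proof. by rewrite /enorm dotpNl dotpNr opprK. Qed.

Lemma enormB u v : enorm (u - v) = enorm (v - u).
Proof. by rewrite -enormN opprB. Qed.

Lemma enormZ a u : enorm (a *: u) = `|a| * enorm u.
Proof.
by rewrite /enorm dotpZl dotpZr mulrA -expr2 sqrtrM ?sqr_ge0// sqrtr_sqr.
Qed.

Lemma enorm_le u a : 0 <= a -> (enorm u <= a) = (dotp u u <= a ^+ 2).
Proof. by move=> a0; rewrite -enorm_sqr ler_sqr ?nnegrE ?enorm_ge0. Qed.

(** Young's inequality; it follows from [0 <= |c u - v|^2]. *)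
Lemma dotp_young c u v : 0 < c ->
  `|dotp u v| <= c / 2 * dotp u u + dotp v v / (2 * c).
Proof.
move=> c0; have c1 := gt_eqF c0.
have h1 := dotp_ge0 (c *: u - v); have h2 := dotp_ge0 (c *: u + v).
rewrite !(dotpDl, dotpDr, dotpNl, dotpNr, dotpZl, dotpZr) in h1 h2.
rewrite !(dotpC v u) in h1 h2.
have -> : c / 2 * dotp u u + dotp v v / (2 * c) =
    (c * (c * dotp u u) + dotp v v) / (2 * c) by field; rewrite c1.
rewrite ler_pdivlMr ?mulr_gt0//.
have [d0|d0] := leP 0 (dotp u v).
  by rewrite ger0_norm//; nra.
by rewrite ltr0_norm//; nra.
Qed.

Lemma cauchy_schwarz u v : dotp u v <= enorm u * enorm v.
Proof.
have [->|v0] := eqVneq v 0; first by rewrite dotp0r enorm0 mulr0.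
have [->|u0] := eqVneq u 0; first by rewrite dotp0l enorm0 mul0r.
have pu : 0 < enorm u by rewrite lt_neqAle enorm_ge0 eq_sym enorm_eq0 u0.
have pv : 0 < enorm v by rewrite lt_neqAle enorm_ge0 eq_sym enorm_eq0 v0.
have /= := dotp_young u v (divr_gt0 pv pu).
rewrite -!enorm_sqr => h; apply: (le_trans (ler_norm _)).
apply: (le_trans h); rewrite le_eqVlt; apply/orP; left; apply/eqP.
by field; rewrite !gt_eqF.
Qed.

Lemma enormD u v : enorm (u + v) <= enorm u + enorm v.
Proof.
rewrite enorm_le ?addr_ge0 ?enorm_ge0// !(dotpDl, dotpDr) (dotpC v u).
have := cauchy_schwarz u v; rewrite sqrrD !enorm_sqr.
by lra.
Qed.

Lemma abs_coord_le_enorm u i : `|u 0 i| <= enorm u.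
Proof.
rewrite -sqrtr_sqr ler_wsqrtr// /dotp (bigD1 i)//= -expr2 lerDl.
by apply: sumr_ge0 => j _; rewrite -expr2 sqr_ge0.
Qed.

Lemma enorm_le_sum u : enorm u <= \sum_i `|u 0 i|.
Proof.
have h0 : 0 <= \sum_i `|u 0 i| by apply: sumr_ge0.
rewrite enorm_le// expr2 mulr_suml /dotp; apply: ler_sum => i _.
apply: (le_trans (ler_norm _)); rewrite normrM ler_wpM2l//.
by rewrite (bigD1 i)//= lerDl; apply: sumr_ge0.
Qed.

Lemma dotp_sumsq_le u v : dotp (u + v) (u + v) <= 2 * dotp u u + 2 * dotp v v.
Proof.
have := dotp_ge0 (u - v).
by rewrite !(dotpDl, dotpDr, dotpNl, dotpNr) (dotpC v u); lra.
Qed.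

(** Minimising over the segment towards [v] turns the minimality of the
    projection into the first-order condition below; everything later uses
    only this variational inequality. *)
Lemma convex_in_segment X x y a : convex_in X -> X x -> X y ->
  0 <= a <= 1 -> X (x + a *: (y - x)).
Proof.
move=> cX Xx Xy /andP[a0 a1].
have i01 : (0 <= a <= 1) by rewrite a0 a1.
have := cX y x (Itv01 a0 a1) (mem_set Xy) (mem_set Xx).
rewrite inE; congr (X _); rewrite /conv/= /unstable.onem.
by rewrite scalerBl scale1r scalerBr addrC addrA addrAC.
Qed.

Lemma dotp_continuous g : continuous (dotp g : 'rV[R]_n -> R).
Proof.
apply: (@continuous_big R^o _ +%R 0 xpredT _ _ (index_enum 'I_n)) => [|i _ x].
  exact: add_continuous.
apply: (@cvgM R _ (nbhs x) _ (fun=> _) (fun x => x 0 i)); last first.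
  exact: coord_continuous.
exact: cvg_cst.
Qed.

Lemma sqnorm_continuous : continuous (fun u : 'rV[R]_n => dotp u u).
Proof.
apply: (@continuous_big R^o _ +%R 0 xpredT _ _ (index_enum 'I_n)) => [|i _ x].
  exact: add_continuous.
by apply: (@cvgM R _ (nbhs x) _ (fun x => x 0 i) (fun x => x 0 i));
  exact: coord_continuous.
Qed.

Lemma prox_obj_continuous x g a : continuous (prox_obj x g a).
Proof.
move=> y.
pose h2 : 'rV[R]_n -> R := fun u => a / 2 * dotp (x - u) (x - u).
have -> : prox_obj x g a = (fun u => dotp g u + h2 u).
  by apply/funext => u; rewrite /prox_obj enorm_sqr.
apply: (@continuousD R R^o _ (dotp g) h2 y); first exact: dotp_continuous.
apply: (@cvgM R _ (nbhs y) _ (fun=> _) (fun u => dotp (x - u) (x - u))).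
  exact: cvg_cst.
apply: (@continuous_comp _ _ _ (fun u => x - u) (fun u => dotp u u)); last first.
  exact: sqnorm_continuous.
apply: (@cvgB _ _ _ (nbhs y) _ (fun=> x) id x y); last exact: cvg_id.
exact: cvg_cst.
Qed.

Section Prox.
Variables (X : set 'rV[R]_n) (x g : 'rV[R]_n) (gamma : R).
Hypotheses (cX : convex_in X) (kX : compact X) (Xx : X x) (gamma_gt0 : 0 < gamma).

Let prox_spec : X (prox X x g gamma) /\
  forall v, X v -> prox_obj x g gamma (prox X x g gamma) <= prox_obj x g gamma v.
Proof.
have [c cX' cmin] : exists2 c, c \in X & forall t, t \in X ->
    prox_obj x g gamma c <= prox_obj x g gamma t.
  apply: EVT_min_rV => //; first by exists x.
  exact/continuous_subspaceT/prox_obj_continuous.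
apply: (@xgetPex _ x [set u | X u /\ forall v, X v -> _]).
by exists c; split; [exact: set_mem|move=> v Xv; exact/cmin/mem_set].
Qed.

Lemma prox_in : X (prox X x g gamma).
Proof. by case: prox_spec. Qed.

(** First-order optimality: comparing the minimiser [p] with [p + a (v - p)]
    and letting [a] tend to [0] leaves only the linear term in [a]. *)
Lemma prox_variational v : X v ->
  0 <= dotp (g + gamma *: (prox X x g gamma - x)) (v - prox X x g gamma).
Proof.
move=> Xv; have [Xp pmin] := prox_spec; set p := prox X x g gamma in Xp pmin *.
set T := dotp _ _; rewrite leNgt; apply/negP => T0.
set q := gamma / 2 * dotp (v - p) (v - p).
have q0 : 0 <= q by rewrite mulr_ge0 ?dotp_ge0// divr_ge0// ltW.
have key a : 0 <= a <= 1 -> 0 <= a * T + a ^+ 2 * q.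
  move=> a01; have := pmin _ (convex_in_segment cX Xp Xv a01).
  rewrite -subr_ge0 /prox_obj !enorm_sqr => h; apply: (le_trans h).
  rewrite le_eqVlt; apply/orP; left; apply/eqP; rewrite /T /q.
  have -> : x - (p + a *: (v - p)) = (x - p) - a *: (v - p) by rewrite opprD addrA.
  have -> : p - x = - (x - p) by rewrite opprB.
  move: (v - p) (x - p) => s r.
  rewrite !(dotpDl, dotpDr, dotpNl, dotpNr, dotpZl, dotpZr) (dotpC s r).
  by field.
pose a := Num.min 1 (- T / (2 * (q + 1))).
have q1 : 0 < 2 * (q + 1) by lra.
have a_gt0 : 0 < a by rewrite lt_min ltr01 divr_gt0// oppr_gt0.
have a_le1 : a <= 1 by rewrite ge_min lexx.
have /key : 0 <= a <= 1 by rewrite ltW.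
have : a * (2 * (q + 1)) <= - T.
  by rewrite -ler_pdivlMr// ge_min lexx orbT.
by move=> aT; nra.
Qed.

End Prox.
Arguments prox_in {X x} g gamma.
Arguments prox_variational {X x} g {gamma} _ _ _ _ {v}.

(** The optimality conditions of two steps from the same point, tested against
    each other, make the step a nonexpansive function of [g / gamma]. *)
Lemma prox_nonexpansive X x y g h a b : convex_in X -> compact X ->
  X x -> X y -> 0 < a -> 0 < b ->
  enorm (prox X x g a - prox X y h b)
    <= enorm ((x - a^-1 *: g) - (y - b^-1 *: h)).
Proof.
move=> cX kX Xx Xy a0 b0.
set p := prox _ _ _ _; set q := prox _ _ _ _.
have := prox_variational g cX kX Xx a0 (prox_in h b kX Xy).
have := prox_variational h cX kX Xy b0 (prox_in g a kX Xx).
rewrite -/p -/q => hq hp.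
have scaled c w r s : 0 < c -> 0 <= dotp (w + c *: r) s ->
    0 <= dotp (c^-1 *: w + r) s.
  move=> c0; rewrite -(pmulr_rge0 _ c0) => hh.
  have -> : c^-1 *: w + r = c^-1 *: (w + c *: r).
    by rewrite scalerDr scalerA mulVf ?gt_eqF// scale1r.
  by rewrite dotpZl mulr_ge0 ?invr_ge0 ?(ltW c0)// -(pmulr_rge0 _ c0).
have {}hp := scaled _ _ _ _ a0 hp.
have {}hq := scaled _ _ _ _ b0 hq.
have [->|pq] := eqVneq (p - q) 0; first by rewrite enorm0 enorm_ge0.
have pq0 : 0 < enorm (p - q) by rewrite lt_neqAle enorm_ge0 eq_sym enorm_eq0 pq.
rewrite -(ler_pM2r pq0); apply: le_trans (cauchy_schwarz _ _).
rewrite -expr2 enorm_sqr -subr_ge0.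
have -> : dotp (x - a^-1 *: g - (y - b^-1 *: h)) (p - q) - dotp (p - q) (p - q) =
    dotp (b^-1 *: h + (q - y)) (p - q) + dotp (a^-1 *: g + (p - x)) (q - p).
  rewrite -[q - p]opprB dotpNr -!dotpBl; congr dotp.
  by apply/rowP => i; rewrite !mxE; ring.
by apply: addr_ge0; [exact: hq|exact: hp].
Qed.

Lemma prox_lipschitz X x g h a : convex_in X -> compact X -> X x -> 0 < a ->
  a * enorm (prox X x g a - prox X x h a) <= enorm (g - h).
Proof.
move=> cX kX Xx a0; have := prox_nonexpansive g h cX kX Xx Xx a0 a0.
have -> : x - a^-1 *: g - (x - a^-1 *: h) = - (a^-1 *: (g - h)).
  by apply/rowP => i; rewrite !mxE; ring.
rewrite enormN enormZ ger0_norm ?invr_ge0 ?(ltW a0)// => hh.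
by rewrite mulrC -ler_pdivlMr// [_ / a]mulrC.
Qed.

Lemma proj_grad_lipschitz X x g h a : convex_in X -> compact X -> X x -> 0 < a ->
  enorm (proj_grad X x g a - proj_grad X x h a) <= enorm (g - h).
Proof.
move=> cX kX Xx a0; rewrite /proj_grad -scalerBr enormZ gtr0_norm//.
have -> : x - prox X x g a - (x - prox X x h a) =
    prox X x h a - prox X x g a by apply/rowP => i; rewrite !mxE; ring.
by rewrite enormB; exact: prox_lipschitz.
Qed.

End EuclideanFacts.

(** * Consequences of the smoothness assumptions *)

Section GradientOn.
Context {R : realType} {n : nat}.
Variables (X : set 'rV[R]_n) (f : 'rV[R]_n -> R) (df : 'rV[R]_n -> 'rV[R]_n).

Lemma mx_norm_coord (v : 'rV[R]_n) i : `|v 0 i| <= `|v|.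
Proof.
rewrite [leRHS]/Num.norm/= mx_normrE.
by apply/bigmax_geP; right; exists (0, i).
Qed.

Lemma enorm_le_norm (v : 'rV[R]_n) : enorm v <= n%:R * `|v|.
Proof.
apply: (le_trans (enorm_le_sum v)).
have -> : n%:R * `|v| = \sum_(i < n) `|v| by rewrite sumr_const card_ord mulr_natl.
by apply: ler_sum => i _; exact: mx_norm_coord.
Qed.

Lemma gradient_on_continuous x : gradient_on X f df -> X x ->
  f y @[y --> within X (nbhs x)] --> f x.
Proof.
move=> gf Xx; apply/cvgrPdist_lt => e e0.
pose c := enorm (df x) + 1.
have c0 : 0 < c by rewrite ltr_wpDl ?enorm_ge0.
have N0 : 0 < n%:R + 1 :> R by rewrite ltr_wpDl.
have d0 : 0 < e / (c * (n%:R + 1)) by rewrite divr_gt0 ?mulr_gt0.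
have := gf _ Xx 1 ltr01.
have nb : \forall y \near within X (nbhs x), `|x - y| < e / (c * (n%:R + 1)).
  by apply: cvgr_dist_lt d0 => //; exact: cvg_within.
move=> g1; near=> y.
have : `|f y - f x - dotp (df x) (y - x)| <= 1 * enorm (y - x).
  by near: y; exact: g1.
have : `|x - y| < e / (c * (n%:R + 1)) by near: y; exact: nb.
rewrite mul1r ltr_pdivlMr ?mulr_gt0// => hxy h1.
rewrite distrC; apply: le_lt_trans hxy.
have h2 : `|dotp (df x) (y - x)| <= enorm (df x) * enorm (y - x).
  rewrite ler_norml cauchy_schwarz andbT lerNl -dotpNr.
  by apply: (le_trans (cauchy_schwarz _ _)); rewrite enormN.
have h3 : `|f y - f x| <= c * enorm (y - x).
  rewrite -[f y - f x](subrK (dotp (df x) (y - x))).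
  apply: (le_trans (ler_normD _ _)); rewrite /c mulrDl mul1r.
  by rewrite addrC lerD.
apply: (le_trans h3); rewrite mulrCA ler_pM2l//.
apply: (le_trans (enorm_le_norm _)); rewrite distrC mulrC ler_wpM2l//.
by rewrite lerDl.
Unshelve. all: by end_near. Qed.

End GradientOn.

Section Diameter.
Context {R : realType} {n : nat}.
Variable X : set 'rV[R]_n.
Hypothesis kX : compact X.

Lemma enorm_le_diam x y : X x -> X y -> enorm (x - y) <= diam X.
Proof.
move=> Xx Xy.
have [M [_ XM]] := compact_bounded kX.
have {}XM z : X z -> `|z| <= M + 1 by move=> Xz; apply: XM => //; rewrite ltrDl.
apply: sup_upper_bound; last by exists x => //; exists y.
split; first by exists (enorm (x - y)), x => //; exists y.
exists (n%:R * ((M + 1) + (M + 1))) => _ [a Xa [b Xb <-]].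
apply: (le_trans (enorm_le_norm _)); rewrite ler_wpM2l//.
by apply: (le_trans (ler_normB _ _)); rewrite lerD ?XM.
Qed.

Lemma sqdist_le_diam x y : X x -> X y -> dotp (x - y) (x - y) <= diam X ^+ 2.
Proof.
move=> Xx Xy; rewrite -enorm_sqr ler_sqr ?nnegrE ?enorm_ge0 ?enorm_le_diam//.
exact: le_trans (enorm_ge0 _) (enorm_le_diam Xx Xy).
Qed.

End Diameter.

Lemma smooth_problem_minimizer (R : realType) (n : nat) (X : set 'rV[R]_n)
    (f : 'rV[R]_n -> R) (df : 'rV[R]_n -> 'rV[R]_n) (L l : R) :
  smooth_problem X f df L l -> X !=set0 ->
  exists2 u, X u & forall x, X x -> f u <= f x.
Proof.
move=> P X0; have [c cX cmin] : exists2 c, c \in X &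
    forall t, t \in X -> f c <= f t.
  apply: EVT_min_rV => //; first exact: sp_compact P.
  rewrite continuous_subspace_in => x; rewrite inE => Xx.
  rewrite /continuous_at /nbhs/= -nbhs_subspace_in//.
  exact: (gradient_on_continuous (sp_gradient P)).
by exists c; [exact: set_mem|move=> x Xx; apply/cmin/mem_set].
Qed.

(** ** Curvature of the sampled functions *)

Section BregmanFacts.
Context {R : realType} {n : nat}.
Implicit Types (x y : 'rV[R]_n).

Lemma bregmanxx (f : 'rV[R]_n -> R) df x : bregman f df x x = 0.
Proof. by rewrite /bregman !subrr dotp0r subr0. Qed.

Lemma local_curvE (f : 'rV[R]_n -> R) df x y :
  local_curv f df x y * dotp (x - y) (x - y) = 2 * bregman f df x y.
Proof.
have [->|xy] := eqVneq x y; first by rewrite bregmanxx subrr dotp0l !mulr0.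
by rewrite /local_curv enorm_sqr divfK// dotp_eq0 subr_eq0.
Qed.

Lemma bregman_sym (f : 'rV[R]_n -> R) df x y :
  bregman f df x y = dotp (df x - df y) (x - y) - bregman f df y x.
Proof.
rewrite /bregman -[y - x]opprB dotpNr dotpBl; ring.
Qed.
End BregmanFacts.

Section SampleCurvature.
Context {R : realType} {n : nat} {d : measure_display} {Xi : measurableType d}.
Variables (Pxi : probability Xi R) (X : set 'rV[R]_n) (f : 'rV[R]_n -> R)
  (df : 'rV[R]_n -> 'rV[R]_n) (F : 'rV[R]_n -> Xi -> R)
  (G : 'rV[R]_n -> Xi -> 'rV[R]_n) (Lxi : Xi -> R) (sigma hatL barL : R).
Hypothesis O : stochastic_oracle Pxi X f df F G Lxi sigma hatL barL.
Implicit Types x y : 'rV[R]_n.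

Lemma sample_bregman_le s x y : X x -> X y ->
  bregman (F ^~ s) (G ^~ s) x y <= Lxi s / 2 * dotp (x - y) (x - y).
Proof. by move=> Xx Xy; rewrite -enorm_sqr; exact: (so_upper O). Qed.

(** Exchanging the two points turns the upper bound on the curvature into a
    lower bound, up to the Lipschitz constant of the gradient. *)
Lemma sample_bregman_ge s x y : X x -> X y ->
  - (3 / 2 * Lxi s * dotp (x - y) (x - y)) <= bregman (F ^~ s) (G ^~ s) x y.
Proof.
move=> Xx Xy; rewrite bregman_sym.
have := sample_bregman_le s Xy Xx.
have -> : dotp (y - x) (y - x) = dotp (x - y) (x - y).
  by rewrite -[y - x]opprB dotpNl dotpNr opprK.
have : - (Lxi s * dotp (x - y) (x - y)) <= dotp (G x s - G y s) (x - y).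
  rewrite lerNl -dotpNl; apply: (le_trans (cauchy_schwarz _ _)).
  rewrite enormN -enorm_sqr expr2 mulrA ler_wpM2r ?enorm_ge0//.
  exact: (so_lipschitz O).
by lra.
Qed.

Lemma sample_bregman_abs s x y : X x -> X y ->
  `|bregman (F ^~ s) (G ^~ s) x y| <= 3 / 2 * Lxi s * dotp (x - y) (x - y).
Proof.
move=> Xx Xy; rewrite ler_norml sample_bregman_ge//=.
apply: (le_trans (sample_bregman_le s Xx Xy)).
by rewrite ler_wpM2r ?dotp_ge0//; have := so_Lxi_ge0 O s; lra.
Qed.

Lemma sample_curv_le s x y : X x -> X y ->
  local_curv (F ^~ s) (G ^~ s) x y <= Lxi s.
Proof.
move=> Xx Xy; have [->|xy] := eqVneq x y.
  by rewrite /local_curv bregmanxx mulr0 mul0r; exact: (so_Lxi_ge0 O).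
have p0 : 0 < dotp (x - y) (x - y).
  by rewrite lt_neqAle dotp_ge0 eq_sym dotp_eq0 subr_eq0 xy.
rewrite -(ler_pM2r p0) local_curvE.
by have := sample_bregman_le s Xx Xy; lra.
Qed.

End SampleCurvature.

(** * Segments of a run *)

Section Segments.
Context {R : realType} {n : nat}.

Definition restart (st : nat -> state R n) t :=
  (2 <= t)%N && (3 / 2 * Lhat (st t.-1) < Lbar (st t)).

(** The part of the recursion that does not mention the iterates. *)
Record segmented (st : nat -> state R n) : Prop := Segmented {
  sg_Lhat0 : 0 < Lhat (st 0%N);
  sg_segment0 : segment (st 0%N) = 1%N;
  sg_index0 : seg_index (st 0%N) = 0%N;
  sg_Lhat : forall t, Lhat (st t.+1) = Num.max (Lhat (st t)) (Lbar (st t.+1));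
  sg_segment : forall t, segment (st t.+1) =
    if restart st t.+1 then (segment (st t)).+1 else segment (st t);
  sg_index : forall t, seg_index (st t.+1) =
    if restart st t.+1 then 1%N else (seg_index (st t)).+1
}.

Lemma acspg_segmented (Xi : Type) X (F : 'rV[R]_n -> Xi -> R) G est Lbar0 alpha
    b' x0 xi xib : 0 < Lbar0 ->
  segmented (acspg X F G est Lbar0 alpha b' x0 xi xib).
Proof. by move=> L0; split. Qed.

Variable st : nat -> state R n.
Hypothesis sg : segmented st.

Let S t := segment (st t).
Let I t := seg_index (st t).
Let Lh t := Lhat (st t).

Let SS t : S t.+1 = if restart st t.+1 then (S t).+1 else S t.
Proof. exact: sg_segment sg t. Qed.

Let IS t : I t.+1 = if restart st t.+1 then 1%N else (I t).+1.
Proof. exact: sg_index sg t. Qed.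

Lemma Lhat_nondecreasing t t' : (t <= t')%N -> Lh t <= Lh t'.
Proof.
elim: t' => [|t' IH]; first by rewrite leqn0 => /eqP ->.
rewrite leq_eqVlt => /orP[/eqP -> //|/IH] h.
by rewrite (le_trans h)// /Lh (sg_Lhat sg) le_max lexx.
Qed.

Lemma Lhat_gt0 t : 0 < Lh t.
Proof. exact: lt_le_trans (sg_Lhat0 sg) (Lhat_nondecreasing _). Qed.

Lemma gam_gt0 t : 0 < gam st t.
Proof. by rewrite mulr_gt0// Lhat_gt0. Qed.

Lemma gam_nondecreasing t t' : (t <= t')%N -> gam st t <= gam st t'.
Proof. by move=> tt; rewrite ler_pM2l// Lhat_nondecreasing//; lia. Qed.

Lemma Lbar_le_Lhat t : Lbar (st t.+1) <= Lh t.+1.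
Proof. by rewrite /Lh (sg_Lhat sg) le_max lexx orbT. Qed.

Lemma restart_Lhat t : restart st t.+1 ->
  3 / 2 * Lh t < Lh t.+1 /\ Lbar (st t.+1) = Lh t.+1.
Proof.
move=> /andP[_ /= h]; have h0 := Lhat_gt0 t.
rewrite {2 3}/Lh (sg_Lhat sg) -/(Lh t); have -> : Num.max (Lh t) (Lbar (st t.+1)) = Lbar (st t.+1).
  by apply/max_idPr; move: h; rewrite -/(Lh t); lra.
by split.
Qed.

Lemma restart1 : restart st 1 = false. Proof. by []. Qed.

Lemma segment1 : S 1 = 1%N.
Proof. by rewrite SS restart1 [S 0] (sg_segment0 sg). Qed.

Lemma seg_index1 : I 1 = 1%N.
Proof. by rewrite IS restart1 [I 0] (sg_index0 sg). Qed.

Lemma segment_nondecreasing t t' : (t <= t')%N -> (S t <= S t')%N.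
Proof.
elim: t' => [|t' IH]; first by rewrite leqn0 => /eqP ->.
rewrite leq_eqVlt => /orP[/eqP -> //|/IH] h.
by rewrite (leq_trans h)// SS; case: ifP.
Qed.

Lemma segment_gt0 t : (0 < S t)%N.
Proof. by rewrite (leq_trans _ (segment_nondecreasing (leq0n t)))// /S (sg_segment0 sg). Qed.

Lemma seg_index_gt0 t : (0 < I t.+1)%N.
Proof. by rewrite IS; case: ifP. Qed.

(** [t + 1 - S t - I t] counts the iterations of the completed segments that do
    not open a segment. *)
Lemma segment_index_le t : (S t + I t <= t.+1)%N.
Proof.
elim: t => [|t IH]; first by rewrite /S /I (sg_segment0 sg) (sg_index0 sg).
rewrite SS IS.
case: ifP => // [/andP[/= t1 _]|]; last by lia.
by case: t t1 IH => // t _; have := seg_index_gt0 t; lia.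
Qed.

Lemma segment_le t : (S t.+1 <= t.+1)%N.
Proof. by have := segment_index_le t.+1; have := seg_index_gt0 t; lia. Qed.

Lemma seg_index_le t : (I t <= t)%N.
Proof. by have := segment_index_le t; have := segment_gt0 t; lia. Qed.

(** Each new segment multiplies [Lhat] by more than 3/2. *)
Lemma Lhat_growth t t' : (t <= t')%N ->
  Lh t * (3 / 2) ^+ (S t' - S t) <= Lh t'.
Proof.
elim: t' => [|t' IH]; first by rewrite leqn0 => /eqP ->; rewrite subnn mulr1.
rewrite leq_eqVlt => /orP[/eqP -> |]; first by rewrite subnn mulr1.
rewrite ltnS => tt; have := IH tt; have := segment_nondecreasing tt.
rewrite SS; case: ifP => [/restart_Lhat[h _] Stt|_ _] h'.
  rewrite subSn// exprS mulrCA; apply: le_trans (ltW h).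
  by rewrite ler_pM2l// divr_gt0.
by apply: (le_trans h'); exact: Lhat_nondecreasing.
Qed.

Lemma weight_restart t : restart st t.+1 -> weight st t.+1 = 0.
Proof. by move=> r; rewrite /weight (sg_index sg) r. Qed.

Lemma weight1 : weight st 1 = 0.
Proof. by rewrite /weight (sg_index sg) restart1 (sg_index0 sg). Qed.

Lemma weight_continue t : ~~ restart st t.+2 ->
  weight st t.+2 = 3 * (I t.+1).+1%:R / 16 - 1 / 4.
Proof.
move=> /negbTE r; rewrite /weight (sg_index sg) r.
by rewrite -/(I t.+1) ltnS seg_index_gt0.
Qed.

Lemma weight_ge0 t : 0 <= weight st t.
Proof.
rewrite /weight; case: ifP => // h.
have : 2%:R <= (seg_index (st t))%:R :> R by rewrite ler_nat.
by lra.
Qed.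

Lemma weight_gam_ge0 t : 0 <= weight st t / gam st t.
Proof. by rewrite mulr_ge0 ?weight_ge0// invr_ge0 ltW// gam_gt0. Qed.

Lemma weight_sum_ge0 k : 0 <= weight_sum st k.
Proof. by apply: sumr_ge0 => t _; exact: weight_gam_ge0. Qed.

Lemma weight_sum0 : weight_sum st 0 = 0.
Proof. by rewrite /weight_sum big_geq. Qed.

Lemma weight_sumS k :
  weight_sum st k.+1 = weight_sum st k + weight st k.+1 / gam st k.+1.
Proof. by rewrite /weight_sum big_nat_recr. Qed.

(** The weights of a segment of length [a + 1] sum to [a (3 a + 1) / 32], and
    [a (3 a + 1)] is superadditive in [a]. *)
Lemma sum_weight_le k : let y : R := k.+1%:R - (S k.+1)%:R in
  \sum_(1 <= t < k.+2) weight st t <= y * (3 * y + 1) / 32.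
Proof.
elim: k => [|k IH]; cbv zeta.
  by rewrite big_nat1 weight1 segment1 subrr !mul0r.
rewrite big_nat_recr//=; move: IH; cbv zeta; set z := (k.+1)%:R - _ => IH.
have [r|r] := boolP (restart st k.+2).
  rewrite weight_restart// addr0 (_ : _ - _ = z)//.
  rewrite SS r /z -[k.+2]addn1 -[(S _).+1]addn1 !natrD.
  by ring.
rewrite weight_continue// SS (negbTE r).
have -> : k.+2%:R - (S k.+1)%:R = z + 1 :> R.
  by rewrite /z -[k.+2]addn1 natrD; ring.
have : (I k.+1)%:R <= z + 1.
  rewrite /z addrAC lerBrDr natr1 -natrD ler_nat.
  by have := segment_index_le k.+1; lia.
rewrite -[(I k.+1).+1]addn1 natrD; move: ((I k.+1)%:R) IH => i IH hi.
have := lerD IH (lexx (3 * (i + 1) / 16 - 1 / 4)) => h.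
by apply: (le_trans h); lra.
Qed.

(** In a segment of length [a + 1] preceded by [Y] non-opening iterations,
    [M >= (3/2 Y^2 + a (3 a + 1)) / (128 Lhat)]: the factor 3/2 is the growth of
    [Lhat] at the beginning of the segment. The bound follows from
    [(Y + a)^2 <= 3/2 Y^2 + 3 a^2]. *)
Lemma weight_sum_ge k : (0 < k)%N ->
  (k%:R - (S k)%:R) ^+ 2 / (128 * Lh k.-1) <= weight_sum st k.
Proof.
case: k => // k _; rewrite /=.
pose a t : R := (I t)%:R - 1.
pose Y t : R := t%:R - (S t)%:R - a t.
have aY t : 0 <= a t.+1 /\ 0 <= Y t.+1.
  have := seg_index_gt0 t; have := segment_index_le t.+1.
  rewrite /Y /a -(ler_nat R) -[t.+2]addn1 !natrD => h1; rewrite -(ler_nat R) => h2.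
  by split; lra.
suff [_] : 3 / 2 * Y k.+1 ^+ 2 + a k.+1 * (3 * a k.+1 + 1)
      <= 128 * Lh k.+1 * weight_sum st k.+1 /\
    (Y k.+1 + a k.+1) ^+ 2 <= 128 * Lh k * weight_sum st k.+1.
  rewrite ler_pdivrMr ?mulr_gt0 ?Lhat_gt0// => h.
  by rewrite mulrC; apply: le_trans h; rewrite /Y subrK.
elim: k => [|k [IH1 IH2]].
  rewrite weight_sumS weight_sum0 weight1 mul0r addr0 !mulr0.
  by rewrite /Y /a seg_index1 segment1; split; rewrite le_eqVlt; apply/orP; left; apply/eqP; ring.
have [a0 Y0] := aY k; have L0 := Lhat_gt0 k.+1; have M0 := weight_sum_ge0 k.+1.
have [r|r] := boolP (restart st k.+2).
  have -> : a k.+2 = 0 by rewrite /a IS r subrr.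
  have -> : Y k.+2 = Y k.+1 + a k.+1.
    rewrite /Y /a SS IS r.
    rewrite -[k.+2]addn1 -[(S _).+1]addn1 !natrD; ring.
  have [h _] := restart_Lhat r.
  rewrite weight_sumS weight_restart//.
  have h2 : (Y k.+1 + a k.+1) ^+ 2 <= 128 * Lh k.+1 * weight_sum st k.+1.
    apply: (le_trans IH2); rewrite ler_wpM2r// ler_pM2l//.
    exact: Lhat_nondecreasing.
  split; last by rewrite mul0r !addr0.
  rewrite !mul0r !addr0; have : 3 / 2 * (128 * Lh k.+1 * weight_sum st k.+1) <=
      128 * Lh k.+2 * weight_sum st k.+1.
    by rewrite !mulrA ler_wpM2r//; lra.
  by lra.
have -> : a k.+2 = a k.+1 + 1.
  by rewrite /a IS (negbTE r) -[(I _).+1]addn1 natrD; ring.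
have -> : Y k.+2 = Y k.+1.
  rewrite /Y /a SS IS (negbTE r).
  by rewrite -[k.+2]addn1 -[(I _).+1]addn1 !natrD; ring.
have wE : 128 * Lh k.+1 * weight_sum st k.+2 =
    128 * Lh k.+1 * weight_sum st k.+1 + (6 * a k.+1 + 4).
  rewrite weight_sumS weight_continue// /gam/= -/(Lh k.+1).
  rewrite /a -[(I k.+1).+1]addn1 natrD; field; rewrite gt_eqF//.
have h1 : 3 / 2 * Y k.+1 ^+ 2 + (a k.+1 + 1) * (3 * (a k.+1 + 1) + 1) <=
    128 * Lh k.+1 * weight_sum st k.+2.
  by rewrite wE; lra.
split.
  apply: (le_trans h1); rewrite ler_wpM2r ?weight_sum_ge0// ler_pM2l//.
  exact: Lhat_nondecreasing.
apply: le_trans h1.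
have := sqr_ge0 (Y k.+1 - 2 * (a k.+1 + 1)).
by nra.
Qed.

End Segments.

Section SegmentSums.
Context {R : realType} {n : nat}.
Variable st : nat -> state R n.
Hypothesis sg : segmented st.

Let S t := segment (st t).
Let I t := seg_index (st t).

Let SS t : S t.+1 = if restart st t.+1 then (S t).+1 else S t.
Proof. exact: sg_segment sg t. Qed.

Let IS t : I t.+1 = if restart st t.+1 then 1%N else (I t).+1.
Proof. exact: sg_index sg t. Qed.

Lemma seg_lenS k i : seg_len st k.+1 i = (seg_len st k i + (S k.+1 == i))%N.
Proof. by rewrite /seg_len -[X in iota _ X]addn1 iotaD count_cat /= addn0. Qed.

Lemma seg_len_future k i : (S k < i)%N -> seg_len st k i = 0%N.
Proof.
move=> ki; apply/eqP; rewrite -leqn0 leqNgt -has_count; apply/hasPn => t.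
rewrite mem_iota => /andP[_ tk]; apply/negP => /eqP st_i.
have tk' : (t <= k)%N by lia.
by have := segment_nondecreasing sg tk'; rewrite st_i; move: ki; rewrite /S; lia.
Qed.

Lemma seg_len_last k : seg_len st k.+1 (S k.+1) = I k.+1.
Proof.
elim: k => [|k IH].
  by rewrite seg_lenS eqxx /seg_len/= IS restart1 [I 0](sg_index0 sg).
rewrite seg_lenS eqxx addn1 SS IS; case: ifP => r; last by rewrite IH.
by rewrite seg_len_future.
Qed.

Lemma seg_lookup k i j : (0 < i <= S k.+1)%N -> (0 < j <= seg_len st k.+1 i)%N ->
  has (fun t => (S t == i) && (I t == j)) (iota 0 k.+2).
Proof.
move=> /andP[i0 iS] /andP[j0 jl].
suff [t [tk <- <-]] : exists t, [/\ (t <= k.+1)%N, S t = i & I t = j].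
  by apply/hasP; exists t; rewrite ?eqxx// mem_iota; lia.
elim: k iS jl => [|k IH] iS jl.
  have Ei : i = S 1 by move: iS; rewrite SS restart1 [S 0](sg_segment0 sg); lia.
  exists 1%N; split => //.
  by move: jl; rewrite Ei seg_len_last IS restart1 [I 0](sg_index0 sg); lia.
have [/eqP iSk|iSk] := boolP (i == S k.+2).
  have [jI|jI] := eqVneq j (I k.+2); first by exists k.+2.
  have jlt : (j < I k.+2)%N by move: jl; rewrite iSk seg_len_last; lia.
  move: jlt iSk; rewrite IS SS; case: ifP => r; first by lia.
  move=> jlt iSk; have [|//|t [tk h1 h2]] := IH.
  - by rewrite iSk.
  - by rewrite iSk seg_len_last.
  by exists t; split => //; lia.
have iS' : (i <= S k.+1)%N by move: iS iSk; rewrite SS; case: ifP => _; lia.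
move: jl; rewrite seg_lenS eq_sym (negbTE iSk) addn0 => jl.
by have [t [tk h1 h2]] := IH iS' jl; exists t; split => //; lia.
Qed.

Lemma seg_gamS k i j : (0 < i <= S k.+1)%N -> (0 < j <= seg_len st k.+1 i)%N ->
  seg_gam st k.+2 i j = seg_gam st k.+1 i j.
Proof.
move=> hi hj; rewrite /seg_gam -[X in iota _ X]addn1 iotaD find_cat.
by rewrite (seg_lookup hi hj).
Qed.

Lemma seg_lex t t' : (t < t')%N ->
  (S t < S t')%N \/ S t = S t' /\ (I t < I t')%N.
Proof.
elim: t' => // t' IH; rewrite ltnS leq_eqVlt => /orP[/eqP ->|/IH h].
  by rewrite SS IS; case: ifP => _; [left|right].
rewrite SS IS; case: ifP => _; case: h => [h|[<- h]].
- by left; rewrite ltnS ltnW.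
- by left.
- by left.
- by right; rewrite ltnS ltnW.
Qed.

Lemma seg_gam_last k : seg_gam st k (S k) (I k) = gam st k.
Proof.
rewrite /seg_gam -[X in iota _ X]addn1 iotaD find_cat size_iota /= -/(S k) -/(I k).
rewrite !eqxx addn0; case: ifP => // /hasP[t]; rewrite mem_iota => tk /andP[/eqP h1 /eqP h2].
have tk' : (t < k)%N by lia.
by have := seg_lex tk'; rewrite /S /I h1 h2 !ltnn => -[|[]].
Qed.

(** The pairs (segment, index within the segment) enumerate the iterations, so
    the double sum over segments is the sum of the weights along the run. *)
Lemma segment_sum k : (0 < k)%N -> M_ st k = weight_sum st k.
Proof.
case: k => // k _; elim: k => [|k IH].
  rewrite weight_sumS weight_sum0 weight1// mul0r addr0 /M_ /nseg.
  rewrite (segment1 sg) big_nat1 big_geq// (_ : seg_len st 1 1 = 1%N)//.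
  by have := seg_len_last 0; rewrite /S /I segment1// seg_index1.
rewrite weight_sumS -IH /M_ /nseg -/(S k.+2) -/(S k.+1).
have old i : (1 <= i < (S k.+1).+1)%N ->
    \sum_(2 <= t < (seg_len st k.+1 i).+1) (3 * t%:R / 16 - 1 / 4) / seg_gam st k.+2 i t =
    \sum_(2 <= t < (seg_len st k.+1 i).+1) (3 * t%:R / 16 - 1 / 4) / seg_gam st k.+1 i t.
  move=> hi; apply: eq_big_nat => t ht; congr (_ / _).
  by apply: seg_gamS; lia.
have [r|r] := boolP (restart st k.+2).
  rewrite weight_restart// mul0r addr0.
  rewrite SS r big_nat_recr//= [X in _ + X]big_geq ?addr0; last first.
    by have := seg_len_last k.+1; rewrite SS IS r => ->.
  apply: eq_big_nat => i hi; rewrite seg_lenS SS r.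
  have /negbTE -> : (S k.+1).+1 != i by lia.
  by rewrite addn0 old.
have Sk : (0 < S k.+1)%N by exact: segment_gt0.
have SE : S k.+2 = S k.+1 by rewrite SS (negbTE r).
rewrite SE big_nat_recr//= [in RHS]big_nat_recr//= -addrA; congr (_ + _).
  apply: eq_big_nat => i hi; rewrite seg_lenS SE.
  have /negbTE -> : S k.+1 != i by lia.
  by rewrite addn0 old//; lia.
rewrite seg_lenS SE eqxx addn1 seg_len_last.
have I0 : (0 < I k.+1)%N by exact: seg_index_gt0.
rewrite big_nat_recr/=; last by lia.
congr (_ + _).
  by have := old (S k.+1); rewrite seg_len_last; apply; lia.
rewrite weight_continue//; congr (_ / _).
by have := seg_gam_last k.+2; rewrite SE IS (negbTE r).
Qed.

End SegmentSums.

(** * The potential argument along one run *)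

Lemma dotp_sqD (R : realType) (n : nat) (v w : 'rV[R]_n) :
  dotp (v + w) (v + w) = dotp w w + 2 * dotp v w + dotp v v.
Proof. by rewrite dotpDl !dotpDr (dotpC w v); ring. Qed.

Section OneStep.
Context {R : realType} {n : nat}.
Variables (X : set 'rV[R]_n) (f : 'rV[R]_n -> R) (df : 'rV[R]_n -> 'rV[R]_n)
  (L l : R).
Hypothesis hp : smooth_problem X f df L l.
Variables (x g u : 'rV[R]_n) (gamma : R).
Hypotheses (Xx : X x) (Xu : X u) (gamma_gt0 : 0 < gamma).

Let x' := prox X x g gamma.
Let dlt := g - df x.
Let dx := x' - x.
Let E := dotp (x - u) (x - u).
Let E' := dotp (x' - u) (x' - u).

Let Xx' : X x'. Proof. exact: prox_in (sp_compact hp) _. Qed.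

Lemma step_descent :
  f x' - f x <= bregman f df x' x - gamma * dotp dx dx - dotp dlt dx.
Proof.
have := prox_variational g (sp_convex hp) (sp_compact hp) Xx gamma_gt0 Xx.
rewrite -/x' -/dx -[x - x']opprB -/dx dotpNr dotpDl dotpZl.
have -> : dotp g dx = dotp dlt dx + dotp (df x) dx by rewrite -dotpDl subrK.
by rewrite /bregman -/dx; lra.
Qed.

(** The first-order condition of the step tested at [u]; the distances to [u]
    telescope, and [l] accounts for the lack of convexity. *)
Lemma step_gap : f x' - f u <= bregman f df x' x + gamma / 2 * (E - E')
    - gamma / 2 * dotp dx dx - dotp dlt dx - dotp dlt (x - u)
    + l / 2 * diam X ^+ 2.
Proof.
have hu : dotp (g + gamma *: dx) (dx + (x - u)) <= 0.
  rewrite -oppr_ge0 -dotpNr.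
  have -> : - (dx + (x - u)) = u - x' by apply/rowP => i; rewrite !mxE; ring.
  exact: (prox_variational g (sp_convex hp) (sp_compact hp) Xx gamma_gt0 Xu).
have hl : - (l / 2) * E <= f u - f x + dotp (df x) (x - u).
  rewrite -[x - u]opprB dotpNr; have := sp_lower hp Xu Xx; rewrite enorm_sqr.
  have -> : dotp (u - x) (u - x) = E.
    by rewrite /E -[u - x]opprB dotpNl dotpNr opprK.
  by [].
have EE : E' = E + 2 * dotp dx (x - u) + dotp dx dx.
  rewrite /E' (_ : x' - u = dx + (x - u)); last first.
    by apply/rowP => i; rewrite !mxE; ring.
  exact: dotp_sqD.
have ED : l * E <= l * diam X ^+ 2.
  by rewrite ler_wpM2l ?(sp_l_ge0 hp)// sqdist_le_diam//; exact: sp_compact hp.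
have gE : g = dlt + df x by rewrite subrK.
move: hu; rewrite {1}gE (dotpDl (dlt + df x)) (dotpDl dlt (df x)) dotpZl.
rewrite !(dotpDr dx (x - u)) /bregman -/dx EE; clearbody E dx dlt.
by move: hl ED; lra.
Qed.

(** The exact step from [x] differs from the stochastic one by at most the error of
    the gradient, since steps are Lipschitz in the gradient. *)
Lemma step_proj_grad :
  enorm (proj_grad X x (df x) gamma) ^+ 2
    <= 2 * gamma ^+ 2 * dotp dx dx + 2 * dotp dlt dlt.
Proof.
set p := proj_grad _ _ _ _.
have -> : p = - (gamma *: dx) + (p - proj_grad X x g gamma).
  apply/rowP => i; rewrite /p /proj_grad /dx /x' !mxE; ring.
rewrite enorm_sqr; apply: (le_trans (dotp_sumsq_le _ _)); apply: lerD.
  by rewrite dotpNl dotpNr opprK dotpZl dotpZr expr2 !mulrA.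
rewrite ler_pM2l// -enorm_sqr -[X in _ <= X]enorm_sqr.
rewrite ler_sqr ?nnegrE ?enorm_ge0// /dlt enormB.
rewrite -[X in _ <= X]enormN opprB enormB.
by apply: proj_grad_lipschitz => //; [exact: sp_convex hp|exact: sp_compact hp].
Qed.

Let noise_dx c : 0 < c -> - dotp dlt dx <= c / 2 * dotp dx dx + dotp dlt dlt / (2 * c).
Proof.
move=> c0; rewrite -dotpNl (dotpC _ dx).
apply: (le_trans (ler_norm _)); apply: (le_trans (dotp_young _ _ c0)).
by rewrite dotpNl dotpNr opprK.
Qed.

(** The descent inequality with weight [i] plus the gap inequality with weight
    one; the constant 11/8 is [1 + 3/8], the cost of Young's inequality plus that
    of replacing the stochastic step by the exact one. *)
Lemma step_continue (i C : R) : 1 <= i ->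
  (i + 1) * bregman f df x' x <= (i + 1) * (3 * gamma / 8) * dotp dx dx + C ->
  (3 * (i + 1) / 16 - 1 / 4) / gamma * enorm (proj_grad X x (df x) gamma) ^+ 2
      + (i + 1) * (f x' - f u)
    <= i * (f x - f u) + gamma / 2 * (E - E') + l / 2 * diam X ^+ 2
      + (11 * i / 8 + 7 / 8) / gamma * dotp dlt dlt - dotp dlt (x - u) + C.
Proof.
move=> i1 hC; set W := 3 * (i + 1) / 16 - 1 / 4.
have W0 : 0 <= W by rewrite /W; lra.
have h1 : W / gamma * enorm (proj_grad X x (df x) gamma) ^+ 2 <=
    2 * W * gamma * dotp dx dx + 2 * W / gamma * dotp dlt dlt.
  have -> : 2 * W * gamma * dotp dx dx + 2 * W / gamma * dotp dlt dlt =
     W / gamma * (2 * gamma ^+ 2 * dotp dx dx + 2 * dotp dlt dlt).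
    by field; rewrite gt_eqF.
  by rewrite ler_wpM2l ?step_proj_grad// divr_ge0// ltW.
have h2 : i * (f x' - f x) <=
    i * (bregman f df x' x - gamma * dotp dx dx - dotp dlt dx).
  by rewrite ler_wpM2l ?step_descent//; lra.
have h3 := step_gap.
have g2 : 0 < gamma / 2 by rewrite divr_gt0.
have h4 : - ((i + 1) * dotp dlt dx) <= (i + 1) * (gamma / 4 * dotp dx dx + dotp dlt dlt / gamma).
  rewrite -mulrN ler_wpM2l//; first by lra.
  apply: (le_trans (noise_dx g2)); rewrite le_eqVlt; apply/orP; left; apply/eqP.
  by field; rewrite gt_eqF.
have -> : (11 * i / 8 + 7 / 8) / gamma * dotp dlt dlt =
   2 * W / gamma * dotp dlt dlt + (i + 1) * (dotp dlt dlt / gamma).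
  by rewrite /W; field; rewrite gt_eqF.
move: h1; set w := 2 * W / gamma * dotp dlt dlt; rewrite /W; set pg := _ / gamma * _ => h1.
move: h4; set q := dotp dlt dlt / gamma => h4; clearbody w q pg.
have -> : f x' - f u = f x' - f x + (f x - f u) by ring.
by nra.
Qed.

Lemma step_start :
  f x' - f u <= bregman f df x' x + gamma / 2 * (E - E')
    + l / 2 * diam X ^+ 2 + (1 / 2) / gamma * dotp dlt dlt - dotp dlt (x - u).
Proof.
have h3 := step_gap.
have := noise_dx gamma_gt0.
have -> : (1 / 2) / gamma * dotp dlt dlt = dotp dlt dlt / (2 * gamma).
  by field; rewrite gt_eqF.
by lra.
Qed.

(** At a restart the error of a step counts with the weight of the old segment but
    the gap with that of the new one; this bounds the difference. *)
Lemma step_noise_gap : - dotp dlt (x - u) <=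
  gamma / 4 * diam X ^+ 2 + dotp dlt dlt / gamma.
Proof.
have g2 : 0 < gamma / 2 by rewrite divr_gt0.
have := dotp_young (x - u) (- dlt) g2; rewrite dotpNr (dotpC _ dlt) dotpNl dotpNr opprK.
move=> h; apply: (le_trans (ler_norm _)); apply: (le_trans h); apply: lerD.
  have -> : gamma / 2 / 2 = gamma / 4 by field.
  by rewrite ler_wpM2l ?sqdist_le_diam//; [rewrite divr_ge0// ltW|exact: sp_compact hp].
rewrite le_eqVlt; apply/orP; left; apply/eqP.
by field; rewrite gt_eqF.
Qed.

End OneStep.

Section Potential.
Context {R : realType} {n : nat}.
Variables (X : set 'rV[R]_n) (f : 'rV[R]_n -> R) (df : 'rV[R]_n -> 'rV[R]_n)
  (L l : R).
Hypothesis hp : smooth_problem X f df L l.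
Variables (st : nat -> state R n) (ghat : nat -> 'rV[R]_n).
Hypothesis sg : segmented st.
Hypothesis x0X : X (iterate (st 0%N)).
Hypothesis stepE : forall t,
  iterate (st t.+1) = prox X (iterate (st t)) (ghat t.+1) (gam st t.+1).

Definition grad_error t := ghat t - df (iterate (st t.-1)).
Definition move t := iterate (st t) - iterate (st t.-1).
Definition step_curv t := bregman f df (iterate (st t)) (iterate (st t.-1)).

(** The batch sizes are [alpha] times this coefficient, rounded up. *)
Definition noise_coef t : R :=
  (11 * (seg_index (st t.-1))%:R / 8 + 7 / 8) / gam st t.

Definition weighted_pg t : R :=
  weight st t / gam st t
  * enorm (proj_grad X (iterate (st t.-1)) (df (iterate (st t.-1))) (gam st t)) ^+ 2.

Lemma iterate_in t : X (iterate (st t)).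
Proof.
by elim: t => // t IH; rewrite stepE; exact: prox_in (sp_compact hp) IH.
Qed.

Lemma weighted_pg_ge0 t : 0 <= weighted_pg t.
Proof. by rewrite mulr_ge0 ?sqr_ge0// weight_gam_ge0. Qed.

(** Both estimators satisfy [curvature_control]: [C t] is what the true curvature
    of a step may exceed its estimate by, and [chi] is 1 or 0 according to
    whether this excess is charged to the length of the segment that ends. *)
Record curvature_control (Om : nat -> R) (hatL chi : R) (C : nat -> R) (k : nat) := {
  cc_continue : forall t, (t.+2 <= k)%N -> ~~ restart st t.+2 ->
    ((seg_index (st t.+1))%:R + 1) * step_curv t.+2
    <= ((seg_index (st t.+1))%:R + 1) * (3 * gam st t.+2 / 8)
         * dotp (move t.+2) (move t.+2) + C t.+2;
  cc_first : (1 <= k)%N ->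
    step_curv 1 <= 2 * Lhat (st 1%N) * diam X ^+ 2 / 2 + C 1%N;
  cc_restart : forall t, (t.+2 <= k)%N -> restart st t.+2 ->
    Om (segment (st t.+2)) * step_curv t.+2
    <= Om (segment (st t.+2)) *
         (2 * Lhat (st t.+2) + chi * ((seg_index (st t.+1))%:R - 1) * hatL)
         * diam X ^+ 2 / 2
       + Om (segment (st t.+1)) * C t.+2
}.

Variables (u : 'rV[R]_n) (Om : nat -> R) (hatL chi : R) (C : nat -> R) (k : nat).
Hypotheses (Xu : X u) (umin : forall x, X x -> f u <= f x).
Hypotheses (Om_gt0 : forall i, 0 < Om i).
Hypotheses (Om_growth : forall i, (0 < i < k)%N -> Om i <= Om i.+1 <= 13 / 12 * Om i).
Hypotheses (chi_ge0 : 0 <= chi) (hatL_ge0 : 0 <= hatL).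
Hypothesis cc : curvature_control Om hatL chi C k.

Definition noise t : R := Om (segment (st t.-1)) *
  (noise_coef t * dotp (grad_error t) (grad_error t)
   - dotp (grad_error t) (iterate (st t.-1) - u) + C t).

Let S t := segment (st t).
Let I t := seg_index (st t).
Let x t := iterate (st t).
Let E t := dotp (x t - u) (x t - u).
Let D2 := diam X ^+ 2.

Let SS t : S t.+1 = if restart st t.+1 then (S t).+1 else S t.
Proof. exact: sg_segment sg t. Qed.

Let IS t : I t.+1 = if restart st t.+1 then 1%N else (I t).+1.
Proof. exact: sg_index sg t. Qed.

(** The bound for the potential collects the distances to [u], telescoped with the
    increasing stepsizes, the cost of opening the segments, and the concavity.
    With [chi = 1] the iterations of the completed segments are charged as well,
    those that open a segment excepted. *)
Definition budget t : R :=
  gam st t / 2 * (D2 - E t)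
  + D2 / 2 * (19 / 3 * Lhat (st t) + chi * (t%:R - (S t)%:R - (I t)%:R + 1) * hatL)
  + t%:R * (l / 2 * D2).

Let D2_ge0 : 0 <= D2. Proof. exact: sqr_ge0. Qed.

Let ED t : E t <= D2.
Proof. exact: (sqdist_le_diam (sp_compact hp) (iterate_in t) Xu). Qed.

Let count_ge0 t : 0 <= t.+1%:R - (S t.+1)%:R - (I t.+1)%:R + 1 :> R.
Proof.
have := segment_index_le sg t.+1; rewrite -(ler_nat R) natrD -[t.+2]addn1 natrD.
by rewrite -/(S _) -/(I _); lra.
Qed.

Let gam_S t : gam st t.+1 = 4 * Lhat (st t). Proof. by []. Qed.

Let natS (m : nat) : m.+1%:R = m%:R + 1 :> R. Proof. by rewrite natr1. Qed.

Let budget_ge0 t : 0 <= budget t.+1.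
Proof.
have := gam_gt0 sg t.+1; have := Lhat_gt0 sg t.+1; have := ED t.+1; have := count_ge0 t.
have := sp_l_ge0 hp => l0 c0 E0 L0 g0.
apply: addr_ge0; last by rewrite mulr_ge0// mulr_ge0// divr_ge0.
apply: addr_ge0; first by rewrite mulr_ge0 ?subr_ge0// divr_ge0// ltW.
apply: mulr_ge0; first by rewrite divr_ge0.
by apply: addr_ge0; [rewrite mulr_ge0// ltW|rewrite !mulr_ge0].
Qed.

(** The gap is weighted by the index in the segment and hence starts afresh at a
    restart. The [1/3] in [19/3 = 6 + 1/3] pays for the change of the weight [Om] at a
    restart, where the gap inequality is used with the new weight although the
    sampling error of that step is only centred for the old one. *)
Lemma potential t : (t.+1 <= k)%N ->
  \sum_(1 <= s < t.+2) Om (S s) * weighted_pg s + Om (S t.+1) * (I t.+1)%:R * (f (x t.+1) - f u)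
    <= Om (S t.+1) * budget t.+1 + \sum_(1 <= s < t.+2) noise s.
Proof.
elim: t => [|t IH] tk.
  have := step_start hp (ghat 1) (iterate_in 0) Xu (gam_gt0 sg 1).
  rewrite -stepE => h; have hC := cc_first cc tk.
  rewrite !big_nat1 /weighted_pg weight1// !mul0r mulr0 add0r.
  rewrite /I (seg_index1 sg) mulr1 /noise /= (sg_segment0 sg) /S (segment1 sg).
  rewrite -mulrDr ler_pM2l//; apply: (le_trans h).
  rewrite /budget /S /I (segment1 sg) (seg_index1 sg) subrr sub0r addNr mulr0 mul0r addr0 mul1r.
  move: hC; rewrite /step_curv/= -/(x 1) -/(x 0) => hC.
  have h1 : gam st 1 / 2 * (E 0 - E 1) <= gam st 1 / 2 * (D2 - E 1).
    by rewrite ler_wpM2l ?lerB// divr_ge0// ltW// gam_gt0.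
  have h2 : 0 <= D2 / 2 * (13 / 3 * Lhat (st 1%N)).
    have := Lhat_gt0 sg 1 => L1.
    by apply: mulr_ge0; [rewrite divr_ge0|apply: mulr_ge0 => //; exact: ltW].
  have h3 : 1 / 2 / gam st 1 * dotp (grad_error 1) (grad_error 1) <=
     noise_coef 1 * dotp (grad_error 1) (grad_error 1).
    rewrite ler_wpM2r ?dotp_ge0// /noise_coef/= (sg_index0 sg) ler_pM2r; first by lra.
    by rewrite invr_gt0 gam_gt0.
  rewrite -/(x 1) -/(x 0) -/(E 0) -/(E 1) -/D2 -/(grad_error 1) in h1 h2 h3 hC *.
  by move: (noise_coef 1) h3 => nc h3; lra.
have {IH} IH := IH (ltnW tk).
rewrite big_nat_recr//= [X in _ <= _ + X]big_nat_recr//= {2}/noise/=.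
have g0 := gam_gt0 sg t.+2; have I1 := seg_index_gt0 sg t.
have Xx := iterate_in t.+1.
have i1 : 1 <= (I t.+1)%:R :> R by rewrite ler1n.
set err := grad_error t.+2; set nc := noise_coef t.+2.
have gap0 : 0 <= f (x t.+1) - f u by rewrite subr_ge0 umin.
have ncE : noise_coef t.+2 = (11 * (I t.+1)%:R / 8 + 7 / 8) / gam st t.+2 by [].
have gam_mono : gam st t.+1 / 2 * (D2 - E t.+1) <= gam st t.+2 / 2 * (D2 - E t.+1).
  by rewrite ler_wpM2r ?subr_ge0// ler_pM2r ?invr_gt0// gam_nondecreasing.
have [r|r] := boolP (restart st t.+2); last first.
  have := step_continue hp (g := ghat t.+2) Xx Xu g0 i1 (C := C t.+2).
  rewrite -stepE -/(step_curv t.+2) => /(_ (cc_continue cc tk r)).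
  rewrite -/(x t.+1) -/(x t.+2) -/(E t.+1) -/(E t.+2) -/D2 -ncE -/(grad_error t.+2) -/err.
  have -> : (3 * ((I t.+1)%:R + 1) / 16 - 1 / 4) / gam st t.+2
      * enorm (proj_grad X (x t.+1) (df (x t.+1)) (gam st t.+2)) ^+ 2 = weighted_pg t.+2.
    by rewrite /weighted_pg weight_continue// (natS (I t.+1)).
  rewrite -/nc => h; rewrite (SS t.+1) (IS t.+1) (negbTE r) (natS (I t.+1)).
  set w := Om _; have w0 : 0 < w by exact: Om_gt0.
  have hb : budget t.+1 + gam st t.+2 / 2 * (E t.+1 - E t.+2) + l / 2 * D2 <= budget t.+2.
    rewrite /budget (SS t.+1) (IS t.+1) (negbTE r) (natS t.+1) (natS (I t.+1)).
    have : D2 / 2 * (19 / 3 * Lhat (st t.+1)) <= D2 / 2 * (19 / 3 * Lhat (st t.+2)).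
      by rewrite ler_wpM2l ?divr_ge0// ler_pM2l// Lhat_nondecreasing.
    by move: gam_mono; lra.
  have := ler_wpM2l (ltW w0) (le_trans h (lexx _)).
  have := ler_wpM2l (ltW w0) hb.
  move: IH; rewrite -/w; move: (budget t.+2) (budget t.+1) (\sum_(1 <= i < _) _).
  move=> b2 b1 sw; move: (\sum_(1 <= i < _) _) => sn.
  by lra.
have := step_start hp (ghat t.+2) Xx Xu g0.
rewrite -stepE -/(step_curv t.+2) -/(x t.+1) -/(x t.+2) -/(E t.+1) -/(E t.+2) -/D2
  -/(grad_error t.+2) -/err => h.
have := step_noise_gap hp (ghat t.+2) Xx Xu g0.
rewrite -/(grad_error t.+2) -/err -/(x t.+1) -/D2 => hgap.
have hC := cc_restart cc tk r; have [Lgrow _] := restart_Lhat sg r.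
have hw : (0 < segment (st t.+1) < k)%N.
  rewrite (segment_gt0 sg)/=; apply: leq_trans tk.
  by rewrite ltnS; exact: segment_le.
have /andP[Om1 Om2] := Om_growth hw.
have wz : weighted_pg t.+2 = 0 by rewrite /weighted_pg weight_restart// !mul0r.
rewrite wz mulr0 addr0 (SS t.+1) (IS t.+1) r mulr1.
rewrite -/(S t.+1) in hC Om1 Om2 *; rewrite -/(S t.+2) (SS t.+1) r in hC.
move: (Om_gt0 (S t.+1)) (Om_gt0 (S t.+1).+1) Om1 Om2 IH hC.
move: (Om (S t.+1)) (Om (S t.+1).+1) => w w' w0 w'0 ww' w'w IH hC.
have hb : budget t.+1 + gam st t.+2 / 2 * (E t.+1 - E t.+2) + l / 2 * D2
    + (2 * Lhat (st t.+2) + chi * ((I t.+1)%:R - 1) * hatL) * D2 / 2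
    + 1 / 12 * (gam st t.+2 / 4 * D2) <= budget t.+2.
  rewrite /budget (SS t.+1) (IS t.+1) r (natS t.+1) (natS (S t.+1)).
  have : D2 / 2 * (13 / 2 * Lhat (st t.+1)) <= D2 / 2 * (13 / 3 * Lhat (st t.+2)).
    by rewrite ler_wpM2l ?divr_ge0//; lra.
  by move: gam_mono; rewrite (gam_S t.+1); lra.
have b0 := budget_ge0 t.
have q0 : 0 <= dotp err err / gam st t.+2.
  by rewrite divr_ge0 ?dotp_ge0// ltW.
have nc0 : 9 / 4 * (dotp err err / gam st t.+2) <= nc * dotp err err.
  have -> : nc * dotp err err = (11 * (I t.+1)%:R / 8 + 7 / 8) * (dotp err err / gam st t.+2).
    by rewrite /nc ncE; ring.
  by rewrite ler_wpM2r//; lra.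
have qE : 1 / 2 / gam st t.+2 * dotp err err = 1 / 2 * (dotp err err / gam st t.+2).
  by ring.
rewrite qE in h.
move: h hgap; set q := dotp err err / _ in q0 nc0 *; set cr := dotp err (x t.+1 - u).
set e2 := nc * _ in nc0 *; set gD := gam st t.+2 / 4 * D2 in hb *.
have gD0 : 0 <= gD by rewrite mulr_ge0// divr_ge0// ltW.
move=> h hgap.
have e1 : w' * (f (x t.+2) - f u) <= w' * (step_curv t.+2 + gam st t.+2 / 2 * (E t.+1 - E t.+2)
   + l / 2 * D2 + 1 / 2 * q - cr) by rewrite ler_pM2l.
have e3 : (w' - w) * - cr <= (w' - w) * (gD + q) by rewrite ler_wpM2l// subr_ge0.
(* The weights of neighbouring segments differ by at most a twelfth. *)
have e4 : (w' - w) * gD <= w' * (1 / 12 * gD).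
  by rewrite [w' * _]mulrA ler_wpM2r//; lra.
have e5 : w' * (1 / 2 * q) + (w' - w) * q <= w * e2.
  apply: (@le_trans _ _ (w * (9 / 4 * q))); last by rewrite ler_pM2l.
  rewrite (mulrA w') -mulrDl (mulrA w); apply: ler_wpM2r => //; lra.
have e6 : w * budget t.+1 <= w' * budget t.+1 by rewrite ler_wpM2r.
have e7 := ler_wpM2l (ltW w'0) hb.
have e8 : 0 <= w * (I t.+1)%:R * (f (x t.+1) - f u) by rewrite !mulr_ge0// ltW.
move: IH hC e1 e3 e4 e5 e6 e7 e8; rewrite -/D2 -/(I t.+1).
move: (budget t.+2) (budget t.+1) (\sum_(1 <= i < _) _).
move=> b2 b1 sw; move: (\sum_(1 <= i < _) _) => sn.
by lra.
Qed.

End Potential.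

(** * Failure probability of a run given its samples *)

Section CubeBound.
Context {R : realType}.

(** The maximum of [j^3 (2/3)^j] is attained at [j = 7] and is slightly above 20. *)
Lemma cube_le_exp (j : nat) : j%:R ^+ 3 <= 21 * (3 / 2) ^+ j :> R.
Proof.
have base (i : nat) : (i <= 7)%N -> i%:R ^+ 3 <= 21 * (3 / 2) ^+ i :> R.
  by do 8 (case: i => [_|i]; first by rewrite ?exprS ?expr0; lra).
have [/base//|] := leqP j 7; elim: j => // j IH.
rewrite ltnS leq_eqVlt => /orP[/eqP <-|j7].
  by rewrite !exprS !expr0; lra.
have := IH j7; rewrite [(3 / 2) ^+ j.+1]exprS -[j.+1%:R]natr1.
have : 8 <= j%:R :> R by rewrite ler_nat.
move: (j%:R) ((3 / 2) ^+ j) => x e x8 xe.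
have h : (x + 1) ^+ 3 <= 3 / 2 * x ^+ 3.
  have x0 : 0 <= x by lra.
  have x80 : 0 <= x - 8 by lra.
  have := mulr_ge0 x80 (mulr_ge0 x0 x0); have := mulr_ge0 x80 x0.
  rewrite exprSr expr2 [x ^+ 3]exprSr expr2; lra.
by lra.
Qed.

(** If a failing run has its first failing candidate [j] segments before the
    last, then the failing candidates carry a fraction [p] of the weight that
    decreases like [(2/3) ^ j], while the weights [Om] of the two segments
    differ only by the factor [(q + j + 2) / (q + 2)]. *)
Lemma late_failure (q y p : R) (j : nat) : 0 <= p -> 1 <= y -> 10 + y <= q ->
  p * q * (3 / 2) ^+ j <= 3 / 32 * (y * (3 * y + 1)) ->
  p * (1 - 4 / 3 * (q / (q + (j%:R + 2)))) <= 5 / 6 / (q + 2).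
Proof.
move=> p0 y1 qy pq.
have j0 : 0 <= j%:R :> R by [].
have s0 : 0 < q + (j%:R + 2) by lra.
have := cube_le_exp j; move: pq.
have : 1 <= (3 / 2 : R) ^+ j by apply: exprn_ege1; lra.
move: ((3 / 2) ^+ j) => r r1 pq jr.
have q2 : 0 < q + 2 by lra.
have [qj|qj] := leP (3 * (j%:R + 2)) q.
  apply: (@le_trans _ _ 0); last by rewrite divr_ge0// ltW.
  rewrite mulr_ge0_le0// subr_le0 mulrA ler_pdivlMr// mul1r.
  by lra.
have fE : 1 - 4 / 3 * (q / (q + (j%:R + 2))) = (3 * (j%:R + 2) - q) / (3 * (q + (j%:R + 2))).
  by field; rewrite gt_eqF.
set z := j%:R in j0 s0 jr qj fE *.
have zy : 0 < 3 * z - 4 - y by lra.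
have ff : (3 * (z + 2) - q) / (3 * (q + (z + 2))) <= (3 * z - 4 - y) / (3 * (12 + y + z)).
  rewrite ler_pdivrMr; last by lra.
  rewrite mulrAC ler_pdivlMr; last by lra.
  have : 0 <= (q - 10 - y) * (z + 2) by rewrite mulr_ge0//; lra.
  by nra.
have zge : 2 <= z.
  have : (1 < j)%N.
    rewrite ltnNge; apply/negP; rewrite -(ler_nat R) -/z => z1.
    by lra.
  by rewrite -(ler_nat R).
have amgm : y * (3 * y + 1) * (3 * z - 4 - y) <= 16 * z ^+ 3.
  apply: (@le_trans _ _ (4 * (y ^+ 2 * (3 * z - 4 - y)))).
    rewrite mulrA ler_pM2r//; nra.
  set c := 3 * z - 4; have c0 : 0 <= c by rewrite /c; lra.
  have : 27 * (y ^+ 2 * (c - y)) <= 4 * c ^+ 3.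
    have -> : 4 * c ^+ 3 = 27 * (y ^+ 2 * (c - y)) + (3 * y - 2 * c) ^+ 2 * (3 * y + c).
      by ring.
    by rewrite lerDl mulr_ge0 ?sqr_ge0//; lra.
  have : c ^+ 3 <= (3 * z) ^+ 3 by apply: lerXn2r; rewrite ?nnegrE//; rewrite /c; lra.
  by rewrite exprMn; lra.
have pqz : p * q * (3 * z - 4 - y) <= 63 / 2.
  have r0 : 0 < r by lra.
  rewrite -(ler_pM2r r0).
  have -> : p * q * (3 * z - 4 - y) * r = (p * q * r) * (3 * z - 4 - y) by ring.
  apply: (le_trans (ler_wpM2r (ltW zy) pq)).
  by rewrite -mulrA; lra.
rewrite fE ler_pdivlMr//.
apply: (@le_trans _ _ (p * ((3 * z - 4 - y) / (3 * (12 + y + z))) * (q + 2))).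
  by rewrite ler_pM2r// ler_wpM2l.
have -> : p * ((3 * z - 4 - y) / (3 * (12 + y + z))) * (q + 2) =
    (p * q * (3 * z - 4 - y)) * ((q + 2) / q) / (3 * (12 + y + z)).
  by field; apply/andP; split; rewrite gt_eqF//; lra.
rewrite ler_pdivrMr; last by lra.
have qq : (q + 2) / q <= 13 / 11 by rewrite ler_pdivrMr; lra.
have t0 : 0 <= p * q * (3 * z - 4 - y) by rewrite !mulr_ge0//; lra.
apply: (@le_trans _ _ (63 / 2 * (13 / 11))); last by lra.
by apply: ler_pM => //; rewrite divr_ge0//; lra.
Qed.

End CubeBound.

Section FailureProbability.
Context {R : realType} {n : nat}.
Variables (X : set 'rV[R]_n) (f : 'rV[R]_n -> R) (df : 'rV[R]_n -> 'rV[R]_n)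
  (L l : R).
Hypothesis hp : smooth_problem X f df L l.
Variables (st : nat -> state R n) (ghat : nat -> 'rV[R]_n).
Hypothesis sg : segmented st.
Hypothesis x0X : X (iterate (st 0%N)).
Hypothesis stepE : forall t,
  iterate (st t.+1) = prox X (iterate (st t)) (ghat t.+1) (gam st t.+1).

Definition sq_pg t : R :=
  enorm (proj_grad X (iterate (st t.-1)) (df (iterate (st t.-1))) (gam st t)) ^+ 2.

(** The candidate [t - 1] is too bad for the final bound. The factor 8/3 is
    what the last step of the proof leaves room for, see [selection_bound]. *)
Definition failing (k : nat) (q : R) t := 8 * q < 3 * (weight_sum st k * sq_pg t).

Definition failure_prob (k : nat) (q : R) : R :=
  \sum_(1 <= t < k.+1) output_prob st k t * (failing k q t)%:R.

Let wM k t : weight_sum st k != 0 ->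
  output_prob st k t * weight_sum st k = weight st t / gam st t.
Proof. by move=> M0; rewrite /output_prob mulrAC mulVf// mul1r. Qed.

Lemma output_prob_ge0 k t : 0 <= output_prob st k t.
Proof. by rewrite mulr_ge0 ?invr_ge0 ?weight_sum_ge0// weight_gam_ge0. Qed.

Lemma failure_prob_ge0 k q : 0 <= failure_prob k q.
Proof. by apply: sumr_ge0 => t _; rewrite mulr_ge0// output_prob_ge0. Qed.

Lemma failure_prob_degenerate k q : weight_sum st k = 0 -> failure_prob k q = 0.
Proof.
move=> M0; rewrite /failure_prob big1// => t _.
by rewrite /output_prob M0 invr0 !mul0r.
Qed.

(** Markov's inequality, with weights that increase along the run. *)
Lemma failure_prob_markov k q t0 (Om : nat -> R) :
  (forall t, (1 <= t <= k)%N -> failing k q t -> Om t0 <= Om t) ->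
  (forall t, 0 <= Om t) ->
  Om t0 * (8 / 3 * q) * failure_prob k q
    <= \sum_(1 <= t < k.+1) Om t * weighted_pg X df st t.
Proof.
move=> hOm Om0; have [M0|M0] := eqVneq (weight_sum st k) 0.
  rewrite failure_prob_degenerate// mulr0; apply: sumr_ge0 => t _.
  by rewrite mulr_ge0// weighted_pg_ge0.
have {}M0 : 0 < weight_sum st k by rewrite lt_neqAle eq_sym M0 weight_sum_ge0.
rewrite /failure_prob mulr_sumr big_nat [leRHS]big_nat.
apply: ler_sum => t tk.
have [ft|_] := boolP (failing k q t); last first.
  by rewrite !mulr0 mulr_ge0// weighted_pg_ge0.
rewrite mulr1; have := hOm t tk ft => h.
have pM := wM t (lt0r_neq0 M0); have p0 := output_prob_ge0 k t.
apply: (@le_trans _ _ (Om t0 * weighted_pg X df st t)).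
  rewrite -mulrA ler_wpM2l// /weighted_pg -/(sq_pg t) -pM.
  by move: ft; rewrite /failing; nra.
by rewrite ler_wpM2r// weighted_pg_ge0.
Qed.

Let D2 := diam X ^+ 2.

Lemma sq_pg_le t : sq_pg t <= gam st t ^+ 2 * D2.
Proof.
rewrite /sq_pg enorm_sqr /proj_grad dotpZl dotpZr mulrA -expr2.
rewrite ler_wpM2l ?sqr_ge0// sqdist_le_diam//; first exact: sp_compact hp.
  exact: (iterate_in hp x0X stepE).
by apply: prox_in (sp_compact hp) _; exact: (iterate_in hp x0X stepE).
Qed.

Variables (k : nat) (hatL q : R).
Hypothesis hatLk : Lhat (st k) <= hatL.
Hypothesis k0 : (0 < k)%N.

Let m := segment (st k).
Let y : R := k%:R - m%:R.
Let a : R := hatL * D2 / 2.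

(** Two bounds on the failing candidates are multiplied: their share is at most the
    total weight of the run divided by [M_k] and by the stepsize of the first of
    them, while [|g| <= gamma D] forces this stepsize to be large compared with
    [Q_k / M_k]. The product no longer contains [M_k], and the stepsize is at most
    [4 * hatL / (3/2)^j]. *)
Lemma first_failure_bound t0 : (1 <= t0 <= k)%N -> 0 < weight_sum st k ->
  failing k q t0 -> (forall t, (1 <= t <= k)%N -> failing k q t -> (t0 <= t)%N) ->
  failure_prob k q * q * (3 / 2) ^+ (m - segment (st t0))
    <= 3 / 32 * a * (y * (3 * y + 1)).
Proof.
move=> t0k M0 ft0 t0min; set p := failure_prob k q.
have p0 : 0 <= p by exact: failure_prob_ge0.
have g0 := gam_gt0 sg t0.
have pM : p * weight_sum st k * gam st t0 <= \sum_(1 <= t < k.+1) weight st t.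
  rewrite /p /failure_prob mulr_suml mulr_suml big_nat [leRHS]big_nat.
  apply: ler_sum => t tk; have w0 := weight_ge0 st t.
  have [ft|_] := boolP (failing k q t); last by rewrite mulr0 !mul0r.
  rewrite mulr1 (wM t (lt0r_neq0 M0)) mulrAC ler_pdivrMr ?gam_gt0//.
  by rewrite ler_wpM2l// gam_nondecreasing//; exact: t0min.
have W := sum_weight_le sg k.-1; rewrite prednK// -/m -/y in W.
have growth : gam st t0 * (3 / 2) ^+ (m - segment (st t0)) <= 4 * hatL.
  rewrite /gam -mulrA ler_pM2l//; apply: le_trans hatLk.
  have /andP[_ t0k'] := t0k.
  apply: le_trans (Lhat_growth sg t0k'); rewrite ler_wpM2r ?exprn_ge0//.
  by apply: Lhat_nondecreasing => //; exact: leq_pred.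
have D0 : 0 <= D2 by exact: sqr_ge0.
have key : p * (8 * q) <= p * (3 * (weight_sum st k * (gam st t0 ^+ 2 * D2))).
  rewrite ler_wpM2l//; apply: (le_trans (ltW ft0)).
  by rewrite ler_pM2l// ler_pM2l// sq_pg_le.
have {}W := le_trans pM W; clear pM.
set r := (3 / 2) ^+ _ in growth *.
have r0 : 0 <= r by rewrite exprn_ge0.
set Y := y * (3 * y + 1) in W *.
have Y0 : 0 <= Y.
  apply: le_trans (_ : 0 <= 32 * (Y / 32)) _; last by rewrite le_eqVlt; apply/orP; left; apply/eqP; field.
  rewrite mulr_ge0//; apply: le_trans W; by rewrite mulr_ge0 ?(ltW g0)// mulr_ge0 ?(ltW M0).
have key2 : p * (8 * q) * r <= 3 * (Y / 32) * (4 * hatL * D2).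
  apply: (@le_trans _ _ (3 * (p * weight_sum st k * gam st t0) * (gam st t0 * r * D2))).
    have -> : 3 * (p * weight_sum st k * gam st t0) * (gam st t0 * r * D2) =
       p * (3 * (weight_sum st k * (gam st t0 ^+ 2 * D2))) * r by ring.
    by rewrite ler_wpM2r.
  apply: ler_pM.
  - by rewrite mulr_ge0// mulr_ge0 ?(ltW g0)// mulr_ge0 ?(ltW M0).
  - exact: mulr_ge0 (mulr_ge0 (ltW g0) r0) D0.
  - by rewrite ler_pM2l.
  - by rewrite ler_wpM2r.
by move: key2; rewrite /a; lra.
Qed.

End FailureProbability.

Section FailureBounds.
Context {R : realType} {n : nat}.
Variables (X : set 'rV[R]_n) (f : 'rV[R]_n -> R) (df : 'rV[R]_n -> 'rV[R]_n)
  (L l : R).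
Hypothesis hp : smooth_problem X f df L l.
Variables (st : nat -> state R n) (ghat : nat -> 'rV[R]_n).
Hypothesis sg : segmented st.
Hypothesis x0X : X (iterate (st 0%N)).
Hypothesis stepE : forall t,
  iterate (st t.+1) = prox X (iterate (st t)) (ghat t.+1) (gam st t.+1).
Variables (u : 'rV[R]_n) (hatL sigma alpha : R) (C : nat -> R) (k : nat).
Hypotheses (Xu : X u) (umin : forall x, X x -> f u <= f x).
Hypotheses (hatL_ge0 : 0 <= hatL) (hatLk : Lhat (st k) <= hatL) (k0 : (0 < k)%N).
Hypotheses (sigma_gt0 : 0 < sigma ^+ 2) (alpha_gt0 : 0 < alpha).

Let D2 := diam X ^+ 2.
Let m := segment (st k).
Let a : R := hatL * D2 / 2.
Let nu : R := sigma ^+ 2 / alpha.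
Let B : R := k%:R * l * D2 / 2.
Let total_noise Om := \sum_(1 <= s < k.+1) noise df st ghat u Om C s.

Let a_ge0 : 0 <= a.
Proof. by rewrite /a divr_ge0// mulr_ge0// sqr_ge0. Qed.

Let B_ge0 : 0 <= B.
Proof. by rewrite divr_ge0// mulr_ge0 ?sqr_ge0// mulr_ge0// (sp_l_ge0 hp). Qed.

Let nu_gt0 : 0 < nu. Proof. exact: divr_gt0. Qed.

Let c_gt0 : 0 < k%:R * nu. Proof. by rewrite mulr_gt0// ltr0n. Qed.

Let m_le : m%:R <= k%:R :> R.
Proof. by rewrite ler_nat /m -(prednK k0); exact: segment_le. Qed.

(** The constant is [31/3 = 4 + 19/3], with [4 a] from the distances to [u]. *)
Lemma sum_weighted_pg_le (Om : nat -> R) chi : (forall i, 0 < Om i) ->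
  (forall i, (0 < i < k)%N -> Om i <= Om i.+1 <= 13 / 12 * Om i) -> 0 <= chi ->
  curvature_control X f df st Om hatL chi C k ->
  \sum_(1 <= s < k.+1) Om (segment (st s)) * weighted_pg X df st s
    <= Om m * ((31 / 3 + chi * (k%:R - m%:R)) * a + B) + total_noise Om.
Proof.
move=> Om0 Omg chi0 cc.
have := potential hp sg x0X stepE Xu umin Om0 Omg chi0 hatL_ge0 cc (t := k.-1).
rewrite (prednK k0) => /(_ (leqnn _)) h.
have Xk := iterate_in hp x0X stepE k.
apply: le_trans (_ : Om m * budget X l st u hatL chi k + total_noise Om <= _).
  apply: le_trans h; rewrite lerDl mulr_ge0 ?mulr_ge0 ?subr_ge0 ?umin//.
  exact: ltW.
rewrite lerD2r ler_pM2l// /budget -/D2 -/m.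
have i1 : 1 <= (seg_index (st k))%:R :> R.
  by rewrite ler1n -(prednK k0); exact: seg_index_gt0.
have D0 : 0 <= D2 by exact: sqr_ge0.
have g0 := gam_gt0 sg k.
have h1 : gam st k / 2 * (D2 - dotp (iterate (st k) - u) (iterate (st k) - u)) <= 4 * a.
  apply: (@le_trans _ _ (gam st k / 2 * D2)).
    by rewrite ler_wpM2l ?divr_ge0 ?(ltW g0)// lerBlDr lerDl dotp_ge0.
  have : gam st k * D2 <= 4 * hatL * D2.
    rewrite ler_wpM2r// /gam ler_pM2l//; apply: le_trans hatLk.
    by apply: Lhat_nondecreasing => //; exact: leq_pred.
  by rewrite /a; lra.
have h2 : D2 / 2 * (19 / 3 * Lhat (st k)) <= 19 / 3 * a.
  have : D2 / 2 * (19 / 3 * Lhat (st k)) <= D2 / 2 * (19 / 3 * hatL).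
    by rewrite ler_wpM2l ?divr_ge0// ler_pM2l.
  by rewrite /a; lra.
have h3 : 0 <= chi * a * ((seg_index (st k))%:R - 1).
  by apply: mulr_ge0; [exact: mulr_ge0|rewrite subr_ge0].
have -> : D2 / 2 * (19 / 3 * Lhat (st k) +
     chi * (k%:R - m%:R - (seg_index (st k))%:R + 1) * hatL) =
   D2 / 2 * (19 / 3 * Lhat (st k)) + chi * a * (k%:R - m%:R)
   - chi * a * ((seg_index (st k))%:R - 1) by rewrite /a; ring.
have -> : k%:R * (l / 2 * D2) = B by rewrite /B; ring.
by lra.
Qed.

(** For the second estimator [Q_k] does not depend on the run and constant
    weights suffice. *)
Lemma failure_prob_max : curvature_control X f df st (fun=> 1) hatL 0 C k ->
  let Q := Q_ EstimatorII st k hatL (diam X) l sigma alpha in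
  failure_prob X df st k Q
    <= 1 / 2 + 3 / (8 * Q) * (total_noise (fun=> 1) - k%:R * nu - a / 2).
Proof.
move=> cc; cbv zeta; set Q := Q_ _ _ _ _ _ _ _ _.
have QE : Q = 21 / 2 * a + B + k%:R * nu.
  by rewrite /Q /Q_ /= /a /B /nu -/D2; field; rewrite gt_eqF.
have Q0 : 0 < Q by rewrite QE; move: a_ge0 B_ge0 c_gt0; lra.
have := sum_weighted_pg_le (Om := fun=> 1) _ _ _ cc.
rewrite mul1r mul0r addr0 => h.
have {}h : \sum_(1 <= s < k.+1) 1 * weighted_pg X df st s <=
   31 / 3 * a + B + total_noise (fun=> 1).
  by apply: h => // i _; rewrite lexx; lra.
have := failure_prob_markov (X := X) (df := df) sg (q := Q) (t0 := 0%N) (Om := fun=> 1) (k := k).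
move=> /(_ (fun _ _ _ => lexx _) (fun _ => ler01)); rewrite mul1r => h2.
have := le_trans h2 h; move: (failure_prob _ _ _ _ _) (total_noise _) => p N hh.
have -> : 1 / 2 + 3 / (8 * Q) * (N - k%:R * nu - a / 2) =
  (4 / 3 * Q + (N - k%:R * nu - a / 2)) / (8 / 3 * Q).
  by field; rewrite gt_eqF.
rewrite ler_pdivlMr ?mulr_gt0//; rewrite mulrC; apply: (le_trans hh).
by rewrite QE; move: a_ge0 B_ge0 c_gt0; lra.
Qed.

(** For the first estimator [Q_k] decreases with the number [m] of segments, so
    the weight of segment [i] is half the reciprocal of the value, enlarged by
    the slack [2 a], that [Q_k] would take if [i] were the last segment. The
    truncation at [k] keeps it positive. *)
Definition segment_weight (i : nat) : R :=
  (2 * ((12 + k%:R - (minn i k)%:R) * a + B + k%:R * nu))^-1.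

Let segment_weight_den_gt0 i :
  0 < (12 + k%:R - (minn i k)%:R) * a + B + k%:R * nu.
Proof.
have : 0 <= (12 + k%:R - (minn i k)%:R) * a.
  have : (minn i k)%:R <= k%:R :> R by rewrite ler_nat geq_minr.
  by move=> h; rewrite mulr_ge0//; lra.
by move: B_ge0 c_gt0; lra.
Qed.

Lemma segment_weight_gt0 i : 0 < segment_weight i.
Proof. by rewrite invr_gt0 mulr_gt0// segment_weight_den_gt0. Qed.

Lemma segment_weight_growth i : (0 < i < k)%N ->
  segment_weight i <= segment_weight i.+1 <= 13 / 12 * segment_weight i.
Proof.
move=> /andP[i0 ik]; have d1 := segment_weight_den_gt0 i.
have d2 := segment_weight_den_gt0 i.+1.
rewrite /segment_weight; move: d1 d2.
have -> : minn i k = i by apply/minn_idPl; exact: ltnW.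
have -> : minn i.+1 k = i.+1 by exact/minn_idPl.
have ik' : i%:R + 1 <= k%:R :> R by rewrite natr1 ler_nat.
rewrite -[i.+1%:R]natr1; set d := _ + _ + k%:R * nu.
have -> : (12 + k%:R - (i%:R + 1)) * a + B + k%:R * nu = d - a by rewrite /d; ring.
move=> d0 da0.
have da : 13 * a <= d.
  rewrite /d; have : 0 <= (k%:R - i%:R - 1) * a by rewrite mulr_ge0//; lra.
  by move: B_ge0 c_gt0; lra.
clearbody d; rewrite lef_pV2 ?posrE ?mulr_gt0//; apply/andP; split; first by move: a_ge0; lra.
rewrite -[13 / 12]invrK -invfM lef_pV2 ?posrE ?mulr_gt0 ?invr_gt0//.
rewrite invf_div; move: a_ge0; lra.
Qed.

Lemma segment_weight_le i j : (i <= j)%N -> segment_weight i <= segment_weight j.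
Proof.
move=> ij; rewrite lef_pV2 ?posrE ?mulr_gt0 ?segment_weight_den_gt0// ler_pM2l//.
rewrite !lerD2r ler_wpM2r// lerD2l lerN2 ler_nat.
by rewrite leq_min geq_minr andbT (leq_trans (geq_minl _ _)).
Qed.

(** The weight of the segment of the first failing candidate replaces that of the
    last one in Markov's inequality; [late_failure] bounds the loss by
    [5/3 * a * segment_weight m], which the slack in the weights covers. *)
Lemma failure_prob_average :
  curvature_control X f df st segment_weight hatL 1 C k ->
  failure_prob X df st k (Q_ EstimatorI st k hatL (diam X) l sigma alpha)
    <= 1 / 2 + (total_noise segment_weight - segment_weight m * (k%:R * nu)).
Proof.
move=> cc; set Q := Q_ _ _ _ _ _ _ _ _; set y : R := k%:R - m%:R.
have y0 : 0 <= y by rewrite subr_ge0.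
have QE : Q = (10 + y) * a + B + k%:R * nu.
  by rewrite /Q /Q_ /= /a /B /nu /y /nseg -/m -/D2; field; rewrite gt_eqF.
have ya : 0 <= y * a by exact: mulr_ge0.
have Q0 : 0 < Q by rewrite QE mulrDl; move: a_ge0 B_ge0 c_gt0 ya; lra.
have sum := sum_weighted_pg_le segment_weight_gt0 segment_weight_growth ler01 cc.
rewrite mul1r -/y in sum.
have mk : minn m k = m by apply/minn_idPl; rewrite -(ler_nat R).
have wm : segment_weight m = (2 * (Q + 2 * a))^-1.
  by rewrite /segment_weight mk QE; congr (2 * _)^-1; rewrite /y; ring.
have wm0 := segment_weight_gt0 m.
have half : 1 / 2 = segment_weight m * (Q + 2 * a).
  by rewrite wm; field; rewrite gt_eqF//; move: a_ge0; lra.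
set p := failure_prob _ _ _ _ _.
(* The slack [2 a] of the weights and [31/3 <= 12] leave [5/3 * a] for the loss. *)
suff key : p <= \sum_(1 <= s < k.+1) segment_weight (segment (st s)) * weighted_pg X df st s
    + 5 / 3 * a * segment_weight m.
  apply: (le_trans key); rewrite half; apply: le_trans (lerD sum (lexx _)) _.
  by rewrite QE; lra.
have p0 : 0 <= p by exact: failure_prob_ge0.
have [->|pn0] := eqVneq p 0.
  rewrite addr_ge0//; last by rewrite mulr_ge0 ?(ltW wm0)// mulr_ge0.
  by apply: sumr_ge0 => s _; rewrite mulr_ge0 ?weighted_pg_ge0// ltW// segment_weight_gt0.
have M0 : 0 < weight_sum st k.
  rewrite lt_neqAle weight_sum_ge0// andbT eq_sym; apply: contra pn0 => /eqP M0.
  by apply/eqP; exact: failure_prob_degenerate.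
have ex : exists t, (1 <= t <= k)%N && failing X df st k Q t.
  apply: contrapT => nex; move/negP: pn0; apply; rewrite /p /failure_prob big_nat big1//.
  move=> t tk; have [ft|_] := boolP (failing _ _ _ _ _ _); last by rewrite mulr0.
  by exfalso; apply: nex; exists t; rewrite ft andbT; exact: tk.
(* Segments, hence weights, increase from the first failing candidate on. *)
case: (ex_minnP ex) => t0 /andP[t0k ft0] t0min.
have {}t0min t : (1 <= t <= k)%N -> failing X df st k Q t -> (t0 <= t)%N.
  by move=> tk ft; apply: t0min; rewrite tk.
have := first_failure_bound hp sg x0X stepE hatLk k0 t0k M0 ft0 t0min.
rewrite -/p -/D2 -/m -/y -/a => bound.
have t0k' : (t0 <= k)%N by case/andP: t0k.
have St0 : (segment (st t0) <= m)%N by exact: segment_nondecreasing.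
set j := (m - segment (st t0))%N in bound.
have w0E : segment_weight (segment (st t0)) = (2 * (Q + (j%:R + 2) * a))^-1.
  rewrite /segment_weight (minn_idPl _); last first.
    by apply: leq_trans St0 _; rewrite -(ler_nat R).
  by congr (2 * _)^-1; rewrite QE /y /j natrB//; ring.
have := failure_prob_markov (X := X) (df := df) sg (q := Q) (t0 := t0)
  (Om := fun t => segment_weight (segment (st t))) (k := k).
rewrite -/p => markov.
have {}markov : segment_weight (segment (st t0)) * (8 / 3 * Q) * p <=
    \sum_(1 <= s < k.+1) segment_weight (segment (st s)) * weighted_pg X df st s.
  apply: markov => t; last exact: ltW (segment_weight_gt0 _).
  move=> tk ft; apply: segment_weight_le.
  by apply: segment_nondecreasing => //; exact: t0min.
suff : p - segment_weight (segment (st t0)) * (8 / 3 * Q) * p <= 5 / 3 * a * segment_weight m.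
  by move: markov; lra.
rewrite w0E wm.
have [a0|a0] := eqVneq a 0.
  rewrite a0 !mulr0 mul0r addr0.
  have -> : (2 * Q)^-1 * (8 / 3 * Q) = 4 / 3 by field; rewrite gt_eqF.
  by lra.
have {a0} a_gt0 : 0 < a by rewrite lt_neqAle eq_sym a0 a_ge0.
pose q := Q / a; have Qq : Q = q * a by rewrite /q divfK// gt_eqF.
have qy : 10 + y <= q by rewrite /q ler_pdivlMr// QE; move: B_ge0 c_gt0; lra.
have q0 : 0 < q by lra.
have r1 : 1 <= (3 / 2 : R) ^+ j by apply: exprn_ege1; lra.
have yE : y = (k - m)%:R by rewrite natrB// -(ler_nat R).
have y1 : 1 <= y.
  rewrite yE ler1n lt0n; apply/negP => /eqP km.
  move: bound; rewrite yE km mul0r mulr0 leNgt => /negP; apply.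
  by rewrite mulr_gt0 ?mulr_gt0// ?lt_neqAle 1?eq_sym ?pn0//; lra.
have pq : p * q * (3 / 2) ^+ j <= 3 / 32 * (y * (3 * y + 1)).
  by rewrite -(ler_pM2r a_gt0); move: bound; rewrite Qq; lra.
have := late_failure p0 y1 qy pq => lf.
have j0 : 0 <= j%:R :> R by [].
have -> : p - (2 * (Q + (j%:R + 2) * a))^-1 * (8 / 3 * Q) * p =
    p * (1 - 4 / 3 * (q / (q + (j%:R + 2)))).
  have s1 : 0 < q * a + (j%:R + 2) * a by rewrite -mulrDl mulr_gt0//; lra.
  by rewrite Qq; field; apply/andP; split; rewrite gt_eqF//; lra.
apply: (le_trans lf); rewrite le_eqVlt; apply/orP; left; apply/eqP.
have s2 : 0 < q * a + 2 * a by rewrite -mulrDl mulr_gt0//; lra.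
by rewrite Qq; field; apply/andP; split; rewrite gt_eqF//; lra.
Qed.

End FailureBounds.

Section CurvatureControl.
Context {R : realType} {n : nat}.
Variables (X : set 'rV[R]_n) (f : 'rV[R]_n -> R) (df : 'rV[R]_n -> 'rV[R]_n)
  (L l : R).
Hypothesis hp : smooth_problem X f df L l.
Variable st : nat -> state R n.
Hypothesis sg : segmented st.
Hypothesis xX : forall t, X (iterate (st t)).
Variables (Om : nat -> R) (hatL : R) (k : nat).
Hypotheses (Om_gt0 : forall i, 0 < Om i).
Hypotheses (Om_growth : forall i, (0 < i < k)%N -> Om i <= Om i.+1 <= 13 / 12 * Om i).
Hypotheses (hatLk : Lhat (st k) <= hatL).

Let D2 := diam X ^+ 2.
Let d2 t := dotp (move st t) (move st t).

Let d2_le t : d2 t.+1 <= D2.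
Proof. exact: (sqdist_le_diam (sp_compact hp) (xX _) (xX _)). Qed.

Let d2_ge0 t : 0 <= d2 t. Proof. exact: dotp_ge0. Qed.

Let D2_ge0 : 0 <= D2. Proof. exact: sqr_ge0. Qed.

Let Lhat_le t : (t <= k)%N -> Lhat (st t) <= hatL.
Proof. by move=> tk; apply: le_trans hatLk; exact: Lhat_nondecreasing. Qed.

Let restart_Om t : (t.+2 <= k)%N -> restart st t.+2 ->
  Om (segment (st t.+1)) <= Om (segment (st t.+2)) <= 13 / 12 * Om (segment (st t.+1)).
Proof.
move=> tk r; rewrite (sg_segment sg t.+1) r; apply: Om_growth.
by rewrite segment_gt0//=; apply: leq_trans tk; exact: (segment_le sg).
Qed.

Let continue_Lbar t : ~~ restart st t.+2 -> 2 * Lbar (st t.+2) <= 3 / 4 * gam st t.+2.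
Proof. by rewrite /restart/= -leNgt /gam/=; lra. Qed.

(** The difference between the true curvature and its unbiased estimate, on the
    steps where the true curvature is too large for the descent inequality; it is
    centred given the step. *)
Definition average_excess (avg : nat -> R) t : R :=
  if (t == 1%N) || (3 * gam st t / 8 * d2 t < step_curv f df st t)
  then ((seg_index (st t.-1))%:R + 1) * (step_curv f df st t - avg t) else 0.

(** When a segment of length [s] is closed by a large estimate, the compensation
    of the accumulated excess costs [s] times that estimate. The estimates at the
    restarts grow geometrically, which bounds the part [2 * Lhat] of this cost;
    the remaining [s - 1] are the non-opening iterations of the segment. *)
Lemma average_control avg :
  (forall t, Lbar (st t.+1) * d2 t.+1 = 2 * avg t.+1) ->
  curvature_control X f df st Om hatL 1 (average_excess avg) k.
Proof.
move=> avgE; split => [t tk r|k1|t tk r].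
- have := continue_Lbar r; have := avgE t.+1; have := d2_ge0 t.+2.
  rewrite /average_excess /= -/(d2 t.+2) => d0 aE Lb.
  have I0 : 0 <= (seg_index (st t.+1))%:R :> R by [].
  move: (step_curv f df st t.+2) (avg t.+2) (gam_gt0 sg t.+2) aE Lb => sc av g0 aE Lb.
  case: ltP => [_|h]; last by rewrite addr0 -mulrA ler_wpM2l//; lra.
  have h2 : 2 * Lbar (st t.+2) * d2 t.+2 <= 3 / 4 * gam st t.+2 * d2 t.+2 by rewrite ler_wpM2r.
  have h3 : 0 <= gam st t.+2 * d2 t.+2 by rewrite mulr_ge0// ltW.
  have h4 : ((seg_index (st t.+1))%:R + 1) * av <=
      ((seg_index (st t.+1))%:R + 1) * (3 * gam st t.+2 / 8 * d2 t.+2).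
    by rewrite ler_wpM2l//; lra.
  by lra.
- have := avgE 0%N; have := d2_le 0; have := Lbar_le_Lhat sg 0; have := d2_ge0 1.
  rewrite /average_excess eqxx /= (sg_index0 sg) add0r mul1r -/D2 => d0 Lb dD aE.
  have := Lhat_gt0 sg 1 => L1.
  have h1 : Lbar (st 1%N) * d2 1 <= Lhat (st 1%N) * d2 1 by rewrite ler_wpM2r.
  have h2 : Lhat (st 1%N) * d2 1 <= Lhat (st 1%N) * D2 by rewrite ler_wpM2l// ltW.
  have h3 : 0 <= Lhat (st 1%N) * D2 by rewrite mulr_ge0// ltW.
  by lra.
have := avgE t.+1; have := d2_le t.+1; have [Lgrow LE] := restart_Lhat sg r; rewrite LE.
have := restart_Om tk r; have := d2_ge0 t.+2.
have s1 : 1 <= (seg_index (st t.+1))%:R :> R by rewrite ler1n seg_index_gt0.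
have := Lhat_le tk; have L0 := Lhat_gt0 sg t.+1.
rewrite /average_excess /= -/(d2 t.+2) -/D2 {1}/gam /=.
move: (step_curv f df st t.+2) (avg t.+2) (Om_gt0 (segment (st t.+1))) (Om_gt0 (segment (st t.+2))).
move: (Om (segment (st t.+1))) (Om (segment (st t.+2))) s1 (Lhat_gt0 sg t.+2) Lgrow => w w'; move: (seg_index _)%:R (Lhat _) L0.
move=> s Lh Lh0; move: (Lhat _) (d2 _) => Lh' d s1 Lh'0 Lgrow sc av w0 w'0 Lle d0 /andP[ww w'w] dD aE.
have LD : Lh' * d <= Lh' * D2 by rewrite ler_wpM2l// ltW.
have goal1 : 2 * Lh' * D2 / 2 <= (2 * Lh' + 1 * (s - 1) * hatL) * D2 / 2.
  have : 0 <= (s - 1) * hatL * D2.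
    by rewrite mulr_ge0// mulr_ge0//; lra.
  by lra.
case: ltP => h.
  have sc0 : 0 < sc.
    by have : 0 <= Lh * d := mulr_ge0 (ltW Lh0) d0; move: h; lra.
  have h1 : (w' - w) * sc <= w * s * sc.
    rewrite ler_pM2r//; have : w * 1 <= w * s by rewrite ler_pM2l.
    by lra.
  have h2 : w * (s + 1) * av <= w' * ((s + 1) * (Lh' * D2 / 2)).
    have a0 : 0 <= Lh' * D2 / 2 by rewrite divr_ge0// mulr_ge0// ltW.
    rewrite -mulrA; apply: (@le_trans _ _ (w * ((s + 1) * (Lh' * D2 / 2)))).
      by rewrite ler_pM2l// ler_pM2l; lra.
    by rewrite ler_wpM2r// mulr_ge0//; lra.
  have h3 : w' * ((s - 1) * (Lh' * D2)) <= w' * ((s - 1) * (hatL * D2)).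
    rewrite ler_pM2l// ler_wpM2l//; first by lra.
    by rewrite ler_wpM2r.
  by lra.
have h1 : Lh * d * (3 / 2) <= Lh' * d by rewrite mulrAC ler_wpM2r//; lra.
have h2 : w' * sc <= w' * (2 * Lh' * D2 / 2) by rewrite ler_pM2l//; move: h; lra.
have h3 := ler_wpM2l (ltW w'0) goal1.
by lra.
Qed.

(** When the estimate is below half of the curvature nothing better than the bound
    [hatL * D^2 / 2] on the step is available. *)
Definition max_excess t : R :=
  if Lbar (st t) <= local_curv f df (iterate (st t)) (iterate (st t.-1)) / 2
  then ((seg_index (st t.-1))%:R + 1) * (hatL * D2 / 2) else 0.

Hypothesis curv_le : forall t, (t <= k)%N -> step_curv f df st t <= hatL / 2 * d2 t.

(** An estimate above half of the curvature serves as well as the curvature: without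
    restart it is at most [3/8 * gamma], with restart it is the new [Lhat]. *)
Lemma max_control : (forall i, Om i = 1) ->
  curvature_control X f df st Om hatL 0 max_excess k.
Proof.
move=> Om1.
have hatL0 : 0 <= hatL by apply: le_trans hatLk; exact: ltW (Lhat_gt0 sg k).
have hD0 : 0 <= hatL * D2 / 2 by rewrite divr_ge0// mulr_ge0.
have cl t : (t.+1 <= k)%N -> step_curv f df st t.+1 <= hatL * D2 / 2.
  move=> tk; apply: (le_trans (curv_le tk)).
  have : hatL * d2 t.+1 <= hatL * D2 by rewrite ler_wpM2l.
  by lra.
have cE t : local_curv f df (iterate (st t)) (iterate (st t.-1)) * d2 t =
    2 * step_curv f df st t by exact: local_curvE.
have good t : Lbar (st t) > local_curv f df (iterate (st t)) (iterate (st t.-1)) / 2 ->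
    step_curv f df st t <= Lbar (st t) * d2 t.
  move=> h; have := cE t.
  have : local_curv f df (iterate (st t)) (iterate (st t.-1)) * d2 t <= 2 * Lbar (st t) * d2 t.
    by rewrite ler_wpM2r//; lra.
  by lra.
split => [t tk r|k1|t tk r].
- have I0 : 0 <= (seg_index (st t.+1))%:R :> R by [].
  rewrite /max_excess -/(d2 t.+2) /=; case: (leP (Lbar (st t.+2))) => [h|h].
    have := gam_gt0 sg t.+2 => g0.
    apply: (@le_trans _ _ (((seg_index (st t.+1))%:R + 1) * (hatL * D2 / 2))).
      by rewrite ler_wpM2l ?cl//; lra.
    have i0 : 0 <= (seg_index (st t.+1))%:R + 1 :> R by lra.
    have g3 : 0 <= 3 * gam st t.+2 / 8 by lra.
    by rewrite lerDr; exact: mulr_ge0 (mulr_ge0 i0 g3) (d2_ge0 _).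
  have i0 : 0 <= (seg_index (st t.+1))%:R + 1 :> R by lra.
  rewrite addr0 -mulrA; apply: ler_wpM2l => //.
  apply: (le_trans (good _ h)); apply: ler_wpM2r => //.
  by have := continue_Lbar r; lra.
- have L1 := Lhat_gt0 sg 1.
  have h3 : 0 <= Lhat (st 1%N) * D2 by rewrite mulr_ge0// ltW.
  rewrite /max_excess -/D2; case: (leP (Lbar (st 1%N))) => [h|h].
    by rewrite /= (sg_index0 sg) add0r mul1r; have := cl 0%N k1; lra.
  have h1 := good _ h; have := Lbar_le_Lhat sg 0 => Lb.
  have h2 : Lbar (st 1%N) * d2 1 <= Lhat (st 1%N) * d2 1 by rewrite ler_wpM2r.
  have h4 : Lhat (st 1%N) * d2 1 <= Lhat (st 1%N) * D2 by rewrite ler_wpM2l ?d2_le// ltW.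
  by lra.
rewrite !Om1 !mul1r mul0r mul0r addr0 /max_excess -/D2.
have L1 := Lhat_gt0 sg t.+2.
have h3 : 0 <= Lhat (st t.+2) * D2 by rewrite mulr_ge0// ltW.
have I0 : 0 <= (seg_index (st t.+1))%:R :> R by [].
case: (leP (Lbar (st t.+2))) => [h|h].
  have := cl t.+1 tk; have : 0 <= (seg_index (st t.+1))%:R * (hatL * D2 / 2) by rewrite mulr_ge0.
  by rewrite /=; lra.
have h1 := good _ h; have [_ LE] := restart_Lhat sg r; rewrite LE in h1.
have h4 : Lhat (st t.+2) * d2 t.+2 <= Lhat (st t.+2) * D2 by rewrite ler_wpM2l ?d2_le// ltW.
by lra.
Qed.

End CurvatureControl.

(** * Measurability of the run *)

Section Measurability.
Context {d : measure_display} {T : measurableType d} {R : realType}.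

Lemma measurable_inv (h : T -> R) : (forall w, 0 <= h w) ->
  measurable_fun setT h -> measurable_fun setT (fun w => (h w)^-1).
Proof.
move=> h0 mh; under eq_fun do rewrite -powR_inv1//.
by apply: (measurableT_comp (measurable_powR _)).
Qed.

(** Measurability into a countable type that carries no sigma-algebra. *)
Definition discrete_measurable_fun (C : Type) (c : T -> C) :=
  forall k, measurable [set w | c w = k].

Lemma measurable_select (C : countType) {d'} {T' : measurableType d'}
    (c : T -> C) (f : C -> T -> T') : discrete_measurable_fun c ->
  (forall k, measurable_fun setT (f k)) ->
  measurable_fun setT (fun w => f (c w) w).
Proof.
move=> mc mf _ B mB; rewrite setTI.
rewrite (_ : _ @^-1` B = \bigcup_k ([set w | c w = k] `&` (f k @^-1` B))).
  apply: countable_bigcupT_measurable; first exact: countableP.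
  move=> k; apply: measurableI; first exact: mc.
  by rewrite -[X in measurable X]setTI; exact: mf.
by apply/seteqP; split => [w /= Bw|w [k _ [/= <-]]//]; exists (c w).
Qed.

Lemma discrete_comp (C C' : countType) (c : T -> C) (g : C -> C') :
  discrete_measurable_fun c -> discrete_measurable_fun (g \o c).
Proof.
move=> mc k'; rewrite (_ : [set _ | _] =
    \bigcup_k ([set w | c w = k] `&` (if g k == k' then setT else set0))).
  apply: countable_bigcupT_measurable; first exact: countableP.
  by move=> k; apply: measurableI => //; case: ifP.
apply/seteqP; split => [w /= <-|w [k _ [/= <-]]].
  by exists (c w) => //; split => //=; rewrite eqxx.
by case: eqP.
Qed.

Lemma discrete_if (C : countType) (b : T -> bool) (c c' : T -> C) :
  measurable_fun setT b -> discrete_measurable_fun c ->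
  discrete_measurable_fun c' ->
  discrete_measurable_fun (fun w => if b w then c w else c' w).
Proof.
move=> mb mc mc' k.
have mB : measurable [set w | b w].
  by have := mb measurableT [set true] I; rewrite setTI.
rewrite (_ : [set _ | _] = ([set w | b w] `&` [set w | c w = k]) `|`
   (~` [set w | b w] `&` [set w | c' w = k])).
  by apply: measurableU; apply: measurableI => //; exact: measurableC.
apply/seteqP; split => w /=.
  by case: ifP => bw h; [left|right]; split.
by case=> -[]; [move=> ->|move=> /negP/negbTE ->].
Qed.

Lemma discrete_cst (C : Type) (k : C) : discrete_measurable_fun (fun=> k).
Proof.
move=> k'; have [->|h] := pselect (k = k').
  by rewrite (_ : [set _ | _] = setT)//; apply/seteqP; split.
by rewrite (_ : [set _ | _] = set0)//; apply/seteqP; split.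
Qed.

Lemma discrete_natr (c : T -> nat) : discrete_measurable_fun c ->
  measurable_fun setT (fun w => (c w)%:R : R).
Proof.
by move=> mc; apply: (measurable_select (f := fun (k : nat) (_ : T) => k%:R : R)).
Qed.

Context {n : nat}.
Implicit Types (z : T -> 'rV[R]_n).

Definition measurable_vec z := forall i, measurable_fun setT (fun w => z w 0 i).

Lemma measurable_dotp z z' : measurable_vec z -> measurable_vec z' ->
  measurable_fun setT (fun w => dotp (z w) (z' w)).
Proof.
by move=> mz mz'; apply: measurable_sum => i; exact: measurable_funM.
Qed.

Lemma measurable_vecB z z' : measurable_vec z -> measurable_vec z' ->
  measurable_vec (fun w => z w - z' w).
Proof.
move=> mz mz' i; under eq_fun do rewrite !mxE.
exact: measurable_funB.
Qed.

Lemma measurable_vecZ (a : T -> R) z : measurable_fun setT a -> measurable_vec z ->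
  measurable_vec (fun w => a w *: z w).
Proof.
move=> ma mz i; under eq_fun do rewrite !mxE.
exact: measurable_funM.
Qed.

Lemma measurable_vec_sum (I : Type) (s : seq I) (h : I -> T -> 'rV[R]_n) :
  (forall i, measurable_vec (h i)) ->
  measurable_vec (fun w => \sum_(i <- s) h i w).
Proof.
move=> mh i; under eq_fun do rewrite summxE.
by apply: measurable_sum => j; exact: mh.
Qed.

Lemma measurable_vec_select (C : countType) (c : T -> C)
    (f : C -> T -> 'rV[R]_n) : discrete_measurable_fun c ->
  (forall k, measurable_vec (f k)) -> measurable_vec (fun w => f (c w) w).
Proof.
move=> mc mf i.
by apply: (measurable_select (f := fun k w => f k w 0 i)) => // k; exact: mf.
Qed.

Let cell (m : nat) (v : 'rV[R]_n) : 'rV[int]_n :=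
  map_mx (fun r => Num.floor (m.+1%:R * r)) v.

Let cell_close m v v' : cell m v = cell m v' -> `|v - v'| <= m.+1%:R^-1.
Proof.
move=> cc; rewrite /Num.norm/= mx_normrE; apply/bigmax_leP; split => //= -[i j] _ /=.
rewrite (ord1 i) !mxE; have /rowP/(_ j) := cc; rewrite !mxE.
have m0 : 0 < m.+1%:R :> R by [].
have := real_floor_itv (num_real (m.+1%:R * v 0 j)).
have := real_floor_itv (num_real (m.+1%:R * v' 0 j)).
move=> h1 h2 fE; rewrite fE in h2.
rewrite -[X in _ <= X]mul1r ler_pdivlMr// -[X in _ * X](gtr0_norm m0) -normrM.
move: h1 h2; rewrite !intrD /= => /andP[h1 h2] /andP[h3 h4].
by rewrite ler_norml; apply/andP; split; lra.
Qed.

(** A function measurable in the sample and continuous in the point stays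
    measurable along a random point: replace the point by a representative of its
    cell in finer and finer grids, of which there are countably many. *)
Lemma caratheodory (X : set 'rV[R]_n) z (h : 'rV[R]_n -> T -> R) :
  measurable_vec z -> (forall w, X (z w)) ->
  (forall x, X x -> measurable_fun setT (h x)) ->
  (forall w, h y w @[y --> within X (nbhs (z w))] --> h (z w) w) ->
  measurable_fun setT (fun w => h (z w) w).
Proof.
move=> mz Xz mh ch.
(* Empty cells get an arbitrary representative; they are never visited. *)
pose rep m (c : 'rV[int]_n) : 'rV[R]_n :=
  xget (z point) [set v | X v /\ cell m v = c].
have rep_in m c : X (rep m c).
  by rewrite /rep; case: xgetP => [v _ []//|_]; exact: Xz.
have repE m w : cell m (rep m (cell m (z w))) = cell m (z w).
  by rewrite /rep; case: xgetP => [v _ []//|/(_ (z w))[]].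
apply: (@measurable_fun_cvg _ _ _ setT (fun m w => h (rep m (cell m (z w))) w)) => [m|w _].
  apply: (measurable_select (f := fun c w => h (rep m c) w)) => [c|c]; last exact: mh.
  rewrite (_ : [set w | _] = \bigcap_(j in [set: 'I_n])
      [set w | Num.floor (m.+1%:R * z w 0 j) = c 0 j]); last first.
    apply/seteqP; split => [w /= <- j _ /=|w /= hw]; first by rewrite mxE.
    by apply/rowP => j; rewrite mxE; exact: hw.
  apply: fin_bigcap_measurable => // j _.
  have mzj : measurable_fun setT (fun w => m.+1%:R * z w 0 j).
    by apply: measurable_funM; [exact: measurable_cst|exact: mz].
  rewrite (_ : [set w | _] = (fun w => m.+1%:R * z w 0 j) @^-1` `[(c 0 j)%:~R, (c 0 j + 1)%:~R[).
    by rewrite -[X in measurable X]setTI; apply: mzj.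
  apply/seteqP; split => w /=; rewrite in_itv/=.
    by move=> <-; exact: real_floor_itv (num_real _).
  by move=> hw; exact: floor_def.
apply: (cvg_comp (fun m => rep m (cell m (z w))) (h ^~ w)); last exact: ch.
have c1 : (fun m => rep m (cell m (z w))) @ \oo --> z w.
  apply/cvgrPdist_lt => e e0; near=> m.
  apply: (@le_lt_trans _ _ m.+1%:R^-1); first by apply: cell_close; rewrite repE.
  by near: m; exact: near_infty_natSinv_lt (PosNum e0).
move=> A hA; have h1 : \forall m \near \oo, X (rep m (cell m (z w))) ->
  A (rep m (cell m (z w))) := c1 _ hA.
have : \forall m \near \oo, A (rep m (cell m (z w))).
  by apply: filterS h1 => m; apply; exact: rep_in.
exact.
Unshelve. all: by end_near.
Qed.

End Measurability.

Lemma lipschitz_within_cvg (R : realType) (n : nat) (X : set 'rV[R]_n)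
    (h : 'rV[R]_n -> R) (c : R) x : 0 <= c -> X x ->
  (forall y, X y -> `|h x - h y| <= c * enorm (x - y)) ->
  h y @[y --> within X (nbhs x)] --> h x.
Proof.
move=> c0 Xx hc; apply/cvgrPdist_lt => e e0.
have N0 : 0 < c * n%:R + 1 by rewrite ltr_wpDl// mulr_ge0.
have d0 : 0 < e / (c * n%:R + 1) by rewrite divr_gt0.
have nb : \forall y \near within X (nbhs x), `|x - y| < e / (c * n%:R + 1).
  by apply: cvgr_dist_lt d0 => //; exact: cvg_within.
near=> y; have Xy : X y by near: y; exact: withinT.
apply: (le_lt_trans (hc _ Xy)).
have : `|x - y| < e / (c * n%:R + 1) by near: y; exact: nb.
rewrite ltr_pdivlMr// => h1; apply: le_lt_trans h1.
apply: (@le_trans _ _ (c * (n%:R * `|x - y|))).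
  by rewrite ler_wpM2l// enorm_le_norm.
by rewrite mulrA mulrC ler_wpM2l// lerDl.
Unshelve. all: by end_near. Qed.

Section RunMeasurability.
Context {R : realType} {n : nat} {dXi : measure_display} {Xi : measurableType dXi}.
Variables (Pxi : probability Xi R) (X : set 'rV[R]_n) (f : 'rV[R]_n -> R)
  (df : 'rV[R]_n -> 'rV[R]_n) (L l : R) (F : 'rV[R]_n -> Xi -> R)
  (G : 'rV[R]_n -> Xi -> 'rV[R]_n) (Lxi : Xi -> R) (sigma hatL barL : R).
Hypothesis hp : smooth_problem X f df L l.
Hypothesis O : stochastic_oracle Pxi X f df F G Lxi sigma hatL barL.
Context {d : measure_display} {T : measurableType d}.
Implicit Types (x g : T -> 'rV[R]_n) (s : T -> Xi).

(** By nonexpansiveness a step depends only on [x - g / gamma], and continuously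
    so. *)
Lemma measurable_prox x g (gamma : T -> R) : measurable_vec x -> measurable_vec g ->
  measurable_fun setT gamma -> (forall w, X (x w)) -> (forall w, 0 < gamma w) ->
  measurable_vec (fun w => prox X (x w) (g w) (gamma w)).
Proof.
move=> mx mg mgam Xx g0 i.
have cX := sp_convex hp; have kX := sp_compact hp.
pose x0 := x point; pose z w := x w - (gamma w)^-1 *: g w.
have mz : measurable_vec z.
  apply: measurable_vecB => //; apply: measurable_vecZ => //.
  by apply: measurable_inv => // w; exact: ltW.
(* All steps are reduced to one with base point [x0] and stepsize 1. *)
have E w : prox X (x w) (g w) (gamma w) = prox X x0 (x0 - z w) 1.
  apply/eqP; rewrite -subr_eq0 -enorm_eq0 eq_le enorm_ge0 andbT.
  apply: (le_trans (prox_nonexpansive _ _ cX kX (Xx w) (Xx point) (g0 w) ltr01)).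
  rewrite invr1 scale1r -/(z w) (_ : _ - _ = 0) ?enorm0//.
  by apply/rowP => j; rewrite !mxE; ring.
under eq_fun do rewrite E.
apply: (@caratheodory _ _ _ _ setT z (fun v _ => prox X x0 (x0 - v) 1 0 i)) => // w.
apply: (@lipschitz_within_cvg _ _ _ (fun v => prox X x0 (x0 - v) 1 0 i) 1) => // v _.
have := abs_coord_le_enorm (prox X x0 (x0 - z w) 1 - prox X x0 (x0 - v) 1) i.
rewrite !mxE => h; apply: (le_trans h).
apply: (le_trans (prox_nonexpansive _ _ cX kX (Xx point) (Xx point) ltr01 ltr01)).
rewrite mul1r invr1 !scale1r (_ : _ - _ = z w - v)//.
by apply/rowP => j; rewrite !mxE; ring.
Qed.

Let map_measurable (h : 'rV[R]_n -> 'rV[R]_n) (c : R) x : 0 <= c ->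
  measurable_vec x -> (forall w, X (x w)) -> lipschitz_map_on X c h ->
  measurable_vec (h \o x).
Proof.
move=> c0 mx Xx hc i.
apply: (@caratheodory _ _ _ _ X x (fun v _ => h v 0 i)) => // w.
apply: (@lipschitz_within_cvg _ _ _ (fun v => h v 0 i) c) => // v Xv.
have := abs_coord_le_enorm (h (x w) - h v) i.
by rewrite !mxE => hh; apply: (le_trans hh); exact: hc.
Qed.

Lemma measurable_gradient x : measurable_vec x -> (forall w, X (x w)) ->
  measurable_vec (fun w => df (x w)).
Proof.
move=> mx Xx; apply: (map_measurable _ mx Xx (sp_lipschitz hp)).
exact: le_trans (sp_l_ge0 hp) (sp_l_leL hp).
Qed.

Lemma measurable_objective x : measurable_vec x -> (forall w, X (x w)) ->
  measurable_fun setT (fun w => f (x w)).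
Proof.
move=> mx Xx; apply: (@caratheodory _ _ _ _ X x (fun v _ => f v)) => // w.
exact: (gradient_on_continuous (sp_gradient hp)).
Qed.

Lemma measurable_sample_gradient x s : measurable_vec x -> (forall w, X (x w)) ->
  measurable_fun setT s -> measurable_vec (fun w => G (x w) (s w)).
Proof.
move=> mx Xx ms i.
apply: (@caratheodory _ _ _ _ X x (fun v w => G v (s w) 0 i)) => // [v Xv|w].
  apply: (measurableT_comp (f := fun t => G v t 0 i)) => //.
  exact/measurable_EFinP/measurable_int/(so_G_integrable O).
apply: (@lipschitz_within_cvg _ _ _ (fun v => G v (s w) 0 i) (Lxi (s w))) => // [|v Xv].
  exact: so_Lxi_ge0 O _.
have := abs_coord_le_enorm (G (x w) (s w) - G v (s w)) i.
by rewrite !mxE => hh; apply: (le_trans hh); exact: so_lipschitz O _ _ _ _ _.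
Qed.

Lemma measurable_sample_value x s : measurable_vec x -> (forall w, X (x w)) ->
  measurable_fun setT s -> measurable_fun setT (fun w => F (x w) (s w)).
Proof.
move=> mx Xx ms.
apply: (@caratheodory _ _ _ _ X x (fun v w => F v (s w))) => // [v Xv|w].
  apply: (measurableT_comp (f := F v)) => //.
  exact/measurable_EFinP/measurable_int/(so_F_integrable O).
exact: (gradient_on_continuous (so_gradient O (s w))).
Qed.

Lemma measurable_bregman x g : measurable_vec x -> measurable_vec g ->
  (forall w, X (x w)) -> (forall w, X (g w)) ->
  measurable_fun setT (fun w => bregman f df (x w) (g w)).
Proof.
move=> mx mg Xx Xg; apply: measurable_funB.
  by apply: measurable_funB; exact: measurable_objective.
by apply: measurable_dotp; [exact: measurable_gradient|exact: measurable_vecB].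
Qed.

Lemma measurable_sample_bregman x g s : measurable_vec x -> measurable_vec g ->
  (forall w, X (x w)) -> (forall w, X (g w)) -> measurable_fun setT s ->
  measurable_fun setT (fun w => bregman (F ^~ (s w)) (G ^~ (s w)) (x w) (g w)).
Proof.
move=> mx mg Xx Xg ms; apply: measurable_funB.
  by apply: measurable_funB; exact: measurable_sample_value.
by apply: measurable_dotp; [exact: measurable_sample_gradient|exact: measurable_vecB].
Qed.

Lemma measurable_curv_of (b : T -> R) x g : measurable_vec x -> measurable_vec g ->
  measurable_fun setT b ->
  measurable_fun setT (fun w => 2 * b w / enorm (x w - g w) ^+ 2).
Proof.
move=> mx mg mb; apply: measurable_funM; first by apply: measurable_funM.
apply: measurable_inv => [w|]; first exact: sqr_ge0.
under eq_fun do rewrite enorm_sqr.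
by apply: measurable_dotp; exact: measurable_vecB.
Qed.

Lemma measurable_minibatch x (b : T -> nat) (xi : nat -> T -> Xi) :
  measurable_vec x -> (forall w, X (x w)) -> discrete_measurable_fun b ->
  (forall j, measurable_fun setT (xi j)) ->
  measurable_vec (fun w => minibatch G (b w) (fun j => xi j w) (x w)).
Proof.
move=> mx Xx mb mxi.
apply: (measurable_vec_select
  (f := fun b w => minibatch G b (fun j => xi j w) (x w))) => // c.
apply: measurable_vecZ; first exact: measurable_cst.
by apply: measurable_vec_sum => j; exact: measurable_sample_gradient.
Qed.

Variables (est : estimator) (Lbar0 alpha : R) (b' : nat -> nat) (x0 : 'rV[R]_n).
Hypotheses (Lbar0_gt0 : 0 < Lbar0) (Xx0 : X x0).

Lemma measurable_estimate x g b (xib : nat -> T -> Xi) :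
  measurable_vec x -> measurable_vec g ->
  (forall w, X (x w)) -> (forall w, X (g w)) ->
  (forall j, measurable_fun setT (xib j)) ->
  measurable_fun setT (fun w => estimate est F G Lbar0 b (fun j => xib j w) (x w) (g w)).
Proof.
move=> mx mg Xx Xg mxib; rewrite /estimate.
have mc j : measurable_fun setT
    (fun w => local_curv (F ^~ (xib j w)) (G ^~ (xib j w)) (x w) (g w)).
  by apply: measurable_curv_of => //; exact: measurable_sample_bregman.
case: est.
  by apply: measurable_funM => //; apply: measurable_sum => j; exact: mc.
elim: (index_enum _) => [|j r IH].
  by under eq_fun do rewrite big_nil; exact: measurable_cst.
under eq_fun do rewrite big_cons.
by apply: measurable_maxr.
Qed.

Lemma discrete_ceil (h : T -> R) : measurable_fun setT h ->
  discrete_measurable_fun (fun w => Num.ceil (h w)).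
Proof.
move=> mh k; rewrite (_ : [set w | _] = h @^-1` `](k - 1)%:~R, k%:~R]).
  by rewrite -[X in measurable X]setTI; exact: mh.
apply/seteqP; split => w /=; rewrite in_itv/=.
  by move=> <-; exact: ceil_itv.
by move=> hw; exact: ceil_def.
Qed.

Lemma discrete_batch_size (gamma : T -> R) (i : T -> nat) :
  (forall w, 0 <= gamma w) -> measurable_fun setT gamma ->
  discrete_measurable_fun i ->
  discrete_measurable_fun (fun w => batch_size alpha (gamma w) (i w)).
Proof.
move=> g0 mg mi; rewrite /batch_size.
apply: (discrete_comp (fun c : int => maxn 1 `|c|%N)
  (c := fun w => Num.ceil ((11 * (i w)%:R / 8 + 7 / 8) * (alpha / gamma w)))).
apply: discrete_ceil; apply: measurable_funM; last first.
  by apply: measurable_funM => //; exact: measurable_inv.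
apply: measurable_funD => //; apply: measurable_funM => //.
by apply: measurable_funM => //; exact: discrete_natr.
Qed.

Record measurable_state (st : T -> state R n) : Prop := MeasurableState {
  ms_iterate : measurable_vec (fun w => iterate (st w));
  ms_Lbar : measurable_fun setT (fun w => Lbar (st w));
  ms_Lhat : measurable_fun setT (fun w => Lhat (st w));
  ms_segment : discrete_measurable_fun (fun w => segment (st w));
  ms_index : discrete_measurable_fun (fun w => seg_index (st w))
}.

Variables xi xib : nat -> nat -> T -> Xi.

Definition sample_run w : nat -> state R n :=
  acspg X F G est Lbar0 alpha b' x0 (fun t j => xi t j w) (fun t j => xib t j w).

Definition batch w t : nat :=
  batch_size alpha (gam (sample_run w) t) (seg_index (sample_run w t.-1)).

Definition batch_grad w t : 'rV[R]_n :=
  minibatch G (batch w t) (fun j => xi t j w) (iterate (sample_run w t.-1)).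

Lemma sample_run_step w t : iterate (sample_run w t.+1) =
  prox X (iterate (sample_run w t)) (batch_grad w t.+1) (gam (sample_run w) t.+1).
Proof. by []. Qed.

Lemma sample_run_segmented w : segmented (sample_run w).
Proof. exact: acspg_segmented. Qed.

Lemma sample_run_in w t : X (iterate (sample_run w t)).
Proof. exact: (iterate_in hp (Xx0 : X (iterate (sample_run w 0))) (sample_run_step w)). Qed.

Lemma sample_run_Lbar w t : Lbar (sample_run w t.+1) =
  estimate est F G Lbar0 (b' t.+1) (fun j => xib t.+1 j w)
    (iterate (sample_run w t.+1)) (iterate (sample_run w t)).
Proof. by []. Qed.

Lemma discrete_batch t : measurable_state (sample_run ^~ t) ->
  discrete_measurable_fun (fun w => batch w t.+1).
Proof.
move=> ms; apply: discrete_batch_size => [w||]; last exact: ms_index ms.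
  exact: ltW (gam_gt0 (sample_run_segmented w) _).
by apply: measurable_funM => //; exact: ms_Lhat ms.
Qed.

Lemma measurable_gam t : measurable_state (sample_run ^~ t) ->
  measurable_fun setT (fun w => gam (sample_run w) t.+1).
Proof. by move=> ms; apply: measurable_funM => //; exact: ms_Lhat ms. Qed.

Lemma measurable_batch_grad t : measurable_state (sample_run ^~ t) ->
  (forall j, measurable_fun setT (xi t.+1 j)) ->
  measurable_vec (fun w => batch_grad w t.+1).
Proof.
move=> ms mxi; apply: measurable_minibatch => //; first exact: ms_iterate ms.
  by move=> w; exact: sample_run_in.
exact: discrete_batch.
Qed.

Lemma measurable_next_iterate t : measurable_state (sample_run ^~ t) ->
  (forall j, measurable_fun setT (xi t.+1 j)) ->
  measurable_vec (fun w => iterate (sample_run w t.+1)).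
Proof.
move=> ms mxi; apply: measurable_prox.
- exact: ms_iterate ms.
- exact: measurable_batch_grad.
- exact: measurable_gam.
- by move=> w; exact: sample_run_in.
- by move=> w; exact: gam_gt0 (sample_run_segmented w) t.+1.
Qed.

Lemma measurable_restart t : measurable_state (sample_run ^~ t) ->
  measurable_fun setT (fun w => Lbar (sample_run w t.+1)) ->
  measurable_fun setT (fun w => restart (sample_run w) t.+1).
Proof.
move=> ms mL; rewrite /restart; apply: measurable_and => //.
by apply: measurable_fun_ltr => //; apply: measurable_funM => //; exact: ms_Lhat ms.
Qed.

Lemma measurable_run t :
  (forall t' j, (t' <= t)%N -> measurable_fun setT (xi t' j)) ->
  (forall t' j, (t' <= t)%N -> measurable_fun setT (xib t' j)) ->
  measurable_state (sample_run ^~ t).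
Proof.
elim: t => [_ _|t IH mxi mxib].
  split => [i||||]; [exact: measurable_cst|exact: measurable_cst|exact: measurable_cst| |];
  exact: discrete_cst.
have ms : measurable_state (sample_run ^~ t).
  by apply: IH => t' j tt; [apply: mxi|apply: mxib]; exact: leqW.
have mx := measurable_next_iterate ms (fun j => mxi t.+1 j (leqnn _)).
have mL : measurable_fun setT (fun w => Lbar (sample_run w t.+1)).
  apply: (measurable_estimate (x := fun w => iterate (sample_run w t.+1))
    (g := fun w => iterate (sample_run w t))) => //.
  - exact: ms_iterate ms.
  - by move=> w; exact: sample_run_in.
  - by move=> w; exact: sample_run_in.
  - by move=> j; exact: mxib.
have mr := measurable_restart ms mL.
split => //.
- by apply: measurable_maxr => //; exact: ms_Lhat ms.
- apply: (discrete_if mr); last exact: ms_segment ms.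
  exact: (discrete_comp S (ms_segment ms)).
- apply: (discrete_if mr); first exact: discrete_cst.
  exact: (discrete_comp S (ms_index ms)).
Qed.

End RunMeasurability.

(** * Independence and conditioning on all samples but one *)

Section IndependentRest.
Context {R : realType} {d : measure_display} {Omega : measurableType d}.
Variable P : probability Omega R.

Lemma bigsetI_seqP (I : eqType) (J : seq I) (E : I -> set Omega) w :
  (\big[setI/setT]_(i <- J) E i) w <-> (forall i, i \in J -> E i w).
Proof.
elim: J => [|j J IH]; first by rewrite big_nil.
rewrite big_cons; split => [[Ej /IH EJ] i|h].
  by rewrite inE => /orP[/eqP ->//|]; exact: EJ.
split; first by apply: h; rewrite mem_head.
by apply/IH => i iJ; apply: h; rewrite inE iJ orbT.
Qed.

Variables (I : eqType) (C : I -> set (set Omega)).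
Hypotheses (indC : mutually_independent P C)
  (mC : forall i, C i `<=` measurable) (CT : forall i, C i setT)
  (CI : forall i, setI_closed (C i)).

Let rest i : set (set Omega) := \bigcup_(j in [set j | j != i]) C j.

Let cylinder i : set (set Omega) := [set A | exists (J : seq I) (E : I -> set Omega),
  [/\ uniq J, i \notin J, forall j, C j (E j) & A = \big[setI/setT]_(j <- J) E j]].

Let cylinder_setI i : setI_closed (cylinder i).
Proof.
move=> _ _ [J [E [uJ iJ CE ->]]] [J' [E' [uJ' iJ' CE' ->]]].
exists (undup (J ++ J')), (fun j => (if j \in J then E j else setT) `&`
  (if j \in J' then E' j else setT)); split.
- exact: undup_uniq.
- by rewrite mem_undup mem_cat negb_or iJ.
- by move=> j; apply: CI; case: ifP.
apply/seteqP; split => w.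
  move=> [/bigsetI_seqP h /bigsetI_seqP h']; apply/bigsetI_seqP => j _.
  by split; case: ifP => // jJ; [exact: h|exact: h'].
move=> /bigsetI_seqP h; split; apply/bigsetI_seqP => j jJ.
  have : j \in undup (J ++ J') by rewrite mem_undup mem_cat jJ.
  by move=> /h[]; rewrite jJ.
have : j \in undup (J ++ J') by rewrite mem_undup mem_cat jJ orbT.
by move=> /h[_]; rewrite jJ.
Qed.

Let cylinder_measurable i : cylinder i `<=` measurable.
Proof.
move=> _ [J [E [_ _ CE ->]]]; apply: bigsetI_measurable => j _.
exact: mC (CE j).
Qed.

Lemma rest_measurable i : <<s rest i >> `<=` measurable.
Proof.
apply: smallest_sub; first exact: sigma_algebra_measurable.
by move=> A [j _]; exact: mC.
Qed.

(** The classes other than [C i] jointly are independent of [C i]: the events on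
    which the product rule holds form a lambda-system containing the finite
    intersections. *)
Lemma independent_rest i A B : <<s rest i >> A -> C i B ->
  P (A `&` B) = (P A * P B)%E.
Proof.
move=> sA CB; have mB : measurable B by exact: mC CB.
have : <<s cylinder i >> A.
  move: A sA; apply: smallest_sub; first exact: smallest_sigma_algebra.
  move=> A [j /= ji CA]; apply: sub_gen_smallest.
  exists [:: j], (fun j' => if j' == j then A else setT); split => //.
  - by rewrite inE eq_sym.
  - by move=> j'; case: eqP => [->|].
  - by rewrite big_seq1 eqxx.
have msub : <<s cylinder i >> `<=` measurable.
  apply: smallest_sub; first exact: sigma_algebra_measurable.
  exact: cylinder_measurable.
have PB : P B \is a fin_num by exact: fin_num_measure.
have PB0 : 0 <= fine (P B) by exact: fine_ge0.
pose m1 : {measure set Omega -> \bar R} := mrestr P mB.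
pose m2 : {measure set Omega -> \bar R} := mscale (NngNum PB0) P.
move=> cA; have : m1 A = m2 A; last first.
  by rewrite /m1 /m2 /mrestr/= /mscale/= fineK// muleC.
apply: (g_sigma_algebra_measure_unique (cylinder i) (@cylinder_measurable i)
  (fun=> setT) _ _ m1 m2 (@cylinder_setI i) _ _ A cA).
- by move=> _; exists [::], (fun=> setT); split; rewrite ?big_nil.
- by rewrite bigcup_const//; exists 0%N.
- move=> _ [J [E [uJ iJ CE ->]]].
  rewrite /m1 /m2 /mrestr/= /mscale/= fineK//.
  (* The product rule is used for [J] and for [J] extended by [i]. *)
  have EJ : \big[setI/setT]_(j <- J) (if j == i then B else E j) =
      \big[setI/setT]_(j <- J) E j.
    apply: eq_big_seq => j jJ; case: eqP => // ji.
    by move: iJ; rewrite -ji jJ.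
  have PJ : (\prod_(j <- J) P (if j == i then B else E j) = P (\big[setI/setT]_(j <- J) E j))%E.
    by rewrite -EJ indC// => j _; case: eqP => [->|].
  have : forall j, j \in rcons J i -> C j (if j == i then B else E j).
    by move=> j _; case: eqP => [->|].
  move=> /indC; rewrite rcons_uniq iJ uJ => /(_ isT).
  rewrite -cats1 !big_cat /= !big_seq1 eqxx EJ PJ muleC.
  exact.
- by move=> _; rewrite /m1/= /mrestr setTI ltey_eq PB.
Qed.

End IndependentRest.

(** ** Integrating out an independent sample *)

Section Freezing.
Context {R : realType} {d : measure_display} {Omega : measurableType d}
  {dXi : measure_display} {Xi : measurableType dXi}.
Variables (P : probability Omega R) (Pxi : probability Xi R).

(** Centred errors and errors that overestimate are treated alike: sums and
    nonnegative multiples keep this property. *)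
Definition mean_le0 (g : Omega -> R) : Prop :=
  P.-integrable setT (EFin \o g) /\ (\int[P]_w (g w)%:E <= 0)%E.

Lemma mean_le0D (g h : Omega -> R) :
  mean_le0 g -> mean_le0 h -> mean_le0 (fun w => g w + h w).
Proof.
move=> [ig mg] [ih mh]; split; first exact: (integrableD measurableT ig ih).
under eq_integral do rewrite EFinD.
by rewrite integralD//; exact: adde_le0.
Qed.

Lemma mean_le0_sum (I : Type) (s : seq I) (p : pred I) (g : I -> Omega -> R) :
  (forall i, p i -> mean_le0 (g i)) -> mean_le0 (fun w => \sum_(i <- s | p i) g i w).
Proof.
move=> hg; elim: s => [|i s IH].
  rewrite (_ : (fun w => _) = fun=> 0); last by apply/funext => w; rewrite big_nil.
  split; first exact: integrable0. by rewrite integral0_eq.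
have [pi|pi] := boolP (p i).
  rewrite (_ : (fun w => _) = fun w => g i w + \sum_(i <- s | p i) g i w).
    exact: mean_le0D (hg i pi) IH.
  by apply/funext => w; rewrite big_cons pi.
rewrite (_ : (fun w => _) = fun w => \sum_(i <- s | p i) g i w)//.
by apply/funext => w; rewrite big_cons (negbTE pi).
Qed.

Lemma mean_le0Z (c : R) (g : Omega -> R) : 0 <= c -> mean_le0 g ->
  mean_le0 (fun w => c * g w).
Proof.
move=> c0 [ig mg]; split; first exact: (integrableZl measurableT c ig).
under eq_integral do rewrite EFinM.
by rewrite integralZl// mule_ge0_le0// lee_fin.
Qed.

(** The sigma-algebra generated by [G] stands for the information that is
    frozen, [xi] for a sample independent of it. *)
Variables (G : set (set Omega)) (xi : Omega -> Xi).
Hypotheses (mG : <<s G >> `<=` measurable) (mxi : measurable_fun setT xi)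
  (lxi : forall B, measurable B -> P (xi @^-1` B) = Pxi B)
  (ind : forall A B, <<s G >> A -> measurable B ->
     P (A `&` xi @^-1` B) = (P A * P (xi @^-1` B))%E).

Local Notation Omega' := (g_sigma_algebraType G).

Let idG : Omega -> Omega' := idfun.

Let m_idG : measurable_fun setT idG.
Proof. by move=> _ A mA; rewrite setTI; exact: mG. Qed.

Let joint w : Omega' * Xi := (idG w, xi w).

Let m_joint : measurable_fun setT joint.
Proof. exact: measurable_fun_pair. Qed.

Let idX : {mfun Omega >-> Omega'} :=
  MeasurableFun.Pack (MeasurableFun.Class (isMeasurableFun.Build _ _ _ _ _ m_idG)).
Let jointX : {mfun Omega >-> (Omega' * Xi)%type} :=
  MeasurableFun.Pack (MeasurableFun.Class (isMeasurableFun.Build _ _ _ _ _ m_joint)).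

Let P' : probability Omega' R := distribution P idX.

Let joint_law (A : set (Omega' * Xi)) : measurable A ->
  (P' \x Pxi)%E A = distribution P jointX A.
Proof.
apply: product_measure_unique => A1 A2 m1 m2.
transitivity (P (A1 `&` xi @^-1` A2)) => //.
by rewrite ind// lxi.
Qed.

Variable h : Omega' * Xi -> R.
Hypothesis mh : measurable_fun setT h.

Lemma freeze_integrable (B : R) :
  (forall w, (\int[Pxi]_s `|h (w, s)|%:E <= B%:E)%E) ->
  P.-integrable setT (fun w => (h (w, xi w))%:E).
Proof.
move=> hB; apply/integrableP; split.
  apply/measurable_EFinP; exact: (measurableT_comp mh m_joint).
have mabs : measurable_fun setT (fun z => `|(h z)%:E|%E).
  by apply: measurableT_comp => //; exact/measurable_EFinP.
have -> : (\int[P]_w `|(h (w, xi w))%:E| = \int[distribution P jointX]_z `|(h z)%:E|)%E.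
  by rewrite ge0_integral_pushforward.
rewrite (eq_measure_integral (P' \x Pxi)%E); last by move=> A mA _; exact/esym/joint_law.
rewrite fubini_tonelli1//=.
apply: (@le_lt_trans _ _ (\int[P']_w (cst B%:E) w)%E); last first.
  rewrite integral_cst// (_ : (_ * _)%E = B%:E) ?ltry//.
  rewrite -[RHS]mule1; congr (_ * _)%E; exact: (@probability_setT _ _ _ P').
apply: (@ge0_le_integral _ _ _ P' setT measurableT
  (fubini_F Pxi (fun z => `|h z|%:E)) (cst B%:E)) => //.
- by move=> w _; exact: integral_ge0.
- exact: (@measurable_fun_fubini_tonelli_F _ _ _ _ _ Pxi (fun z => `|(h z)%:E|%E)).
- by move=> w _; exact: hB.
Qed.

(** By independence the joint law of the frozen information and of the sample is a
    product, and the inner integral of Fubini's theorem is nonpositive. *)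
Lemma freeze_mean : P.-integrable setT (fun w => (h (w, xi w))%:E) ->
  (forall w, (\int[Pxi]_s (h (w, s))%:E <= 0)%E) ->
  mean_le0 (fun w => h (w, xi w)).
Proof.
move=> ih h0; split => //.
have mEh : measurable_fun setT (EFin \o h) by exact/measurable_EFinP.
have ihj : (distribution P jointX).-integrable setT (EFin \o h).
  exact: integrable_pushforward.
have ihp : (P' \x Pxi)%E.-integrable setT (EFin \o h).
  apply/integrableP; split => //; case/integrableP: ihj => _ hj.
  rewrite (eq_measure_integral (distribution P jointX))// => A mA _.
  exact: joint_law.
have -> : (\int[P]_w (h (w, xi w))%:E = \int[distribution P jointX]_z (h z)%:E)%E.
  by rewrite integral_pushforward.
rewrite (eq_measure_integral (P' \x Pxi)%E); last by move=> A mA _; exact/esym/joint_law.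
rewrite -integral12_prod_meas1//.
have F0 w : (0 <= - fubini_F Pxi (EFin \o h) w)%E by rewrite oppe_ge0; exact: h0.
have -> : (\int[P']_w fubini_F Pxi (EFin \o h) w =
    - \int[P']_w (- fubini_F Pxi (EFin \o h) w))%E.
  by rewrite -integral_ge0N//; apply: eq_integral => w _; rewrite oppeK.
by rewrite oppe_le0; exact: integral_ge0.
Qed.

End Freezing.

Section SampleMeans.
Context {R : realType} {n : nat} {dXi : measure_display} {Xi : measurableType dXi}.
Variables (Pxi : probability Xi R) (X : set 'rV[R]_n) (f : 'rV[R]_n -> R)
  (df : 'rV[R]_n -> 'rV[R]_n) (L l : R) (F : 'rV[R]_n -> Xi -> R)
  (G : 'rV[R]_n -> Xi -> 'rV[R]_n) (Lxi : Xi -> R) (sigma hatL barL : R).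
Hypothesis hp : smooth_problem X f df L l.
Hypothesis O : stochastic_oracle Pxi X f df F G Lxi sigma hatL barL.

Lemma real_integrable_le {d} {T : measurableType d} (P : probability T R)
    (g h : T -> R) : measurable_fun setT g -> (forall w, `|g w| <= h w) ->
  P.-integrable setT (EFin \o h) -> P.-integrable setT (EFin \o g).
Proof.
move=> mg gh; apply: le_integrable => //; first exact/measurable_EFinP.
move=> w _ /=; rewrite lee_fin; apply: le_trans (gh w) _.
exact: ler_norm.
Qed.

Lemma real_integrableZ {d} {T : measurableType d} (P : probability T R)
    (a : R) (g : T -> R) :
  P.-integrable setT (EFin \o g) -> P.-integrable setT (EFin \o (fun w => a * g w)).
Proof. exact: integrableZl. Qed.

Lemma real_integrable_cst {d} {T : measurableType d} (P : probability T R) (a : R) :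
  P.-integrable setT (EFin \o fun=> a).
Proof. exact: finite_measure_integrable_cst. Qed.

Lemma mean_cst {d} {T : measurableType d} (P : probability T R) (a : R) :
  (\int[P]_w a%:E = a%:E)%E.
Proof.
rewrite integral_cst// -[RHS]mule1; congr (_ * _)%E.
exact: (probability_setT P).
Qed.

Lemma sample_dot_integrable x v : X x ->
  Pxi.-integrable setT (EFin \o (fun s => dotp (G x s) v)).
Proof.
move=> Xx.
have -> : EFin \o (fun s => dotp (G x s) v) =
    (fun s => \sum_i ((v 0 i)%:E * (G x s 0 i)%:E)%E).
  apply/funext => s /=; rewrite sumEFin; congr EFin; apply: eq_bigr => i _.
  by rewrite mulrC.
apply: integrable_sum => // i _; apply: integrableZl => //.
exact: so_G_integrable O _ Xx i.
Qed.

Lemma sample_dot_mean x v : X x ->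
  (\int[Pxi]_s (dotp (G x s) v)%:E = (dotp (df x) v)%:E)%E.
Proof.
move=> Xx.
under eq_integral do rewrite -sumEFin.
rewrite integral_sum//; last first.
  move=> i; under eq_fun do rewrite mulrC EFinM.
  by apply: integrableZl => //; exact: so_G_integrable O _ Xx i.
rewrite /dotp -sumEFin; apply: eq_bigr => i _.
under eq_integral do rewrite mulrC EFinM.
rewrite integralZl//; last exact: so_G_integrable O _ Xx i.
by rewrite (so_G_mean O Xx) -EFinM mulrC.
Qed.

Lemma sample_bregman_integrable x y : X x -> X y ->
  Pxi.-integrable setT (EFin \o (fun s => bregman (F ^~ s) (G ^~ s) x y)).
Proof.
move=> Xx Xy; have iF z (Xz : X z) := so_F_integrable O Xz.
exact: (integrableB measurableT (integrableB measurableT (iF _ Xx) (iF _ Xy))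
  (sample_dot_integrable _ Xy)).
Qed.

Lemma sample_bregman_mean x y : X x -> X y ->
  (\int[Pxi]_s (bregman (F ^~ s) (G ^~ s) x y)%:E = (bregman f df x y)%:E)%E.
Proof.
move=> Xx Xy; have iF z (Xz : X z) := so_F_integrable O Xz.
under eq_integral do rewrite /bregman !EFinB.
rewrite integralB//; last first.
- exact: sample_dot_integrable.
- exact: (integrableB measurableT (iF _ Xx) (iF _ Xy)).
rewrite integralB//; [|exact: iF|exact: iF].
by rewrite !(so_F_mean O)// sample_dot_mean.
Qed.

Lemma hatL_ge0 : 0 <= hatL.
Proof.
have [A [mA PA hA]] := so_Lxi_le O.
rewrite leNgt; apply/negP => h.
have AT : A = setT.
  apply/seteqP; split => // s _; apply: hA => /= hs.
  by have := so_Lxi_ge0 O s; rewrite leNgt (le_lt_trans hs).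
by move: PA; rewrite AT probability_setT => /eqP; rewrite onee_eq0.
Qed.

(** The expected curvature inherits the almost sure bound on the sampled one. *)
Lemma bregman_le_hatL x y : X x -> X y ->
  bregman f df x y <= hatL / 2 * dotp (x - y) (x - y).
Proof.
move=> Xx Xy; rewrite -lee_fin -sample_bregman_mean//.
set B := _ * _.
pose b s := bregman (F ^~ s) (G ^~ s) x y.
have ib : Pxi.-integrable setT (EFin \o b) by exact: sample_bregman_integrable.
have mb : measurable_fun setT b by exact/measurable_EFinP/measurable_int/ib.
(* Truncating at the almost sure bound does not change the mean. *)
have mm : measurable_fun setT (fun s => Num.min (b s) B) by exact: measurable_minr.
have bB : {ae Pxi, forall s, b s <= B}.
  apply: filterS (so_Lxi_le O) => s Ls.
  apply: (le_trans (sample_bregman_le O s Xx Xy)).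
  by rewrite ler_wpM2r ?dotp_ge0//; lra.
have -> : (\int[Pxi]_s (b s)%:E = \int[Pxi]_s (Num.min (b s) B)%:E)%E.
  apply: ae_eq_integral => //; [exact/measurable_EFinP|exact/measurable_EFinP|].
  by apply: filterS bB => s bs _; congr EFin; apply/esym/min_idPl.
rewrite -(mean_cst Pxi B).
apply: le_integral => //.
- apply: (real_integrable_le (h := fun s => `|b s| + `|B|)) => //.
    move=> s; rewrite /Num.min; case: ifP => _; first by rewrite lerDl.
    by rewrite lerDr.
  exact: (integrableD measurableT (integrable_norm ib) (real_integrable_cst Pxi `|B|)).
- exact: real_integrable_cst.
- by move=> s _; rewrite lee_fin ge_min lexx orbT.
Qed.

End SampleMeans.

Section FrozenMeans.
Context {R : realType} {n : nat} {dXi : measure_display} {Xi : measurableType dXi}.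
Variables (Pxi : probability Xi R) (X : set 'rV[R]_n) (f : 'rV[R]_n -> R)
  (df : 'rV[R]_n -> 'rV[R]_n) (L l : R) (F : 'rV[R]_n -> Xi -> R)
  (G : 'rV[R]_n -> Xi -> 'rV[R]_n) (Lxi : Xi -> R) (sigma hatL barL : R).
Hypothesis hp : smooth_problem X f df L l.
Hypothesis O : stochastic_oracle Pxi X f df F G Lxi sigma hatL barL.
Context {d : measure_display} {Omega : measurableType d}.
Variables (P : probability Omega R) (GG : set (set Omega)) (xi : Omega -> Xi).
Hypotheses (mG : <<s GG >> `<=` measurable) (mxi : measurable_fun setT xi)
  (lxi : forall B, measurable B -> P (xi @^-1` B) = Pxi B)
  (ind : forall A B, <<s GG >> A -> measurable B ->
     P (A `&` xi @^-1` B) = (P A * P (xi @^-1` B))%E).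

Local Notation Omega' := (g_sigma_algebraType GG).

Lemma measurable_frozen {d'} {T : measurableType d'} (h : Omega -> T) :
  measurable_fun (setT : set Omega') h -> measurable_fun (setT : set Omega) h.
Proof.
by move=> mh _ B mB; apply: mG; have := mh measurableT B mB.
Qed.

Lemma measurable_vec_frozen (x : Omega -> 'rV[R]_n) :
  measurable_vec (x : Omega' -> _) -> measurable_vec x.
Proof. by move=> mx i; exact: measurable_frozen. Qed.

Variables (x y : Omega -> 'rV[R]_n) (c : Omega -> R) (Bc : R).
Hypotheses (mx : measurable_vec (x : Omega' -> _)) (Xx : forall w, X (x w))
  (my : measurable_vec (y : Omega' -> _)) (Xy : forall w, X (y w))
  (mc : measurable_fun (setT : set Omega') c)
  (cB : forall w, `|c w| <= Bc).

Definition sample_error w : 'rV[R]_n := G (x w) (xi w) - df (x w).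

Let mfst {d'} {T : measurableType d'} (h : Omega' -> T) :
  measurable_fun setT h -> measurable_fun setT (fun z : Omega' * Xi => h z.1).
Proof. by move=> mh; exact: (measurableT_comp mh measurable_fst). Qed.

Let mxfst : measurable_vec (fun z : Omega' * Xi => x z.1).
Proof. by move=> i; exact: (mfst (mx i)). Qed.

Let myfst : measurable_vec (fun z : Omega' * Xi => y z.1).
Proof. by move=> i; exact: (mfst (my i)). Qed.

Let merr : measurable_vec (fun z : Omega' * Xi => G (x z.1) z.2 - df (x z.1)).
Proof.
apply: measurable_vecB.
  by apply: (measurable_sample_gradient O) => //; exact: measurable_snd.
by apply: (measurable_gradient hp).
Qed.

Let bounded_integrable (h : Omega -> R) : measurable_fun (setT : set Omega) h ->
  P.-integrable setT (EFin \o h) ->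
  P.-integrable setT (EFin \o (fun w => c w * h w)).
Proof.
move=> mh ih.
apply: (real_integrable_le (h := fun w => Bc * `|h w|)) => //.
- by apply: measurable_funM => //; exact: measurable_frozen.
- by move=> w; rewrite normrM ler_wpM2r.
- exact: real_integrableZ (integrable_norm ih).
Qed.

Lemma sample_error_measurable : measurable_vec (sample_error : Omega -> _).
Proof.
apply: measurable_vecB.
  by apply: (measurable_sample_gradient O) => //; exact: measurable_vec_frozen.
by apply: (measurable_gradient hp) => //; exact: measurable_vec_frozen.
Qed.

Lemma sample_error_sq_integrable :
  P.-integrable setT (EFin \o (fun w => dotp (sample_error w) (sample_error w))).
Proof.
pose h (z : Omega' * Xi) :=
  dotp (G (x z.1) z.2 - df (x z.1)) (G (x z.1) z.2 - df (x z.1)).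
have mh : measurable_fun setT h by exact: measurable_dotp.
apply: (freeze_integrable mG mxi lxi ind mh (B := sigma ^+ 2)) => w; apply: le_trans (so_variance O (Xx w)).
apply: ge0_le_integral => //.
- by apply/measurable_EFinP; apply: measurableT_comp => //;
    exact: (measurableT_comp (measurable_dotp merr merr) (pair1_measurable (w : Omega'))).
- apply/measurable_EFinP; under eq_fun do rewrite enorm_sqr.
  exact: (measurableT_comp (measurable_dotp merr merr) (pair1_measurable (w : Omega'))).
- by move=> s _; rewrite lee_fin enorm_sqr ger0_norm// dotp_ge0.
Qed.

Lemma sample_error_sq_mean : (forall w, 0 <= c w) -> mean_le0 P
  (fun w => c w * (dotp (sample_error w) (sample_error w) - sigma ^+ 2)).
Proof.
move=> c0.
pose h (z : Omega' * Xi) := c z.1 *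
  (dotp (G (x z.1) z.2 - df (x z.1)) (G (x z.1) z.2 - df (x z.1)) - sigma ^+ 2).
apply: (freeze_mean (G := GG) mG mxi lxi ind (h := h)).
- apply: measurable_funM; first exact: mfst.
  by apply: measurable_funB => //; exact: measurable_dotp.
- apply: bounded_integrable.
    apply: measurable_funB => //.
    by apply: measurable_dotp; exact: sample_error_measurable.
  exact: (integrableB measurableT sample_error_sq_integrable (real_integrable_cst P _)).
- move=> w; rewrite /h /=.
  have := so_variance O (Xx w).
  under eq_integral do rewrite enorm_sqr.
  set e := (fun s => dotp (G (x w) s - df (x w)) (G (x w) s - df (x w))) => he.
  have me : measurable_fun setT e.
    exact: (measurableT_comp (measurable_dotp merr merr) (pair1_measurable (w : Omega'))).
  have ie : Pxi.-integrable setT (EFin \o e).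
    apply/integrableP; split; first exact/measurable_EFinP.
    apply: le_lt_trans (ltry (sigma ^+ 2)); apply: le_trans he.
    rewrite le_eqVlt; apply/orP; left; apply/eqP; apply: eq_integral => s _ /=.
    by rewrite ger0_norm// dotp_ge0.
  under eq_integral do rewrite EFinM EFinB.
  have iB : Pxi.-integrable setT (fun s => (e s)%:E - (sigma ^+ 2)%:E)%E.
    exact: (integrableB measurableT ie (real_integrable_cst Pxi _)).
  rewrite integralZl// mule_ge0_le0 ?lee_fin//.
  rewrite integralB//; last exact: real_integrable_cst.
  by rewrite (mean_cst Pxi) sube_le0.
Qed.

(** Unbiasedness of the gradient: [v] is frozen, so only the mean of the error
    enters. *)
Lemma sample_error_dot_mean (v : Omega -> 'rV[R]_n) :
  measurable_vec (v : Omega' -> _) ->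
  P.-integrable setT (EFin \o (fun w => dotp (v w) (v w))) ->
  mean_le0 P (fun w => c w * dotp (sample_error w) (v w)).
Proof.
move=> mv iv.
have mvfst : measurable_vec (fun z : Omega' * Xi => v z.1).
  by move=> i; exact: (mfst (mv i)).
pose h (z : Omega' * Xi) := c z.1 * dotp (G (x z.1) z.2 - df (x z.1)) (v z.1).
apply: (freeze_mean (G := GG) mG mxi lxi ind (h := h)).
- by apply: measurable_funM; [exact: mfst|exact: measurable_dotp].
- have mdot : measurable_fun (setT : set Omega) (fun w => dotp (sample_error w) (v w)).
    apply: measurable_dotp; first exact: sample_error_measurable.
    exact: measurable_vec_frozen.
  apply: bounded_integrable => //.
  apply: (real_integrable_le (h := fun w => 1 / 2 * dotp (sample_error w) (sample_error w)
     + 1 / 2 * dotp (v w) (v w))) => //.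
    move=> w; have := dotp_young (sample_error w) (v w) (ltr01 (R := R)).
    by move=> hh; apply: (le_trans hh); lra.
  exact: (integrableD measurableT (real_integrableZ _ sample_error_sq_integrable)
    (real_integrableZ _ iv)).
move=> w; rewrite /h /=.
under eq_integral do rewrite dotpBl EFinM EFinB.
rewrite integralZl//; last first.
  exact: (integrableB measurableT (sample_dot_integrable O _ (Xx w)) (real_integrable_cst Pxi _)).
rewrite integralB//; [|exact: (sample_dot_integrable O)|exact: real_integrable_cst].
by rewrite (sample_dot_mean O)// (mean_cst Pxi) subee// mule0.
Qed.

(** Unbiasedness of values and gradients. The bound needed for integrability comes
    from the Lipschitz constants of the samples. *)
Lemma sample_bregman_gap_mean :
  mean_le0 P (fun w => c w * (bregman f df (x w) (y w)
    - bregman (F ^~ (xi w)) (G ^~ (xi w)) (x w) (y w))).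
Proof.
pose h (z : Omega' * Xi) := c z.1 * (bregman f df (x z.1) (y z.1)
  - bregman (F ^~ z.2) (G ^~ z.2) (x z.1) (y z.1)).
have mh : measurable_fun setT h.
  apply: measurable_funM; first exact: mfst.
  apply: measurable_funB; first exact: (measurable_bregman hp).
  by apply: (measurable_sample_bregman O) => //; exact: measurable_snd.
have ib w := sample_bregman_integrable O (Xx w) (Xy w).
pose D2 := diam X ^+ 2; have D0 : 0 <= D2 by exact: sqr_ge0.
have dD w := sqdist_le_diam (sp_compact hp) (Xx w) (Xy w).
have Bc0 : 0 <= Bc by apply: le_trans (cB point).
have mL := so_Lxi_meas O.
have iL : Pxi.-integrable setT (EFin \o Lxi).
  apply: (real_integrable_le (h := fun s => 1 + Lxi s ^+ 2)) => // [s|].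
    rewrite ger0_norm ?(so_Lxi_ge0 O)//; have := sqr_ge0 (Lxi s - 1).
    by have := so_Lxi_ge0 O s; nra.
  have iL2 : Pxi.-integrable setT (EFin \o (fun s => Lxi s ^+ 2)).
    apply/integrableP; split; first by apply/measurable_EFinP; exact: measurable_funX.
    apply: le_lt_trans (ltry (barL ^+ 2)); apply: le_trans (so_Lxi_sq O).
    rewrite le_eqVlt; apply/orP; left; apply/eqP; apply: eq_integral => s _ /=.
    by rewrite ger0_norm// sqr_ge0.
  exact: (integrableD measurableT (real_integrable_cst Pxi 1) iL2).
pose K1 := (hatL / 2 + l / 2) * D2.
have hatL0 := hatL_ge0 O; have l0 := sp_l_ge0 hp.
have bf w : `|bregman f df (x w) (y w)| <= K1.
  have d0 := dotp_ge0 (x w - y w).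
  have := bregman_le_hatL O (Xx w) (Xy w); have := sp_lower hp (Xx w) (Xy w).
  rewrite enorm_sqr => h1 h2.
  have h3 : hatL * dotp (x w - y w) (x w - y w) <= hatL * D2 by rewrite ler_wpM2l.
  have h4 : l * dotp (x w - y w) (x w - y w) <= l * D2 by rewrite ler_wpM2l.
  have h5 : 0 <= hatL * D2 by exact: mulr_ge0.
  have h6 : 0 <= l * D2 by exact: mulr_ge0.
  by rewrite /K1 ler_norml; apply/andP; split; lra.
pose g s := Bc * (K1 + (3 / 2 * D2) * Lxi s).
have ig : Pxi.-integrable setT (EFin \o g).
  apply: real_integrableZ.
  exact: (integrableD measurableT (real_integrable_cst Pxi K1) (real_integrableZ _ iL)).
have hle w s : `|h (w, s)| <= g s.
  rewrite /h /g /= normrM; apply: ler_pM => //.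
  apply: (le_trans (ler_normB _ _)); apply: lerD; first exact: bf.
  apply: (le_trans (sample_bregman_abs O s (Xx w) (Xy w))).
  by rewrite [leRHS]mulrAC ler_wpM2l// mulr_ge0 ?(so_Lxi_ge0 O).
apply: (freeze_mean mG mxi lxi ind mh).
  apply: (freeze_integrable mG mxi lxi ind mh (B := fine (\int[Pxi]_s (g s)%:E))) => w.
  rewrite fineK; last exact: integrable_fin_num.
  apply: ge0_le_integral => //.
  - apply/measurable_EFinP; apply: measurableT_comp => //.
    exact: (measurableT_comp mh (pair1_measurable (w : Omega'))).
  - exact: measurable_int ig.
  - by move=> s _; rewrite lee_fin.
move=> w; rewrite /h /=.
under eq_integral do rewrite EFinM EFinB.
rewrite integralZl//; last exact: (integrableB measurableT (real_integrable_cst Pxi _) (ib w)).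
rewrite integralB//; [|exact: real_integrable_cst|exact: (ib w)].
by rewrite (sample_bregman_mean O)// (mean_cst Pxi) subee// mule0.
Qed.

(** The version for events: the frozen event [A] is followed by an event on the
    new sample of conditional probability at most [p]. *)
Lemma sample_event_mean (A : Omega -> bool) (D : Omega -> Xi -> bool) (p : R) :
  measurable_fun (setT : set Omega') A ->
  measurable_fun setT (fun z : Omega' * Xi => D z.1 z.2) ->
  (forall w, (Pxi [set s | D w s] <= p%:E)%E) ->
  mean_le0 P (fun w => (A w)%:R * ((D w (xi w))%:R - p)).
Proof.
move=> mA mD Dp.
have p0 : 0 <= p by rewrite -lee_fin; apply: le_trans (Dp point).
have mnat d' (T : measurableType d') (b : T -> bool) :
    measurable_fun setT b -> measurable_fun setT (fun t => (b t)%:R : R).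
  move=> mb; have -> : (fun t => (b t)%:R : R) = \1_[set t | b t].
    by apply/funext => t; rewrite indicE mem_setE.
  by apply: measurable_indic; have := mb measurableT [set true] I; rewrite setTI.
pose h (z : Omega' * Xi) : R := (A z.1)%:R * ((D z.1 z.2)%:R - p).
have mh : measurable_fun setT h.
  apply: measurable_funM; first exact: mfst (mnat _ _ _ mA).
  by apply: measurable_funB => //; exact: mnat.
have hb z : `|h z| <= 1 + p.
  rewrite /h normrM; case: (A z.1); last by rewrite normr0 mul0r; lra.
  rewrite normr1 mul1r; apply: (le_trans (ler_normB _ _)).
  by rewrite (ger0_norm p0) lerD2r; case: (D _ _); rewrite ?normr1 ?normr0.
apply: (freeze_mean mG mxi lxi ind mh).
  apply: (freeze_integrable mG mxi lxi ind mh (B := 1 + p)) => w.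
  rewrite -(mean_cst Pxi (1 + p)); apply: ge0_le_integral => //.
  - apply/measurable_EFinP; apply: measurableT_comp => //.
    exact: (measurableT_comp mh (pair1_measurable (w : Omega'))).
  - by move=> s _; rewrite lee_fin.
move=> w; rewrite /h /=.
have mDw : measurable_fun setT (D w) by exact: (measurableT_comp mD (pair1_measurable (w : Omega'))).
have mS : measurable [set s | D w s].
  by have := mDw measurableT [set true] I; rewrite setTI.
under eq_integral do rewrite EFinM EFinB.
have E : (fun s => (D w s)%:R%:E : \bar R) = EFin \o \1_[set s | D w s].
  by apply/funext => s; rewrite /= indicE mem_setE.
have iD : Pxi.-integrable setT (fun s => (D w s)%:R%:E : \bar R).
  by rewrite E; exact: integrable_indic.
rewrite integralZl//; last exact: (integrableB measurableT iD (real_integrable_cst Pxi _)).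
rewrite integralB//; [|exact: real_integrable_cst].
rewrite mule_ge0_le0 ?lee_fin// (mean_cst Pxi) sube_le0 E integral_indic// setIT.
exact: Dp.
Qed.

End FrozenMeans.

(** ** Quadratic forms in the errors of independent samples *)

Section ErrorForms.
Context {R : realType} {n : nat} {dXi : measure_display} {Xi : measurableType dXi}.
Variables (Pxi : probability Xi R) (X : set 'rV[R]_n) (f : 'rV[R]_n -> R)
  (df : 'rV[R]_n -> 'rV[R]_n) (L l : R) (F : 'rV[R]_n -> Xi -> R)
  (G : 'rV[R]_n -> Xi -> 'rV[R]_n) (Lxi : Xi -> R) (sigma hatL barL : R).
Hypothesis hp : smooth_problem X f df L l.
Hypothesis O : stochastic_oracle Pxi X f df F G Lxi sigma hatL barL.
Context {d : measure_display} {Omega : measurableType d}.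
Variables (P : probability Omega R) (B : nat).
Variables (GG : 'I_B -> set (set Omega)) (xi : 'I_B -> Omega -> Xi).
Local Notation frozen j := (g_sigma_algebraType (GG j)).
Hypotheses (mG : forall j, <<s GG j >> `<=` measurable)
  (mxi : forall j, measurable_fun setT (xi j))
  (lxi : forall j D, measurable D -> P (xi j @^-1` D) = Pxi D)
  (ind : forall j A D, <<s GG j >> A -> measurable D ->
     P (A `&` xi j @^-1` D) = (P A * P (xi j @^-1` D))%E)
  (mxi_other : forall i j, i != j -> measurable_fun setT (xi i : frozen j -> Xi)).
Variables (x : Omega -> 'rV[R]_n).
Hypotheses (mx : forall j, measurable_vec (x : frozen j -> _))
  (Xx : forall w, X (x w)).

Local Notation err j := (sample_error df G (xi j) x).

(** The off-diagonal terms are centred: given all samples but one, the error of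
    that one has mean zero. *)
Lemma error_form_mean (q : 'I_B -> 'I_B -> Omega -> R) (Bq : R) :
  (forall i j, measurable_fun setT (q i j : frozen j -> R)) ->
  (forall i j w, `|q i j w| <= Bq) -> (forall j w, 0 <= q j j w) ->
  mean_le0 P (fun w => \sum_j \sum_i q i j w * dotp (err j w) (err i w)
    - \sum_j q j j w * sigma ^+ 2).
Proof.
move=> mq qB q0.
rewrite (_ : (fun w => _) = fun w => \sum_j
    (q j j w * (dotp (err j w) (err j w) - sigma ^+ 2)
     + \sum_(i | i != j) q i j w * dotp (err j w) (err i w))).
  apply: mean_le0_sum => j _; apply: mean_le0D.
    exact: (sample_error_sq_mean hp O (@mG j) (mxi j) (lxi j) (@ind j) (@mx j) Xx
      (@mq j j) (qB j j) (q0 j)).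
  apply: mean_le0_sum => i ij.
  apply: (sample_error_dot_mean hp O (@mG j) (mxi j) (lxi j) (@ind j) (@mx j) Xx
      (@mq i j) (qB i j)).
    apply: (measurable_vecB (T := frozen j)).
      by apply: (measurable_sample_gradient O) => //; exact: mxi_other.
    exact: (measurable_gradient hp).
  exact: (sample_error_sq_integrable hp O (@mG i) (mxi i) (lxi i) (@ind i) (@mx i) Xx).
apply/funext => w; rewrite -sumrB; apply: eq_bigr => j _.
by rewrite (bigD1 j)//= mulrBr addrAC.
Qed.

Lemma error_linear_mean (q : 'I_B -> Omega -> R) (Bq : R) (v : Omega -> 'rV[R]_n) :
  (forall j, measurable_fun setT (q j : frozen j -> R)) ->
  (forall j w, `|q j w| <= Bq) ->
  (forall j, measurable_vec (v : frozen j -> _)) ->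
  P.-integrable setT (EFin \o (fun w => dotp (v w) (v w))) ->
  mean_le0 P (fun w => \sum_j q j w * dotp (err j w) (v w)).
Proof.
move=> mq qB mv iv; apply: mean_le0_sum => j _.
exact: (sample_error_dot_mean hp O (@mG j) (mxi j) (lxi j) (@ind j) (@mx j) Xx
  (@mq j) (qB j)).
Qed.

Lemma dotp_error_sum (a : 'I_B -> R) w :
  dotp (\sum_j a j *: err j w) (\sum_j a j *: err j w)
    = \sum_j \sum_i a j * a i * dotp (err j w) (err i w).
Proof.
rewrite dotp_suml; apply: eq_bigr => j _; rewrite dotp_sumr; apply: eq_bigr => i _.
by rewrite dotpZl dotpZr mulrA.
Qed.

End ErrorForms.

Lemma minibatch_error {R : realType} {n : nat} {Xi : Type}
    (G : 'rV[R]_n -> Xi -> 'rV[R]_n) (b B : nat) (s : nat -> Xi) (x y : 'rV[R]_n) :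
  (0 < b <= B)%N ->
  minibatch G b s x - y = \sum_(j < B) (b%:R^-1 * (j < b)%N%:R) *: (G x (s j) - y).
Proof.
move=> /andP[b0 bB]; have bn0 : b%:R != 0 :> R by rewrite pnatr_eq0 -lt0n.
rewrite /minibatch (eq_bigr (fun j : 'I_B => b%:R^-1 *: ((j < b)%N%:R *: (G x (s j) - y)))).
  rewrite -scaler_sumr.
  have -> : \sum_(j < B) (j < b)%N%:R *: (G x (s j) - y) = \sum_(j < b) (G x (s j) - y).
    rewrite (big_ord_widen B (fun j => G x (s j) - y) bB) [RHS]big_mkcond/=.
    by apply: eq_bigr => j _; case: ltnP; rewrite ?scale1r ?scale0r.
  rewrite sumrB scalerBr sumr_const card_ord -[y *+ b]scaler_nat scalerA mulVf// scale1r//.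
by move=> j _; rewrite scalerA.
Qed.

(** * Means along a run *)

Lemma rv_events_setI {d dXi} {Omega : measurableType d} {Xi : measurableType dXi}
    (Y : Omega -> Xi) : setI_closed (rv_events Y).
Proof.
move=> _ _ [B mB <-] [B' mB' <-]; exists (B `&` B'); first exact: measurableI.
by rewrite !setTI preimage_setI.
Qed.

Section IidRest.
Context {R : realType} {d dXi : measure_display} {Omega : measurableType d}
  {Xi : measurableType dXi}.
Variables (P : probability Omega R) (Pxi : probability Xi R) (I : eqType)
  (Y : I -> Omega -> Xi).
Hypothesis iid : iid_samples P Pxi Y.

(** What is frozen when the sample [i] is integrated out. *)
Definition other_samples i : set (set Omega) :=
  \bigcup_(j in [set j | j != i]) rv_events (Y j).

Let mY j : measurable_fun setT (Y j). Proof. by case: iid. Qed.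

Lemma rv_events_measurable j : rv_events (Y j) `<=` measurable.
Proof. by move=> _ [B mB <-]; exact: mY. Qed.

Lemma other_samples_measurable i : <<s other_samples i >> `<=` measurable.
Proof.
exact: (rest_measurable (C := fun i => rv_events (Y i)) rv_events_measurable).
Qed.

Lemma other_samples_independent i A B : <<s other_samples i >> A -> measurable B ->
  P (A `&` Y i @^-1` B) = (P A * P (Y i @^-1` B))%E.
Proof.
move=> sA mB; apply: (independent_rest (C := fun i => rv_events (Y i)) _ _ _ _ sA).
- by case: iid.
- exact: rv_events_measurable.
- by move=> j; exists setT; rewrite // preimage_setT setTI.
- by move=> j; exact: rv_events_setI.
- by exists B; rewrite // setTI.
Qed.

Lemma other_sample_measurable i j : j != i ->
  measurable_fun (setT : set (g_sigma_algebraType (other_samples i))) (Y j).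
Proof.
move=> ji _ B mB; apply: sub_gen_smallest.
by exists j => //; exists B.
Qed.

End IidRest.

Section RunMeans.
Context {R : realType} {n : nat} {dXi : measure_display} {Xi : measurableType dXi}.
Variables (Pxi : probability Xi R) (X : set 'rV[R]_n) (f : 'rV[R]_n -> R)
  (df : 'rV[R]_n -> 'rV[R]_n) (L l : R) (F : 'rV[R]_n -> Xi -> R)
  (G : 'rV[R]_n -> Xi -> 'rV[R]_n) (Lxi : Xi -> R) (sigma hatL barL : R).
Hypothesis hp : smooth_problem X f df L l.
Hypothesis O : stochastic_oracle Pxi X f df F G Lxi sigma hatL barL.
Variables (est : estimator) (Lbar0 alpha : R) (b' : nat -> nat) (x0 : 'rV[R]_n).
Hypotheses (Lbar0_gt0 : 0 < Lbar0) (alpha_gt0 : 0 < alpha) (Xx0 : X x0).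
Context {d : measure_display} {Omega : measurableType d}.
Variables (P : probability Omega R) (xi xib : nat -> nat -> Omega -> Xi).
Hypothesis iid : iid_samples P Pxi (run_sample xi xib).

Local Notation run := (sample_run X F G est Lbar0 alpha b' x0 xi xib).
Local Notation frozen i := (g_sigma_algebraType (other_samples (run_sample xi xib) i)).

Let xiE t j : xi t j = run_sample xi xib (inl (t, j)). Proof. by []. Qed.
Let xibE t j : xib t j = run_sample xi xib (inr (t, j)). Proof. by []. Qed.

(** The state before an iteration does not involve the samples of that iteration. *)
Lemma frozen_state_grad t j :
  measurable_state (fun w : frozen (inl (t.+1, j)) => run w t).
Proof.
apply: (measurable_run hp O est alpha b' Lbar0_gt0 Xx0 (T := frozen (inl (t.+1, j))))
  => t' j' tt; rewrite ?xiE ?xibE; apply: other_sample_measurable => //.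
by apply/eqP => -[E _]; move: tt; rewrite E ltnn.
Qed.

Lemma frozen_state_curv t j :
  measurable_state (fun w : frozen (inr (t.+1, j)) => run w t).
Proof.
apply: (measurable_run hp O est alpha b' Lbar0_gt0 Xx0 (T := frozen (inr (t.+1, j))))
  => t' j' tt; rewrite ?xiE ?xibE; apply: other_sample_measurable => //.
by apply/eqP => -[E _]; move: tt; rewrite E ltnn.
Qed.

(** The estimator samples are drawn after the step, which is therefore frozen when
    one of them is integrated out. *)
Lemma frozen_next_iterate t j :
  measurable_vec (fun w : frozen (inr (t.+1, j)) => iterate (run w t.+1)).
Proof.
apply: (measurable_next_iterate hp O Lbar0_gt0 Xx0 (T := frozen (inr (t.+1, j)))).
  exact: frozen_state_curv.
by move=> j'; rewrite xiE; apply: other_sample_measurable.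
Qed.

Let run_in w t : X (iterate (run w t)).
Proof. exact: (sample_run_in F G hp). Qed.

Let run_seg w : segmented (run w).
Proof. exact: sample_run_segmented. Qed.

Let Lhat_ge w t : Lbar0 <= Lhat (run w t).
Proof. exact: (Lhat_nondecreasing (run_seg w) (leq0n t)). Qed.

Let run_state t : measurable_state (fun w => run w t).
Proof.
by apply: (measurable_run hp O est alpha b' Lbar0_gt0 Xx0) => t' j' _;
  rewrite ?xiE ?xibE; case: iid.
Qed.

Let rest_measurable_run i : <<s other_samples (run_sample xi xib) i >> `<=` measurable.
Proof. exact: (other_samples_measurable iid (i := i)). Qed.

Let law i B : measurable B -> P (run_sample xi xib i @^-1` B) = Pxi B.
Proof. by case: iid => _ + _; apply. Qed.

Let ind_run i A B : <<s other_samples (run_sample xi xib) i >> A -> measurable B ->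
  P (A `&` run_sample xi xib i @^-1` B) = (P A * P (run_sample xi xib i @^-1` B))%E.
Proof. by move=> sA mB; exact: (other_samples_independent iid sA mB). Qed.

Let mY i : measurable_fun setT (run_sample xi xib i).
Proof. by case: iid. Qed.

Variables (u : 'rV[R]_n) (Om : nat -> R) (OmB : R).
Hypotheses (Xu : X u) (Om_ge0 : forall i, 0 <= Om i) (Om_le : forall i, Om i <= OmB).

Local Notation run_batch := (batch X F G est Lbar0 alpha b' x0 xi xib).
Local Notation run_grad := (batch_grad X F G est Lbar0 alpha b' x0 xi xib).

(** The bound on the batch sizes over the first [t] iterations makes the random
    sums over a batch finite sums. *)
Let Bmax t : nat := batch_size alpha (4 * Lbar0) t.
Let coef_bound t : R := (11 * t%:R / 8 + 7 / 8) / (4 * Lbar0).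

Lemma noise_coef_bounds w t : 0 <= noise_coef (run w) t.+1 <= coef_bound t.
Proof.
have sg := run_seg w; have g0 := gam_gt0 sg t.+1.
have I0 : 0 <= (seg_index (run w t))%:R :> R by [].
have It : (seg_index (run w t))%:R <= t%:R :> R by rewrite ler_nat; exact: seg_index_le.
have gL : 4 * Lbar0 <= gam (run w) t.+1 by rewrite ler_pM2l// Lhat_ge.
have c0 : 0 <= 11 * (seg_index (run w t))%:R / 8 + 7 / 8 :> R by lra.
rewrite /noise_coef /coef_bound /=; apply/andP; split; first exact: divr_ge0 c0 (ltW g0).
have i0 : 0 <= (gam (run w) t.+1)^-1 by rewrite invr_ge0 ltW.
apply: (ler_pM c0 i0); first by lra.
by rewrite lef_pV2// posrE mulr_gt0.
Qed.

Lemma batch_bounds w t :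
  [/\ (0 < run_batch w t.+1)%N, (run_batch w t.+1 <= Bmax t)%N
    & noise_coef (run w) t.+1 * alpha <= (run_batch w t.+1)%:R].
Proof.
have ncE : noise_coef (run w) t.+1 * alpha =
    (11 * (seg_index (run w t))%:R / 8 + 7 / 8) * (alpha / gam (run w) t.+1).
  by rewrite /noise_coef /=; ring.
have /andP[nc0 ncB] := noise_coef_bounds w t.
have z0 : 0 <= noise_coef (run w) t.+1 * alpha by rewrite mulr_ge0// ltW.
have zB : noise_coef (run w) t.+1 * alpha <= (11 * t%:R / 8 + 7 / 8) * (alpha / (4 * Lbar0)).
  by rewrite [leRHS]mulrCA mulrC ler_pM2l.
rewrite /batch /batch_size /= -ncE; split.
- by rewrite leq_max.
- rewrite /Bmax /batch_size geq_max leq_max leqnn /= leq_max; apply/orP; right.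
  have c0 z : 0 <= z :> R -> 0 <= Num.ceil z by move=> ?; rewrite ceil_ge0; lra.
  by rewrite -lez_nat !gez0_abs ?c0 ?le_ceil// (le_trans z0).
- apply: (le_trans (ceil_ge _)); rewrite -[Num.ceil _]gez0_abs; last by rewrite ceil_ge0; lra.
  by rewrite -pmulrn ler_nat leq_maxr.
Qed.

(** The error of a minibatch has at most the [batch]-th part of the variance of
    a sample, and a batch is at least [alpha] times as large as the coefficient
    of the squared error. *)
Lemma gradient_noise_mean t : exists2 g, mean_le0 P g & forall w,
  Om (segment (run w t)) *
    (noise_coef (run w) t.+1
       * dotp (grad_error df (run w) (run_grad w) t.+1) (grad_error df (run w) (run_grad w) t.+1)
     - dotp (grad_error df (run w) (run_grad w) t.+1) (iterate (run w t) - u))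
  <= g w + Om (segment (run w t)) * (sigma ^+ 2 / alpha).
Proof.
set B := Bmax t.
pose s (j : 'I_B) := run_sample xi xib (inl (t.+1, val j)).
pose e (j : 'I_B) := sample_error df G (s j) (fun w => iterate (run w t)).
pose a (j : 'I_B) w : R := (run_batch w t.+1)%:R^-1 * (j < run_batch w t.+1)%N%:R.
pose W w := Om (segment (run w t)).
pose v w := u - iterate (run w t).
have OmB0 : 0 <= OmB := le_trans (Om_ge0 0) (Om_le 0).
have a01 j w : 0 <= a j w <= 1.
  have [b0 _ _] := batch_bounds w t; rewrite /a mulr_ge0 ?invr_ge0//=.
  rewrite -[leRHS]mulr1; apply: ler_pM; rewrite ?invr_ge0 ?lern1 ?leq_b1//.
  by rewrite invf_le1 ?ltr0n// ler1n.
have fs j := @frozen_state_grad t j.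
have ma i j : measurable_fun setT (a i : frozen (inl (t.+1, j)) -> R).
  have db : discrete_measurable_fun (T := frozen (inl (t.+1, j))) (fun w => run_batch w t.+1).
    exact: (discrete_batch (T := frozen (inl (t.+1, j))) Lbar0_gt0 (fs j)).
  apply: (measurable_select (T := frozen (inl (t.+1, j)))
    (f := fun (b : nat) (_ : frozen _) => b%:R^-1 * (i < b)%N%:R : R) db).
  by move=> b; exact: measurable_cst.
have mW j : measurable_fun setT (W : frozen (inl (t.+1, j)) -> R).
  apply: (measurable_select (T := frozen (inl (t.+1, j)))
    (f := fun (b : nat) (_ : frozen _) => Om b) (ms_segment (fs j))).
  by move=> b; exact: measurable_cst.
have mnc j : measurable_fun setT ((fun w => noise_coef (run w) t.+1) : frozen (inl (t.+1, j)) -> R).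
  apply: measurable_funM.
    apply: measurable_funD => //; apply: measurable_funM => //.
    by apply: measurable_funM => //; exact: (discrete_natr (ms_index (fs j))).
  apply: measurable_inv => [w|]; first exact: ltW (gam_gt0 (run_seg w) _).
  by apply: measurable_funM => //; exact: ms_Lhat (fs j).
pose q (i j : 'I_B) w := W w * noise_coef (run w) t.+1 * (a j w * a i w).
pose GG (j : 'I_B) := other_samples (run_sample xi xib) (inl (t.+1, val j)).
have rest_t j : <<s GG j >> `<=` measurable by exact: rest_measurable_run.
have mY_t (j : 'I_B) : measurable_fun setT (s j) by exact: mY.
have law_t (j : 'I_B) D : measurable D -> P (s j @^-1` D) = Pxi D by exact: law.
have ind_t j A D : <<s GG j >> A -> measurable D ->
    P (A `&` s j @^-1` D) = (P A * P (s j @^-1` D))%E.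
  by move=> sA mD; exact: (other_samples_independent iid sA mD).
have other_t i j : i != j ->
    measurable_fun setT (s i : g_sigma_algebraType (GG j) -> Xi).
  move=> ij; apply: other_sample_measurable.
  by apply: contra ij => /eqP[/ord_inj ->].
pose x : Omega -> 'rV[R]_n := fun w => iterate (run w t).
have mx_t j : measurable_vec (x : g_sigma_algebraType (GG j) -> _).
  exact: ms_iterate (fs j).
have xin w : X (x w) by exact: run_in.
have W01 w : 0 <= W w <= OmB by rewrite Om_ge0 Om_le.
exists (fun w => (\sum_j \sum_i q i j w * dotp (e j w) (e i w)
    - \sum_j q j j w * sigma ^+ 2) + \sum_j (W w * a j w) * dotp (e j w) (v w)).
  apply: mean_le0D.
    apply: (error_form_mean hp O rest_t mY_t law_t ind_t other_t mx_t xin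
        (q := q) (Bq := OmB * coef_bound t)).
    - move=> i j; apply: measurable_funM; last exact: (measurable_funM (@ma _ _) (@ma _ _)).
      exact: (measurable_funM (@mW j) (@mnc j)).
    - move=> i j w; rewrite /q.
      have /andP[nc0 ncB] := noise_coef_bounds w t; have /andP[W0 WB] := W01 w.
      have /andP[ai0 ai1] := a01 i w; have /andP[aj0 aj1] := a01 j w.
      have wn0 := mulr_ge0 W0 nc0; have aa0 := mulr_ge0 aj0 ai0.
      rewrite ger0_norm; last exact: mulr_ge0.
      rewrite -[leRHS]mulr1; apply: ler_pM => //; first exact: ler_pM.
      by rewrite -[leRHS]mulr1; apply: ler_pM.
    - move=> j w; have /andP[nc0 _] := noise_coef_bounds w t; have /andP[W0 _] := W01 w.
      have /andP[a0 _] := a01 j w.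
      exact: mulr_ge0 (mulr_ge0 W0 nc0) (mulr_ge0 a0 a0).
  apply: (error_linear_mean hp O rest_t mY_t law_t ind_t mx_t xin
      (q := fun j w => W w * a j w) (Bq := OmB)).
  - by move=> j; exact: (measurable_funM (@mW j) (@ma _ _)).
  - move=> j w; have /andP[W0 WB] := W01 w; have /andP[a0 a1] := a01 j w.
    rewrite ger0_norm; last exact: mulr_ge0 W0 a0.
    by rewrite -[leRHS]mulr1; exact: ler_pM.
  - move=> j; apply: (measurable_vecB (T := frozen (inl (t.+1, val j)))).
      by move=> i; exact: measurable_cst.
    exact: ms_iterate (fs j).
  - have mv : measurable_vec v.
      by apply: measurable_vecB; [move=> i; exact: measurable_cst|exact: ms_iterate (run_state t)].
    apply: (real_integrable_le (h := fun=> diam X ^+ 2)) => //.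
    + exact: measurable_dotp.
    + move=> w; rewrite ger0_norm ?dotp_ge0//.
      exact: (sqdist_le_diam (sp_compact hp) Xu (xin w)).
    + exact: real_integrable_cst.
move=> w; have [b0 bB ba] := batch_bounds w t.
have dE : grad_error df (run w) (run_grad w) t.+1 = \sum_j a j w *: e j w.
  by rewrite /grad_error /batch_grad /= (minibatch_error _ _ _ _ (B := B)) ?b0.
have /andP[W0 WB] := W01 w; rewrite -/(W w).
rewrite dE (dotp_error_sum df G s _ (fun j => a j w) w) dotp_suml.
have -> : \sum_i dotp (a i w *: e i w) (iterate (run w t) - u)
    = - \sum_j a j w * dotp (e j w) (v w).
  rewrite -sumrN; apply: eq_bigr => j _.
  by rewrite dotpZl /v -(opprB (iterate _) u) dotpNr mulrN opprK.
rewrite opprK mulrDr.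
have E1 : W w * (noise_coef (run w) t.+1 * (\sum_j \sum_i a j w * a i w * dotp (e j w) (e i w)))
    = \sum_j \sum_i q i j w * dotp (e j w) (e i w).
  rewrite mulrA mulr_sumr; apply: eq_bigr => j _; rewrite mulr_sumr; apply: eq_bigr => i _.
  by rewrite /q !mulrA.
have E2 : W w * (\sum_j a j w * dotp (e j w) (v w)) = \sum_j W w * a j w * dotp (e j w) (v w).
  by rewrite mulr_sumr; apply: eq_bigr => j _; rewrite mulrA.
rewrite E1 E2.
have bn0 : (run_batch w t.+1)%:R != 0 :> R by rewrite pnatr_eq0 -lt0n.
have sa : \sum_j q j j w * sigma ^+ 2 =
    W w * noise_coef (run w) t.+1 * sigma ^+ 2 / (run_batch w t.+1)%:R.
  have aa j : a j w * a j w = (run_batch w t.+1)%:R^-1 * a j w.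
    by rewrite /a; case: (_ < _)%N; rewrite ?mulr1 ?mulr0.
  have s1 : \sum_j a j w = 1.
    rewrite /a -mulr_sumr -natr_sum.
    have -> : (\sum_(j < B) (j < run_batch w t.+1))%N = run_batch w t.+1.
      by rewrite -[RHS]card_ord -sum1_card (big_ord_widen B (fun=> 1%N) bB) [RHS]big_mkcond.
    by rewrite mulVf.
  rewrite -mulr_suml /q -mulr_sumr (eq_bigr (fun j => (run_batch w t.+1)%:R^-1 * a j w)) => [|j _//].
  by rewrite -mulr_sumr s1 mulr1 mulrAC.
have : \sum_j q j j w * sigma ^+ 2 <= W w * (sigma ^+ 2 / alpha).
  rewrite sa ler_pdivrMr ?ltr0n//.
  rewrite (_ : W w * (sigma ^+ 2 / alpha) * _
    = W w * ((run_batch w t.+1)%:R / alpha) * sigma ^+ 2); last by ring.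
  by rewrite ler_wpM2r ?sqr_ge0// ler_wpM2l// ler_pdivlMr.
by lra.
Qed.

Let measurable_weight {d'} {T : measurableType d'} (c : T -> nat) :
  discrete_measurable_fun c -> measurable_fun setT (fun w => Om (c w)).
Proof.
by move=> mc; apply: (measurable_select (f := fun (i : nat) (_ : T) => Om i) mc).
Qed.

Definition sample_average w t : R :=
  (\sum_(j < b' t) bregman (F ^~ (xib t j w)) (G ^~ (xib t j w))
     (iterate (run w t)) (iterate (run w t.-1))) / (b' t)%:R.

Lemma sample_average_Lbar w t : est = EstimatorI ->
  Lbar (run w t.+1) * dotp (move (run w) t.+1) (move (run w) t.+1)
    = 2 * sample_average w t.+1.
Proof.
move=> E; rewrite sample_run_Lbar E /= mulrAC mulr_suml.
rewrite (eq_bigr (fun j : 'I__ => 2 * bregman (F ^~ (xib t.+1 j w)) (G ^~ (xib t.+1 j w))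
     (iterate (run w t.+1)) (iterate (run w t)))).
  by rewrite -mulr_sumr -mulrA; rewrite /sample_average E.
by move=> j _; rewrite -E; exact: local_curvE.
Qed.

(** Whether the excess counts is decided before the estimate is drawn, so the
    average is still unbiased on this event. *)
Lemma average_excess_mean t : (0 < b' t.+1)%N ->
  mean_le0 P (fun w => Om (segment (run w t))
    * average_excess f df (run w) (sample_average w) t.+1).
Proof.
move=> b0; have bn0 : (b' t.+1)%:R != 0 :> R by rewrite pnatr_eq0 -lt0n.
pose x w := iterate (run w t.+1); pose y w := iterate (run w t).
pose counts w := (t.+1 == 1%N) ||
  (3 * gam (run w) t.+1 / 8 * dotp (x w - y w) (x w - y w) < bregman f df (x w) (y w)).
pose c w : R := Om (segment (run w t)) * ((counts w)%:R * ((seg_index (run w t))%:R + 1))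
  / (b' t.+1)%:R.
have OmB0 : 0 <= OmB := le_trans (Om_ge0 0) (Om_le 0).
have -> : (fun w => Om (segment (run w t))
    * average_excess f df (run w) (sample_average w) t.+1) =
    fun w => \sum_(j < b' t.+1) c w * (bregman f df (x w) (y w) -
      bregman (F ^~ (xib t.+1 j w)) (G ^~ (xib t.+1 j w)) (x w) (y w)).
  apply/funext => w; rewrite -mulr_sumr sumrB sumr_const card_ord.
  rewrite /average_excess /= -/(counts w) /c /step_curv /= -/(x w) -/(y w).
  rewrite /sample_average /= -/(x w) -/(y w).
  case: (counts w); last by rewrite !(mul0r, mulr0).
  by rewrite mul1r -[bregman _ _ _ _ *+ _]mulr_natr; field.
apply: mean_le0_sum => j _.
have fs : measurable_state ((fun w => run w t) : frozen (inr (t.+1, val j)) -> _) := @frozen_state_curv t j.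
have mx : measurable_vec (x : frozen (inr (t.+1, val j)) -> _) := @frozen_next_iterate t j.
have my : measurable_vec (y : frozen (inr (t.+1, val j)) -> _) := ms_iterate fs.
have Xx w : X (x w) by exact: run_in.
have Xy w : X (y w) by exact: run_in.
have mc : measurable_fun setT (c : frozen (inr (t.+1, val j)) -> R).
  apply: measurable_funM => //; apply: measurable_funM.
    exact: measurable_weight (ms_segment fs).
  apply: measurable_funM; last first.
    by apply: measurable_funD => //; exact: discrete_natr (ms_index fs).
  apply: (discrete_natr (T := frozen (inr (t.+1, val j)))); apply: (discrete_comp nat_of_bool).
  have mcounts : measurable_fun setT (counts : frozen (inr (t.+1, val j)) -> bool).
    rewrite /counts; case: (_ == _) => /=; first exact: measurable_cst.
    apply: measurable_fun_ltr; last exact: (measurable_bregman hp (@mx) (@my)).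
    apply: measurable_funM; last by apply: measurable_dotp; exact: measurable_vecB.
    apply: measurable_funM => //; apply: measurable_funM => //.
    by apply: measurable_funM => //; exact: ms_Lhat fs.
  by move=> k; have := mcounts measurableT [set k] I; rewrite setTI.
apply: (sample_bregman_gap_mean hp O (@rest_measurable_run (inr (t.+1, val j)))
  (mY (inr (t.+1, val j))) (@law (inr (t.+1, val j)))
  (@ind_run (inr (t.+1, val j))) (@mx) Xx (@my) Xy (@mc)
  (Bc := OmB * t.+1%:R)) => w.
rewrite /c -mulrA normrM (ger0_norm (Om_ge0 _)); apply: ler_pM => //.
have I1 : (seg_index (run w t))%:R + 1 <= t.+1%:R :> R.
  by rewrite natr1 ler_nat ltnS; exact: seg_index_le.
have I0 : 0 <= (seg_index (run w t))%:R + 1 :> R by rewrite natr1.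
have bi1 : (b' t.+1)%:R^-1 <= 1 :> R by rewrite invf_le1 ?ltr0n// ler1n.
rewrite ger0_norm; last by rewrite divr_ge0// mulr_ge0.
rewrite -[leRHS]mulr1; apply: ler_pM => //.
by rewrite -[leRHS]mul1r; apply: ler_pM => //; case: (counts w).
Qed.

(** ** The maximum estimator *)

Let fails (x y : 'rV[R]_n) (s : Xi) : bool :=
  Num.max Lbar0 (local_curv (F ^~ s) (G ^~ s) x y) <= local_curv f df x y / 2.

Let measurable_fails {d'} {T : measurableType d'} (x y : T -> 'rV[R]_n) (s : T -> Xi) :
  measurable_vec x -> measurable_vec y -> (forall w, X (x w)) -> (forall w, X (y w)) ->
  measurable_fun setT s -> measurable_fun setT (fun w => fails (x w) (y w) (s w)).
Proof.
move=> mx my Xx Xy ms; apply: measurable_fun_ler.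
  apply: measurable_maxr => //; apply: measurable_curv_of => //.
  exact: (measurable_sample_bregman O).
apply: measurable_funM => //; apply: measurable_curv_of => //.
exact: (measurable_bregman hp).
Qed.

Let measurable_true {d'} {T : measurableType d'} (D : T -> bool) :
  measurable_fun setT D -> measurable [set w | D w].
Proof. by move=> mD; have := mD measurableT [set true] I; rewrite setTI. Qed.

Local Notation bet := (beta Pxi X f df F G Lbar0).

Lemma beta_ge x y : X x -> X y -> (Pxi [set s | fails x y s] <= bet%:E)%E.
Proof.
move=> Xx Xy; have mA x' y' : X x' -> X y' -> measurable [set s | fails x' y' s].
  move=> Xx' Xy'; apply: measurable_true.
  have mc v : measurable_vec (fun _ : Xi => v : 'rV[R]_n) by move=> i; exact: measurable_cst.
  exact: (measurable_fails (@mc x') (@mc y')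
    (fun=> Xx') (fun=> Xy') (@measurable_id _ Xi setT)).
have fE x' y' : X x' -> X y' -> fine (Pxi [set s | fails x' y' s]) <= 1.
  move=> Xx' Xy'; have mE := mA _ _ Xx' Xy'.
  by rewrite -lee_fin fineK ?fin_num_measure//; exact: probability_le1.
have mE := mA _ _ Xx Xy; rewrite -[leLHS]fineK ?fin_num_measure// lee_fin /beta.
apply: ub_le_sup; last by exists x => //; exists y.
by exists 1 => _ [x' Xx' [y' Xy' <-]]; exact: fE.
Qed.

Lemma beta_ge0 : 0 <= bet.
Proof. by rewrite -lee_fin; apply: le_trans (beta_ge Xx0 Xx0). Qed.

Let all_fail t m w := all
  (fun j => fails (iterate (run w t.+1)) (iterate (run w t)) (xib t.+1 j w)) (iota 0 m).

(** The estimate from a maximum falls below half of the curvature only when all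
    its samples do, and each does with conditional probability at most [beta]. *)
Lemma all_fail_mean t m : mean_le0 P (fun w => (all_fail t m w)%:R - bet ^+ m).
Proof.
elim: m => [|m IH].
  rewrite (_ : (fun w => _) = fun=> 0); last by apply/funext => w; rewrite subrr.
  by split; [exact: integrable0|rewrite integral0_eq].
pose D w s := fails (iterate (run w t.+1)) (iterate (run w t)) s.
rewrite (_ : (fun w => _) = fun w => (all_fail t m w)%:R *
    ((D w (xib t.+1 m w))%:R - bet) + bet * ((all_fail t m w)%:R - bet ^+ m)).
  apply: mean_le0D; last exact: (mean_le0Z beta_ge0 IH).
  have fs := @frozen_state_curv t m.
  have mx := @frozen_next_iterate t m.
  have my := ms_iterate fs.
  apply: (sample_event_mean (@rest_measurable_run (inr (t.+1, m))) (mY (inr (t.+1, m)))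
    (@law (inr (t.+1, m))) (@ind_run (inr (t.+1, m))) (A := all_fail t m) (D := D)).
  - rewrite /all_fail; have : all (ltn^~ m) (iota 0 m).
      by apply/allP => j; rewrite mem_iota.
    elim: (iota 0 m) => [_|j r IHr /= /andP[jm rm]]; first exact: measurable_cst.
    apply: measurable_and; last exact: IHr.
    apply: (measurable_fails (@mx) (@my) (run_in ^~ t.+1) (run_in ^~ t)).
    apply: (other_sample_measurable (Y := run_sample xi xib) (i := inr (t.+1, m))
      (j := inr (t.+1, j))); apply: contraTN jm => /eqP[->].
    by rewrite ltnn.
  - apply: (measurable_fails (T := (frozen (inr (t.+1, m)) * Xi)%type)
      (x := fun z => iterate (run z.1 t.+1)) (y := fun z => iterate (run z.1 t)) (s := snd)).
    + by move=> i; exact: (measurableT_comp (@mx i) measurable_fst).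
    + by move=> i; exact: (measurableT_comp (@my i) measurable_fst).
    + by move=> z; exact: run_in.
    + by move=> z; exact: run_in.
    + exact: measurable_snd.
  - by move=> w; exact: beta_ge.
apply/funext => w; rewrite {1}/all_fail -[m.+1]addn1 iotaD all_cat -/(all_fail t m w).
rewrite /= andbT add0n -/(D w _) addn1 exprS.
by case: (all_fail t m w); case: (D _ _) => /=; ring.
Qed.

Lemma max_excess_mean t : est = EstimatorII -> 0 <= hatL ->
  exists2 g, mean_le0 P g & forall w,
  max_excess X f df (run w) hatL t.+1
    <= g w + t.+1%:R * (hatL * diam X ^+ 2 / 2) * bet ^+ b' t.+1.
Proof.
move=> E hL; set a := hatL * _ / 2.
have a0 : 0 <= a by rewrite divr_ge0// mulr_ge0// sqr_ge0.
have ta0 : 0 <= t.+1%:R * a by exact: mulr_ge0.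
exists (fun w => t.+1%:R * a * ((all_fail t (b' t.+1) w)%:R - bet ^+ b' t.+1)).
  exact: (mean_le0Z ta0 (all_fail_mean _ _)).
move=> w; rewrite mulrBr subrK /max_excess; case: (leP (Lbar _)) => h; last by rewrite mulr_ge0.
have -> : all_fail t (b' t.+1) w.
  apply/allP => j; rewrite mem_iota add0n => /andP[_ jb].
  apply: le_trans h; rewrite sample_run_Lbar E /= ge_max.
  apply/andP; split; first exact: (@bigmax_ge_id).
  exact: (@le_bigmax _ _ _ _ _ (Ordinal jb)).
rewrite mulr1 ler_wpM2r// natr1 ler_nat ltnS; exact: seg_index_le.
Qed.

End RunMeans.

Section RunFailure.
Context {R : realType} {n : nat} {dXi : measure_display} {Xi : measurableType dXi}.
Variables (Pxi : probability Xi R) (X : set 'rV[R]_n) (f : 'rV[R]_n -> R)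
  (df : 'rV[R]_n -> 'rV[R]_n) (L l : R) (F : 'rV[R]_n -> Xi -> R)
  (G : 'rV[R]_n -> Xi -> 'rV[R]_n) (Lxi : Xi -> R) (sigma hatL barL : R).
Hypothesis hp : smooth_problem X f df L l.
Hypothesis O : stochastic_oracle Pxi X f df F G Lxi sigma hatL barL.
Variables (est : estimator) (Lbar0 alpha : R) (b' : nat -> nat) (x0 : 'rV[R]_n) (k : nat).
Hypotheses (Lbar0_gt0 : 0 < Lbar0) (Lbar0_le : Lbar0 <= hatL)
  (alpha_gt0 : 0 < alpha) (Xx0 : X x0) (k_gt0 : (0 < k)%N)
  (b'_gt0 : forall t, (1 <= t <= k)%N -> (1 <= b' t)%N).
Context {d : measure_display} {Omega : measurableType d}.
Variables (P : probability Omega R) (xi xib : nat -> nat -> Omega -> Xi).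
Hypothesis iid : iid_samples P Pxi (run_sample xi xib).

Local Notation run := (sample_run X F G est Lbar0 alpha b' x0 xi xib).
Local Notation bet := (beta Pxi X f df F G Lbar0).

Let run_in w t : X (iterate (run w t)).
Proof. exact: (sample_run_in F G hp). Qed.

Let run_seg w : segmented (run w).
Proof. exact: sample_run_segmented. Qed.

Let hatL0 : 0 <= hatL. Proof. exact: hatL_ge0 O. Qed.

(** Almost surely every estimate is an average or a maximum of curvatures that
    [hatL] bounds. *)
Lemma Lhat_le_ae : {ae P, forall w, forall t, Lhat (run w t) <= hatL}.
Proof.
have mL : measurable [set s | ~ Lxi s <= hatL].
  rewrite (_ : [set s | _] = Lxi @^-1` `]hatL, +oo[%classic).
    rewrite -[X in measurable X]setTI; exact: (so_Lxi_meas O).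
  by apply/seteqP; split => s /=; rewrite in_itv/= andbT ltNge => /negP.
have L0 : Pxi [set s | ~ Lxi s <= hatL] = 0%E.
  by apply/(negligibleP Pxi mL); exact: so_Lxi_le O.
have aeL t j : {ae P, forall w, Lxi (xib t j w) <= hatL}.
  have [my law _] := iid.
  have mA : measurable [set w | ~ Lxi (xib t j w) <= hatL].
    rewrite (_ : [set w | _] = xib t j @^-1` [set s | ~ Lxi s <= hatL])//.
    by rewrite -[X in measurable X]setTI; exact: (my (inr (t, j))).
  by apply/(negligibleP P mA); rewrite -L0 -(law (inr (t, j)) _ mL).
have aeL' := ae_foralln (fun t => ae_foralln (aeL t)).
apply: filterS aeL' => w hw; elim=> [|t IH]; first exact: Lbar0_le.
rewrite -[Lhat _]/(Num.max (Lhat (run w t)) (Lbar (run w t.+1))) ge_max IH andTb.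
have hc j : local_curv (F ^~ (xib t.+1 j w)) (G ^~ (xib t.+1 j w))
    (iterate (run w t.+1)) (iterate (run w t)) <= hatL.
  exact: le_trans (sample_curv_le O _ (run_in w _) (run_in w _)) (hw t.+1 j).
rewrite sample_run_Lbar /estimate; case: est hc => hc; last first.
  by apply/bigmax_leP; split.
have [->|b0] := posnP (b' t.+1); first by rewrite invr0 mulr0.
rewrite ler_pdivrMr ?ltr0n// mulr_natr.
rewrite -[X in _ *+ X]card_ord -sumr_const; exact: ler_sum.
Qed.

(** The condition on the number of estimator samples amounts to
    [beta ^ b'_t <= (k+1)^-2], and [1 + ... + k <= (k+1)^2 / 2]. *)
Lemma beta_power_sum : estimator_condition EstimatorII b' k bet ->
  \sum_(s < k) s.+1%:R * bet ^+ b' s.+1 <= 1 / 2.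
Proof.
move=> [b1 hb]; have b0 : 0 <= bet by exact: (beta_ge0 hp O Lbar0 Xx0).
have k1 : 0 < k.+1%:R :> R by [].
have small (s : 'I_k) : bet ^+ b' s.+1 <= (k.+1%:R ^+ 2)^-1.
  have sk : (1 <= s.+1 <= k)%N by rewrite ltn_ord.
  have [->|/eqP bn0] := eqVneq bet 0.
    by rewrite expr0n (gtn_eqF (b'_gt0 sk)) invr_ge0 sqr_ge0.
  have bp : 0 < bet by rewrite lt_def b0 andbT; apply/eqP.
  have lb : 0 < ln bet^-1 by rewrite ln_gt0// invf_gt1.
  have := hb _ sk; rewrite mulrA ler_pdivrMr// => h.
  rewrite -[leLHS]invrK lef_pV2 ?posrE ?invr_gt0 ?exprn_gt0//.
  rewrite -ler_ln ?posrE ?invr_gt0 ?exprn_gt0// -exprVn !lnXn ?invr_gt0//.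
  by rewrite -(mulr_natl (ln k.+1%:R)) -(mulr_natl (ln bet^-1)).
have sumE m : \sum_(s < m) s.+1%:R = m%:R * m.+1%:R / 2 :> R.
  elim: m => [|m IH]; first by rewrite big_ord0 !mul0r.
  by rewrite big_ord_recr/= IH -[m.+2%:R]natr1 -[m.+1%:R]natr1; field.
apply: (@le_trans _ _ (\sum_(s < k) s.+1%:R * (k.+1%:R ^+ 2)^-1)).
  by apply: ler_sum => s _; rewrite ler_wpM2l.
rewrite -mulr_suml sumE ler_pdivrMr ?exprn_gt0// expr2.
have : k%:R * k.+1%:R <= k.+1%:R * k.+1%:R :> R by rewrite ler_wpM2r// ler_nat.
by lra.
Qed.

(** Both pathwise bounds leave only errors of nonpositive mean, up to [sigma^2 / alpha]
    per step for the gradients and [a / 2] in total for failed maxima, which are the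
    terms subtracted there. *)
Lemma run_failure_mean : estimator_condition est b' k bet ->
  exists2 g, mean_le0 P g & {ae P, forall w,
    failure_prob X df (run w) k (Q_ est (run w) k hatL (diam X) l sigma alpha)
      <= 1 / 2 + g w}.
Proof.
move=> hest; have s0 := so_sigma_gt0 O.
have [u Xu umin] := smooth_problem_minimizer hp (ex_intro _ x0 Xx0).
pose ghat := batch_grad X F G est Lbar0 alpha b' x0 xi xib.
have stepE w t : iterate (run w t.+1) = prox X (iterate (run w t)) (ghat w t.+1) (gam (run w) t.+1).
  by [].
have noiseE Om C w s : noise df (run w) (ghat w) u Om C s.+1 =
    Om (segment (run w s)) * (noise_coef (run w) s.+1
       * dotp (grad_error df (run w) (ghat w) s.+1) (grad_error df (run w) (ghat w) s.+1)
     - dotp (grad_error df (run w) (ghat w) s.+1) (iterate (run w s) - u))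
    + Om (segment (run w s)) * C s.+1.
  by rewrite /noise /= mulrDr.
have [E|E] : est = EstimatorI \/ est = EstimatorII by case: est; [left|right].
  have QE w : Q_ est (run w) k hatL (diam X) l sigma alpha =
    Q_ EstimatorI (run w) k hatL (diam X) l sigma alpha by rewrite {1}E.
  pose Om := segment_weight X l hatL sigma alpha k.
  have Om0 i : 0 < Om i by exact: (segment_weight_gt0 hp).
  have Om_le i : Om i <= Om k.
    have [ik|ik] := leqP i k; first exact: (segment_weight_le hp).
    by rewrite /Om /segment_weight (minn_idPr (ltnW ik)) minnn.
  have Omg i : (0 < i < k)%N -> Om i <= Om i.+1 <= 13 / 12 * Om i.
    exact: (segment_weight_growth hp).
  have G1 t := cid2 (gradient_noise_mean hp O est b' Lbar0_gt0 alpha_gt0 Xx0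
    iid Xu (fun i => ltW (Om0 i)) Om_le t).
  pose g1 t := s2val (G1 t).
  pose C w := average_excess f df (run w) (sample_average X F G est Lbar0 alpha b' x0 xi xib w).
  pose g2 t w := Om (segment (run w t)) * C w t.+1.
  exists (fun w => \sum_(s < k) (g1 s w + g2 s w)).
    apply: mean_le0_sum => s _; apply: mean_le0D; first exact: s2valP (G1 s).
    apply: (average_excess_mean hp O est alpha Lbar0_gt0 Xx0 iid (fun i => ltW (Om0 i)) Om_le).
    by apply: b'_gt0; rewrite ltn_ord.
  apply: filterS Lhat_le_ae => w hw; rewrite QE.
  have cc : curvature_control X f df (run w) Om hatL 1 (C w) k.
    apply: (average_control hp) => // t.
    exact: sample_average_Lbar.
  apply: (le_trans (failure_prob_average hp (run_seg w) (run_in w 0) (stepE w) Xu umin hatL0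
    (hw k) k_gt0 s0 alpha_gt0 cc)).
  rewrite lerD2l lerBlDr -/Om big_add1 /= big_mkord.
  apply: (@le_trans _ _ (\sum_(s < k) (g1 s w + g2 s w + Om (segment (run w k)) * (sigma ^+ 2 / alpha)))).
    apply: ler_sum => s _; rewrite noiseE.
    have := s2valP' (G1 s) w; rewrite -/(g1 s w) -/(ghat w) /g2 /=.
    have : Om (segment (run w s)) * (sigma ^+ 2 / alpha) <= Om (segment (run w k)) * (sigma ^+ 2 / alpha).
      apply: ler_wpM2r; first by rewrite divr_ge0 ?sqr_ge0// ltW.
      apply: (segment_weight_le hp) => //.
      by apply: (segment_nondecreasing (run_seg w)); exact: ltnW.
    by lra.
  rewrite big_split /= lerD2l sumr_const card_ord -[_ *+ k]mulr_natl.
  by rewrite [leRHS]mulrCA.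
have QE w : Q_ est (run w) k hatL (diam X) l sigma alpha =
  Q_ EstimatorII (run w) k hatL (diam X) l sigma alpha by rewrite {1}E.
rewrite E in hest.
pose Q : R := 21 * hatL * diam X ^+ 2 / 4 + k%:R * l * diam X ^+ 2 / 2 + k%:R * sigma ^+ 2 / alpha.
have Q0 : 0 < Q.
  apply: ltr_wpDl; last by rewrite divr_gt0// mulr_gt0// ltr0n.
  have l0 := sp_l_ge0 hp; have D0 := sqr_ge0 (diam X).
  by apply: addr_ge0; apply: divr_ge0 => //; apply: mulr_ge0 => //; apply: mulr_ge0.
have G1 t := cid2 (gradient_noise_mean hp O est b' Lbar0_gt0 alpha_gt0 Xx0
    iid Xu (Om := fun=> 1) (OmB := 1) (fun=> ler01) (fun=> lexx 1) t).
have G2 t := cid2 (max_excess_mean hp O alpha b' Lbar0_gt0 Xx0 iid t E hatL0).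
pose g1 t := s2val (G1 t); pose g2 t := s2val (G2 t).
exists (fun w => 3 / (8 * Q) * \sum_(s < k) (g1 s w + g2 s w)).
  apply: mean_le0Z; first by rewrite divr_ge0// mulr_ge0// ltW.
  by apply: mean_le0_sum => s _; apply: mean_le0D; [exact: s2valP (G1 s)|exact: s2valP (G2 s)].
apply: filterS Lhat_le_ae => w hw; rewrite QE.
have cc : curvature_control X f df (run w) (fun=> 1) hatL 0 (max_excess X f df (run w) hatL) k.
  by apply: (max_control hp) => // t _; exact: (bregman_le_hatL O).
apply: (le_trans (failure_prob_max hp (run_seg w) (run_in w 0) (stepE w) Xu umin hatL0
    (hw k) k_gt0 s0 alpha_gt0 cc)).
rewrite -[Q_ _ _ _ _ _ _ _ _]/Q lerD2l ler_pM2l; last by rewrite divr_gt0// mulr_gt0.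
rewrite lerBlDr lerBlDr /= big_add1 /= big_mkord.
set a := hatL * _ / 2.
have a0 : 0 <= a by rewrite divr_ge0// mulr_ge0// sqr_ge0.
have := beta_power_sum hest => hb.
apply: (@le_trans _ _ (\sum_(s < k) (g1 s w + g2 s w + sigma ^+ 2 / alpha
    + a * (s.+1%:R * bet ^+ b' s.+1)))).
  apply: ler_sum => s _; rewrite noiseE.
  have := s2valP' (G1 s) w; have := s2valP' (G2 s) w; rewrite -/(g1 s w) -/(g2 s w) -/(ghat w) -/a /= !mul1r.
  by lra.
rewrite big_split /= -mulr_sumr big_split /= sumr_const card_ord -[_ *+ k]mulr_natl.
have := ler_wpM2l a0 hb; lra.
Qed.

End RunFailure.

(** * Failure of one run *)

Section StateFunctions.
Context {R : realType} {n : nat} {d : measure_display} {T : measurableType d}.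
Variables (X : set 'rV[R]_n) (f : 'rV[R]_n -> R) (df : 'rV[R]_n -> 'rV[R]_n) (L l : R).
Hypothesis hp : smooth_problem X f df L l.
Variable st : T -> nat -> state R n.
Hypotheses (ms : forall t, measurable_state (fun w => st w t))
  (sg : forall w, segmented (st w)) (Xst : forall w t, X (iterate (st w t))).

Lemma measurable_stepsize t : measurable_fun setT (fun w => gam (st w) t).
Proof. by apply: measurable_funM => //; exact: ms_Lhat. Qed.

Lemma measurable_weight_gam t :
  measurable_fun setT (fun w => weight (st w) t / gam (st w) t).
Proof.
apply: measurable_funM.
  apply: (measurable_select (f := fun (i : nat) (_ : T) =>
    if (2 <= i)%N then 3 * i%:R / 16 - 1 / 4 else 0 : R) (ms_index (ms t))).
  by move=> i; exact: measurable_cst.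
apply: measurable_inv => [w|]; last exact: measurable_stepsize.
exact: ltW (gam_gt0 (sg w) t).
Qed.

Lemma measurable_weight_sum k : measurable_fun setT (fun w => weight_sum (st w) k).
Proof. by apply: measurable_sum => t; exact: measurable_weight_gam. Qed.

Lemma measurable_output_prob k t : measurable_fun setT (fun w => output_prob (st w) k t).
Proof.
apply: measurable_funM; last exact: measurable_weight_gam.
apply: measurable_inv => [w|]; last exact: measurable_weight_sum.
exact: weight_sum_ge0.
Qed.

Lemma measurable_Q est k hatL D sigma alpha :
  measurable_fun setT (fun w => Q_ est (st w) k hatL D l sigma alpha).
Proof.
apply: measurable_funD => //; apply: measurable_funD => //.
case: est; last exact: measurable_cst.
do 3! (apply: measurable_funM => //).
by apply: measurable_funB => //; exact: discrete_natr (ms_segment (ms k)).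
Qed.

Lemma measurable_proj_grad (x g : T -> 'rV[R]_n) (gamma : T -> R) :
  measurable_vec x -> measurable_vec g -> measurable_fun setT gamma ->
  (forall w, X (x w)) -> (forall w, 0 < gamma w) ->
  measurable_vec (fun w => proj_grad X (x w) (g w) (gamma w)).
Proof.
move=> mx mg mgam Xx g0; apply: measurable_vecZ => //.
by apply: measurable_vecB => //; exact: (measurable_prox hp).
Qed.

Lemma measurable_sq_pg t : measurable_fun setT (fun w => sq_pg X df (st w) t).
Proof.
under eq_fun do rewrite /sq_pg enorm_sqr.
have mx := ms_iterate (ms t.-1).
have mp : measurable_vec (fun w => proj_grad X (iterate (st w t.-1))
    (df (iterate (st w t.-1))) (gam (st w) t)).
  apply: measurable_proj_grad => //.
  - exact: (measurable_gradient hp).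
  - exact: measurable_stepsize.
  - by move=> w; exact: gam_gt0.
exact: measurable_dotp.
Qed.

Lemma measurable_failing (q : T -> R) k t : measurable_fun setT q ->
  measurable_fun setT (fun w => failing X df (st w) k (q w) t).
Proof.
move=> mq; apply: measurable_fun_ltr; first exact: measurable_funM.
apply: measurable_funM => //; apply: measurable_funM; last exact: measurable_sq_pg.
exact: measurable_weight_sum.
Qed.

End StateFunctions.

Lemma prob_union_le {R : realType} {d : measure_display} {Omega : measurableType d}
    (P : probability Omega R) (I : Type) (s : seq I) (A : I -> set Omega) :
  (forall i, measurable (A i)) ->
  (P (\big[setU/set0]_(i <- s) A i) <= \sum_(i <- s) P (A i))%E.
Proof.
move=> mA; pose good (B : set Omega) x := measurable B /\ (P B <= x)%E.
suff [] : good (\big[setU/set0]_(i <- s) A i) (\sum_(i <- s) P (A i))%E by [].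
elim/big_ind2 : _ => [|B x D y [mB hB] [mD hD]|i _]; last by split.
  by split; rewrite ?measure0.
by split; [exact: measurableU|exact: le_trans (measureU2 _ mB mD) (leeD hB hD)].
Qed.

Section RunFails.
Context {R : realType} {n : nat} {dXi : measure_display} {Xi : measurableType dXi}.
Variables (Pxi : probability Xi R) (X : set 'rV[R]_n) (f : 'rV[R]_n -> R)
  (df : 'rV[R]_n -> 'rV[R]_n) (L l : R) (F : 'rV[R]_n -> Xi -> R)
  (G : 'rV[R]_n -> Xi -> 'rV[R]_n) (Lxi : Xi -> R) (sigma hatL barL : R).
Hypothesis hp : smooth_problem X f df L l.
Hypothesis O : stochastic_oracle Pxi X f df F G Lxi sigma hatL barL.
Variables (est : estimator) (Lbar0 alpha : R) (b' : nat -> nat) (x0 : 'rV[R]_n) (k : nat).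
Hypotheses (Lbar0_gt0 : 0 < Lbar0) (Lbar0_le : Lbar0 <= hatL)
  (alpha_gt0 : 0 < alpha) (Xx0 : X x0)
  (b'_gt0 : forall t, (1 <= t <= k)%N -> (1 <= b' t)%N)
  (hest : estimator_condition est b' k (beta Pxi X f df F G Lbar0)).
Context {d : measure_display} {Omega : measurableType d}.
Variables (P : probability Omega R) (xi xib : nat -> nat -> Omega -> Xi).
Hypothesis iid : iid_samples P Pxi (run_sample xi xib).

Local Notation run := (sample_run X F G est Lbar0 alpha b' x0 xi xib).
Local Notation Y := (run_sample xi xib).

Let run_in w t : X (iterate (run w t)).
Proof. exact: (sample_run_in F G hp). Qed.

Let run_seg w : segmented (run w).
Proof. exact: sample_run_segmented. Qed.

Let mY i : measurable_fun setT (Y i). Proof. by case: iid. Qed.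

Lemma measurable_sample_run t : measurable_state (fun w => run w t).
Proof.
by apply: (measurable_run hp O est alpha b' Lbar0_gt0 Xx0) => t' j _;
  [exact: (mY (inl (t', j)))|exact: (mY (inr (t', j)))].
Qed.

Local Notation samples := (g_sigma_algebraType (\bigcup_i rv_events (Y i))).

Let run_known t : measurable_state ((fun w => run w t) : samples -> _).
Proof.
have mS i : measurable_fun setT (Y i : samples -> Xi).
  by move=> _ B mB; apply: sub_gen_smallest; exists i => //; exists B.
by apply: (measurable_run hp O est alpha b' Lbar0_gt0 Xx0 (T := samples)) => t' j _;
  [exact: (mS (inl (t', j)))|exact: (mS (inr (t', j)))].
Qed.

Variable rho : Omega -> nat.
Hypothesis out : random_output P Y run k rho.

Let Q w := Q_ est (run w) k hatL (diam X) l sigma alpha.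

Definition run_fails : set Omega :=
  [set w | 0 < weight_sum (run w) k /\ failing X df (run w) k (Q w) (rho w).+1].

Let fails_at t : set Omega :=
  [set w | (0 < weight_sum (run w) k) && failing X df (run w) k (Q w) t].

Let fails_at_known t : sample_events Y (fails_at t).
Proof.
have mb : measurable_fun setT ((fun w => (0 < weight_sum (run w) k)
    && failing X df (run w) k (Q w) t) : samples -> bool).
  apply: measurable_and.
    apply: measurable_fun_ltr => //.
    exact: (measurable_weight_sum (T := samples) run_known run_seg).
  apply: (measurable_failing (T := samples) hp run_known run_seg run_in).
  exact: (measurable_Q (T := samples) l run_known).
by have := mb measurableT [set true] I; rewrite setTI.
Qed.

Let rho_range w : (0 < (rho w).+1 < k.+1)%N.
Proof.
case: out => _ /(_ w) + _; case: k => [|k'] /=; last by rewrite !ltnS => /andP[].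
by case: (rho w).
Qed.

Let run_fails_cover : run_fails =
  \big[setU/set0]_(1 <= t < k.+1) (fails_at t `&` [set w | rho w = t.-1]).
Proof.
rewrite -bigcup_seq; apply/seteqP; split => w.
  move=> [w0 wf]; exists (rho w).+1 => /=; last by rewrite /fails_at /= w0.
  by rewrite mem_index_iota rho_range.
by move=> [[|t]] /=; rewrite mem_index_iota// => _ [/andP[w0 wf] rE]; split; rewrite ?rE.
Qed.

(** Independence of the runs applies to events of this sigma-algebra only. *)
Lemma run_fails_event : run_events Y rho run_fails.
Proof.
rewrite run_fails_cover.
apply: (@bigsetU_measurable _ (g_sigma_algebraType _)) => t _.
apply: measurableI.
  have : <<s \bigcup_i rv_events (Y i) >> (fails_at t) by exact: fails_at_known.
  apply: smallest_sub; first exact: smallest_sigma_algebra.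
  by move=> A hA; apply: sub_gen_smallest; left.
by apply: sub_gen_smallest; right; exists t.-1.
Qed.

(** Summing the law of the output index over the failing candidates gives the
    expectation of [failure_prob], which is at most [1/2 + g] with [g] of
    nonpositive mean. *)
Lemma run_fails_prob : (P run_fails <= (1 / 2)%:E)%E.
Proof.
have [k0|k0] := posnP k.
  rewrite run_fails_cover k0 big_geq// measure0 lee_fin; lra.
have [mrho _ law] := out.
have mst := measurable_sample_run.
have msamples A : sample_events Y A -> measurable A.
  apply: smallest_sub; first exact: sigma_algebra_measurable.
  by move=> B [i _ [C mC <-]]; exact: mY.
have mA t : measurable (fails_at t) := msamples _ (fails_at_known t).
have mrt t : measurable [set w | rho w = t].
  by have := mrho measurableT [set t] I; rewrite setTI.
have op0 t w : 0 <= output_prob (run w) k t by exact: (output_prob_ge0 (run_seg w)).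
have mop t : measurable_fun setT (fun w => output_prob (run w) k t).
  exact: (measurable_output_prob mst run_seg).
have [g [ig g0] gle] := run_failure_mean hp O Lbar0_gt0 Lbar0_le alpha_gt0 Xx0 k0 b'_gt0 iid hest.
pose fp w := failure_prob X df (run w) k (Q w).
have mind t : measurable_fun setT (fun w => (failing X df (run w) k (Q w) t)%:R : R).
  apply: discrete_natr; apply: (discrete_comp nat_of_bool) => b.
  have mQ := measurable_Q l mst est k hatL (diam X) sigma alpha.
  have mf := measurable_failing hp mst run_seg run_in (q := Q) k t mQ.
  by have := mf measurableT [set b] I; rewrite setTI.
have mfp : measurable_fun setT fp by apply: measurable_sum => t; exact: measurable_funM.
have fp0 w : 0 <= fp w by exact: (failure_prob_ge0 _ _ (run_seg w)).
have mg : measurable_fun setT g by exact/measurable_EFinP/measurable_int/ig.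
(* Truncation makes the upper bound nonnegative everywhere; it equals [1/2 + g]
   almost surely. *)
pose h w := Num.max 0 (1 / 2 + g w).
have mh : measurable_fun setT h by apply: measurable_maxr => //; exact: measurable_funD.
apply: (@le_trans _ _ (\int[P]_w (fp w)%:E)%E); last first.
  apply: (@le_trans _ _ (\int[P]_w (h w)%:E)%E).
    apply: ae_ge0_le_integral => //.
    - by move=> w _; rewrite lee_fin.
    - exact/measurable_EFinP.
    - by move=> w _; rewrite lee_fin le_max lexx.
    - exact/measurable_EFinP.
    - by apply: filterS gle => w fw _; rewrite lee_fin le_max fw orbT.
  have -> : (\int[P]_w (h w)%:E = \int[P]_w ((1 / 2)%:E + (g w)%:E))%E.
    apply: ae_eq_integral => //; [exact/measurable_EFinP| |].
      by apply/measurable_EFinP; exact: measurable_funD.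
    apply: filterS gle => w fw _; rewrite -EFinD /h; congr EFin; apply/max_idPr.
    exact: le_trans (fp0 w) fw.
  rewrite integralD//; last exact: real_integrable_cst.
  by rewrite (mean_cst P) -[leRHS]adde0 leeD2l.
rewrite run_fails_cover.
have mAr t : measurable (fails_at t `&` [set w | rho w = t.-1]) by exact: measurableI.
apply: (@le_trans _ _ (\sum_(1 <= t < k.+1) P (fails_at t `&` [set w | rho w = t.-1]))%E).
  exact: prob_union_le.
pose phi t w : R := output_prob (run w) k t * \1_(fails_at t) w.
have mphi t : measurable_fun setT (phi t).
  by apply: measurable_funM => //; exact: measurable_indic.
have E t : (1 <= t < k.+1)%N ->
    P (fails_at t `&` [set w | rho w = t.-1]) = (\int[P]_w (phi t w)%:E)%E.
  move=> tk; rewrite law//; last by move=> w /andP[].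
  rewrite integral_mkcond; apply: eq_integral => w _.
  by rewrite patchE /phi indicE; case: ifP => _; rewrite ?mulr1 ?mulr0.
rewrite big_nat (eq_bigr _ E) -big_nat -ge0_integral_sum//; last 2 first.
- by move=> t; exact/measurable_EFinP.
- by move=> t w _; rewrite lee_fin mulr_ge0.
apply: ge0_le_integral => //.
- by move=> w _; apply: sume_ge0 => t _; rewrite lee_fin mulr_ge0.
- by apply: emeasurable_sum => t; exact/measurable_EFinP.
- exact/measurable_EFinP.
- move=> w _; rewrite sumEFin lee_fin; apply: ler_sum => t _.
  rewrite /phi ler_wpM2l// indicE ler_nat /fails_at mem_setE unfold_in.
  by case: (0 < weight_sum (run w) k).
Qed.

End RunFails.

(** * The post-optimization phase *)

(** Finite intersections of events of the classes [C i] lie in the sigma-algebra that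
    these generate, from which [C0] splits off. *)
Lemma mutually_independent_option {R : realType} {d : measure_display}
    {Omega : measurableType d} (P : probability Omega R) (I : eqType)
    (C0 : set (set Omega)) (C : I -> set (set Omega)) :
  mutually_independent P C ->
  (forall A B, C0 A -> <<s \bigcup_i C i >> B -> P (A `&` B) = (P A * P B)%E) ->
  mutually_independent P (fun i : option I => if i is Some j then C j else C0).
Proof.
move=> indC ind0 J E uJ hE.
have someE (s : seq (option I)) : None \notin s -> s = [seq Some j | j <- pmap id s].
  elim: s => //= -[j|] s IH; rewrite inE //=.
  by move=> /IH {1}->.
have ind_some (s : seq (option I)) : uniq s -> None \notin s -> {subset s <= J} ->
    P (\big[setI/setT]_(i <- s) E i) = (\prod_(i <- s) P (E i))%E.
  move=> us /someE sE sJ; rewrite sE !big_map; apply: indC.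
    by move: us; rewrite {1}sE map_inj_uniq// => ? ? [].
  move=> j js; have /sJ /hE// : Some j \in s.
  by rewrite sE map_f.
have [NJ|NJ] := boolP (None \in J); last exact: ind_some.
have pJ := perm_to_rem NJ.
have Nr : None \notin rem None J by rewrite mem_rem_uniqF.
have rJ : {subset rem None J <= J} by exact: mem_rem.
rewrite (perm_big _ pJ) (perm_big _ pJ) /= !big_cons ind0; last 2 first.
- exact: hE NJ.
- rewrite big_seq.
  apply: (@bigsetI_measurable _ (g_sigma_algebraType (\bigcup_i C i))) => -[j|] ir.
    by apply: sub_gen_smallest; exists j => //; exact: hE (rJ _ ir).
  by rewrite ir in Nr.
by rewrite ind_some// rem_uniq.
Qed.

Section AllRunsFail.
Context {R : realType} {d dXi : measure_display} {Omega : measurableType d}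
  {Xi : measurableType dXi}.
Variables (P : probability Omega R) (N K : nat)
  (xi xib : 'I_N -> nat -> nat -> Omega -> Xi) (rho : 'I_N -> Omega -> nat)
  (zeta : 'I_K -> Omega -> Xi).
Hypothesis ind : mutually_independent P (phase_events xi xib rho zeta).

Lemma all_runs_fail (A : 'I_N -> set Omega) (p : R) : 0 <= p ->
  (forall r, run_events (run_sample (xi r) (xib r)) (rho r) (A r)) ->
  (forall r, P (A r) <= p%:E)%E ->
  (P (\bigcap_r A r) <= (p ^+ N)%:E)%E.
Proof.
move=> p0 eA PA.
pose E (i : option 'I_N) := if i is Some r then A r else setT.
have PE (s : seq 'I_N) : uniq s ->
    P (\big[setI/setT]_(r <- s) A r) = (\prod_(r <- s) P (A r))%E.
  move=> us; have := ind (E := E) (J := [seq Some r | r <- s]); rewrite !big_map; apply.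
    by rewrite map_inj_uniq// => ? ? [].
  by move=> _ /mapP[r _ ->]; exact: eA.
have -> : \bigcap_r A r = \big[setI/setT]_(r <- enum 'I_N) A r.
  by rewrite -bigcap_seq; apply: eq_bigcapl; split => r //= _; rewrite mem_enum.
rewrite PE ?enum_uniq// -[X in _ ^+ X]card_ord cardE; elim: (enum 'I_N) => [|r s IH].
  by rewrite big_nil.
rewrite big_cons /= exprS EFinM; apply: lee_pmul => //.
by apply: prode_ge0 => r' _.
Qed.

End AllRunsFail.

Section PostError.
Context {R : realType} {n : nat} {dXi : measure_display} {Xi : measurableType dXi}.
Variables (Pxi : probability Xi R) (X : set 'rV[R]_n) (f : 'rV[R]_n -> R)
  (df : 'rV[R]_n -> 'rV[R]_n) (L l : R) (F : 'rV[R]_n -> Xi -> R)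
  (G : 'rV[R]_n -> Xi -> 'rV[R]_n) (Lxi : Xi -> R) (sigma hatL barL : R).
Hypothesis hp : smooth_problem X f df L l.
Hypothesis O : stochastic_oracle Pxi X f df F G Lxi sigma hatL barL.
Context {d : measure_display} {Omega : measurableType d}.
Variables (P : probability Omega R) (K : nat) (zeta : 'I_K -> Omega -> Xi).
Hypotheses (K_gt0 : (0 < K)%N) (iid : iid_samples P Pxi zeta).
Variables (C0 : set (set Omega)) (x : Omega -> 'rV[R]_n).
Hypotheses (mC0 : C0 `<=` measurable) (C0T : C0 setT) (C0I : setI_closed C0)
  (ind0 : forall A B, C0 A -> sample_events zeta B -> P (A `&` B) = (P A * P B)%E)
  (mx : measurable_vec (x : g_sigma_algebraType C0 -> _)) (Xx : forall w, X (x w)).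

Definition post_error w : 'rV[R]_n := post_grad G zeta w (x w) - df (x w).

Local Notation C := (fun i : option 'I_K => if i is Some j then rv_events (zeta j) else C0).
Local Notation GG := (fun j : 'I_K => \bigcup_(i in [set i | i != Some j]) C i).

Let mzeta j : measurable_fun setT (zeta j). Proof. by case: iid. Qed.

Let mC i : C i `<=` measurable.
Proof. by case: i => [j|]; [move=> _ [B mB <-]; exact: mzeta|exact: mC0]. Qed.

(** The candidate is frozen when a post-optimization sample is integrated out, so that
    the variances of the [K] errors add up. *)
Lemma post_error_mean : mean_le0 P
  (fun w => dotp (post_error w) (post_error w) - sigma ^+ 2 / K%:R).
Proof.
have Kn0 : K%:R != 0 :> R by rewrite pnatr_eq0 -lt0n.
have indC : mutually_independent P C.
  by apply: mutually_independent_option => //; case: iid.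
have CT i : C i setT.
  by case: i => [j|] //; exists setT; rewrite // preimage_setT setTI.
have CI i : setI_closed (C i) by case: i => [j|] //; exact: rv_events_setI.
have mG j : <<s GG j >> `<=` measurable by exact: (rest_measurable mC (i := Some j)).
have law j D : measurable D -> P (zeta j @^-1` D) = Pxi D by case: iid => _ + _; apply.
have ind j A D : <<s GG j >> A -> measurable D ->
    P (A `&` zeta j @^-1` D) = (P A * P (zeta j @^-1` D))%E.
  move=> sA mD; apply: (independent_rest indC mC CT CI (i := Some j) sA).
  by exists D; rewrite // setTI.
have other i j : i != j -> measurable_fun setT (zeta i : g_sigma_algebraType (GG j) -> Xi).
  move=> ij _ B mB; apply: sub_gen_smallest.
  by exists (Some i) => //; exists B.
have mxG j : measurable_vec (x : g_sigma_algebraType (GG j) -> _).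
  move=> i _ B mB; have := mx i measurableT mB.
  move: (_ `&` _); apply: smallest_sub; first exact: smallest_sigma_algebra.
  by move=> A CA; apply: sub_gen_smallest; exists None.
pose q (i j : 'I_K) (w : Omega) : R := K%:R^-1 * K%:R^-1.
have q0 : 0 <= K%:R^-1 * K%:R^-1 :> R by rewrite mulr_ge0.
have := error_form_mean hp O mG mzeta law ind other mxG Xx (q := q) (Bq := K%:R^-1 * K%:R^-1).
have eE w : post_error w = \sum_j K%:R^-1 *: sample_error df G (zeta j) x w.
  rewrite /post_error /post_grad -scaler_sumr sumrB scalerBr sumr_const card_ord.
  by rewrite -[df (x w) *+ K]scaler_nat scalerA mulVf// scale1r.
have -> : (fun w => dotp (post_error w) (post_error w) - sigma ^+ 2 / K%:R) =
    fun w => \sum_j \sum_i q i j w * dotp (sample_error df G (zeta j) x w)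
      (sample_error df G (zeta i) x w) - \sum_j q j j w * sigma ^+ 2.
  apply/funext => w; rewrite eE (dotp_error_sum df G zeta x (fun=> K%:R^-1)).
  by congr (_ - _); rewrite /q sumr_const card_ord -[_ *+ K]mulr_natr; field.
apply => // [i j|i j w]; first exact: measurable_cst.
by rewrite ger0_norm.
Qed.

(** Chebyshev's inequality. *)
Lemma post_error_prob (lambda : R) : 0 < lambda ->
  (P [set w | (lambda * (sigma ^+ 2 / K%:R) <= dotp (post_error w) (post_error w))%R]
     <= (lambda^-1)%:E)%E.
Proof.
move=> l0; set v := sigma ^+ 2 / K%:R.
have v0 : 0 < v by rewrite divr_gt0 ?(so_sigma_gt0 O)// ltr0n.
have [ig g0] := post_error_mean.
pose g w := dotp (post_error w) (post_error w).
have ige : P.-integrable setT (EFin \o g).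
  have := integrableD measurableT ig (real_integrable_cst P v).
  apply: eq_integrable => // w _ /=.
  by rewrite -EFinD subrK.
have gv : (\int[P]_w (g w)%:E <= v%:E)%E.
  have : (\int[P]_w ((g w)%:E - v%:E) <= 0)%E by exact: g0.
  rewrite integralB//; last exact: real_integrable_cst.
  by rewrite (mean_cst P) sube_le0.
have mg : measurable_fun setT (EFin \o g) by exact: measurable_int ige.
have := le_integral_abse P measurableT mg (mulr_gt0 l0 v0).
rewrite setTI => h.
have E : [set w | ((lambda * v)%:E <= `|(EFin \o g) w|)%E] = [set w | lambda * v <= g w].
  by apply/seteqP; split => w /=; rewrite ger0_norm ?dotp_ge0.
rewrite E in h.
have h2 : (\int[P]_w `|(EFin \o g) w| <= v%:E)%E.
  apply: le_trans gv; rewrite le_eqVlt; apply/orP; left; apply/eqP.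
  by apply: eq_integral => w _ /=; rewrite ger0_norm ?dotp_ge0.
have mA : measurable [set w | lambda * v <= g w].
  have mg' : measurable_fun setT g by exact/measurable_EFinP.
  rewrite (_ : [set w | _] = g @^-1` `[lambda * v, +oo[%classic).
    by rewrite -[X in measurable X]setTI; exact: mg'.
  by apply/seteqP; split => w /=; rewrite in_itv/= andbT.
have Pf : P [set w | lambda * v <= g w] \is a fin_num by exact: fin_num_measure.
have : ((lambda * v)%:E * P [set w | (lambda * v <= g w)%R] <= v%:E)%E := le_trans h h2.
rewrite -(fineK Pf) -EFinM !lee_fin.
rewrite mulrAC ger_pMl// => h3.
by rewrite -[leRHS]mul1r ler_pdivlMr// mulrC.
Qed.

End PostError.

(** * The selected candidate *)

Section Selection.
Context {R : realType}.

(** The selection compares noisy norms, so the selected candidate is at most as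
    bad as any other one up to the errors of both. *)
Lemma selection_bound (n : nat) (vs vr ws wr : 'rV[R]_n) (es er c : R) :
  enorm ws <= enorm wr -> enorm (vs - ws) <= es -> enorm (vr - wr) <= er ->
  es ^+ 2 <= c -> er ^+ 2 <= c -> enorm vs ^+ 2 <= 3 * enorm vr ^+ 2 + 6 * c.
Proof.
move=> swr hs hr; have := enorm_ge0 vs; have := enorm_ge0 vr.
have := enormD (vs - ws) ws; have := enormD (wr - vr) vr; rewrite !subrK.
rewrite enormB in hr; move: (enorm vs) (enorm vr) swr hs hr => gs gr.
move: (enorm _) (enorm _) (enorm _) (enorm _) => a1 a2 a3 a4 swr hs hr h1 h2 gr0 gs0 cs cr.
have h : gs <= gr + (er + es) by lra.
have := ler_pM gs0 gs0 h h; have := sqr_ge0 (2 * gr - (er + es)).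
have := sqr_ge0 (er - es); move: cs cr; rewrite !expr2; lra.
Qed.

(** The ratio is infinite for [m = 0], where the real quotient would be [0]. *)
Lemma le_ratio_add (x c q m : R) : 0 < q -> 0 <= m ->
  (x%:E <= q%:E / m%:E + c%:E)%E = (m == 0) || (x <= q / m + c).
Proof.
move=> q0 m0; rewrite inver; case: eqP => [->|_] /=.
  by rewrite gt0_muley ?lte_fin// addye// leey.
by rewrite -EFinM -EFinD lee_fin.
Qed.

Lemma Q_gt0 (n : nat) (X : set 'rV[R]_n) (f : 'rV[R]_n -> R)
    (df : 'rV[R]_n -> 'rV[R]_n) (L l hatL sigma alpha : R) (st : nat -> state R n)
    (est : estimator) (k : nat) :
  smooth_problem X f df L l -> segmented st -> (0 < k)%N -> 0 <= hatL ->
  0 < sigma ^+ 2 -> 0 < alpha -> 0 < Q_ est st k hatL (diam X) l sigma alpha.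
Proof.
move=> hp sg k0 hL s0 a0; have D0 := sqr_ge0 (diam X); have l0 := sp_l_ge0 hp.
have mk : (nseg st k)%:R <= k%:R :> R.
  by rewrite ler_nat /nseg -(prednK k0); exact: segment_le.
apply: ltr_wpDl; last by rewrite divr_gt0// mulr_gt0// ltr0n.
apply: addr_ge0; last by apply: divr_ge0 => //; apply: mulr_ge0 => //; apply: mulr_ge0.
have c0 : 0 <= 10 + k%:R - (nseg st k)%:R :> R by lra.
by case: est; apply: divr_ge0 => //; apply: mulr_ge0 => //; apply: mulr_ge0.
Qed.

Lemma ceil_log2_power (delta : R) (N : nat) : 0 < delta ->
  N%:Z = ceil_log2 (2 / delta) -> (1 / 2) ^+ N <= delta / 2.
Proof.
move=> d0 NE; have l2 : 0 < ln 2 :> R by rewrite ln_gt0// ltr1n.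
have := ceil_ge (ln (2 / delta) / ln 2); rewrite -/(ceil_log2 _) -NE.
rewrite ler_pdivrMr// -pmulrn (_ : N%:R * ln 2 = ln (2 ^+ N)); last first.
  by rewrite lnXn// mulr_natl.
rewrite ler_ln ?posrE ?exprn_gt0 ?divr_gt0// => h.
rewrite mul1r exprVn -[leRHS]invrK lef_pV2 ?posrE ?invr_gt0 ?exprn_gt0 ?divr_gt0//.
by rewrite invf_div.
Qed.

End Selection.

Section TwoPhaseBound.
Context {R : realType} {n : nat} {dXi : measure_display} {Xi : measurableType dXi}.
Variables (Pxi : probability Xi R) (X : set 'rV[R]_n) (f : 'rV[R]_n -> R)
  (df : 'rV[R]_n -> 'rV[R]_n) (L l : R) (F : 'rV[R]_n -> Xi -> R)
  (G : 'rV[R]_n -> Xi -> 'rV[R]_n) (Lxi : Xi -> R) (sigma hatL barL : R).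
Hypothesis hp : smooth_problem X f df L l.
Hypothesis O : stochastic_oracle Pxi X f df F G Lxi sigma hatL barL.
Variables (Lbar0 alpha : R) (x0 : 'rV[R]_n) (N K k : nat) (est : estimator)
  (b' : nat -> nat).
Hypotheses (Lbar0_gt0 : 0 < Lbar0) (Lbar0_le : Lbar0 <= hatL)
  (alpha_gt0 : 0 < alpha) (Xx0 : X x0) (K_gt0 : (0 < K)%N)
  (b'_gt0 : forall t, (1 <= t <= k)%N -> (1 <= b' t)%N)
  (hest : estimator_condition est b' k (beta Pxi X f df F G Lbar0)).
Context {d : measure_display} {Omega : measurableType d}.
Variables (P : probability Omega R)
  (xi xib : 'I_N -> nat -> nat -> Omega -> Xi) (rho : 'I_N -> Omega -> nat)
  (zeta : 'I_K -> Omega -> Xi).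
Local Notation st := (trajectory X F G est Lbar0 alpha b' x0 xi xib).
Hypothesis rnd : two_phase_randomness P Pxi k xi xib rho zeta st.
Variable sel : Omega -> 'I_N.
Hypotheses (msel : forall r, measurable [set w | sel w = r])
  (best : selects_best X G zeta st rho sel).

Local Notation Y r := (run_sample (xi r) (xib r)).

Let run_in r w t : X (iterate (st r w t)).
Proof. exact: (sample_run_in F G hp est Lbar0 alpha b' Xx0 (xi r) (xib r)). Qed.

Let run_seg r w : segmented (st r w).
Proof. exact: (sample_run_segmented X F G est alpha b' x0 Lbar0_gt0 (xi r) (xib r)). Qed.

Let mst r t : measurable_state (fun w => st r w t).
Proof. exact: (measurable_sample_run hp O est alpha b' Lbar0_gt0 Xx0 (tp_run_iid rnd r)). Qed.

(** The range of the output index leaves room for a candidate. *)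
Lemma iterations_gt0 : (0 < k)%N.
Proof.
have [_ /(_ point) + _] := tp_output rnd (sel point).
by case: k => //=; case: (rho _ _).
Qed.

Let k0 := iterations_gt0.

Let mrho r t : measurable [set w | rho r w = t].
Proof.
have [m _ _] := tp_output rnd r.
by have := m measurableT [set t] I; rewrite setTI.
Qed.

Let run_events_measurable r : run_events (Y r) (rho r) `<=` measurable.
Proof.
apply: smallest_sub; first exact: sigma_algebra_measurable.
move=> A [[i _ [B mB <-]]|[t _ <-]]; last exact: mrho.
by case: (tp_run_iid rnd r) => mY _ _; exact: mY.
Qed.

Let candidate_known r :
  measurable_vec (candidate st rho r : g_sigma_algebraType (run_events (Y r) (rho r)) -> _).
Proof.
have known A : run_events (Y r) (rho r) A -> <<s run_events (Y r) (rho r) >> A.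
  exact: sub_gen_smallest.
have mY i : measurable_fun setT (Y r i : g_sigma_algebraType (run_events (Y r) (rho r)) -> Xi).
  move=> _ B mB; apply: known; apply: sub_gen_smallest; left.
  by exists i => //; exists B.
apply: (measurable_vec_select (T := g_sigma_algebraType (run_events (Y r) (rho r)))
  (f := fun t w => iterate (st r w t)) (c := rho r)).
  by move=> t; apply: known; apply: sub_gen_smallest; right; exists t.
move=> t; apply: ms_iterate.
by apply: (measurable_run hp O est alpha b' Lbar0_gt0 Xx0
  (T := g_sigma_algebraType (run_events (Y r) (rho r)))) => t' j _;
  [exact: (mY (inl (t', j)))|exact: (mY (inr (t', j)))].
Qed.

Let err r w := post_error df G zeta (candidate st rho r) w.

Let large_error (lambda : R) r : set Omega :=
  [set w | lambda * (sigma ^+ 2 / K%:R) <= dotp (err r w) (err r w)].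

Lemma large_error_prob lambda r : 0 < lambda ->
  (P (large_error lambda r) <= (lambda^-1)%:E)%E.
Proof.
move=> l0; pose S : set (set Omega) :=
  \bigcup_i rv_events (Y r i) `|` [set [set w | rho r w = s] | s in setT].
have eT : run_events (Y r) (rho r) setT by exact: (@measurableT _ (g_sigma_algebraType S)).
have eI : setI_closed (run_events (Y r) (rho r)).
  by move=> A B; exact: (@measurableI _ (g_sigma_algebraType S)).
have ind A B : run_events (Y r) (rho r) A -> sample_events zeta B ->
    P (A `&` B) = (P A * P B)%E.
  move=> eA eB; have := tp_independent rnd (J := [:: Some r; None])
    (E := fun i => if i is Some _ then A else B).
  rewrite !big_cons !big_nil setIT mule1; apply => // i.
  by rewrite !inE => /orP[]/eqP ->.
have Xc w : X (candidate st rho r w) by exact: run_in.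
exact: (post_error_prob hp O K_gt0 (tp_post_iid rnd) (@run_events_measurable r) eT eI ind
  (@candidate_known r) Xc l0).
Qed.

Let large_error_measurable lambda r : measurable (large_error lambda r).
Proof.
have mx : measurable_vec (candidate st rho r).
  apply: (measurable_vec_select (f := fun t w => iterate (st r w t)) (c := rho r)) => // t.
  exact: ms_iterate (mst r t).
have Xc w : X (candidate st rho r w) by exact: run_in.
have merr : measurable_vec (err r).
  apply: measurable_vecB; last exact: (measurable_gradient hp).
  apply: measurable_vecZ => //; apply: measurable_vec_sum => j.
  apply: (measurable_sample_gradient O) => //.
  by case: (tp_post_iid rnd).
have mb : measurable_fun setT
    (fun w => lambda * (sigma ^+ 2 / K%:R) <= dotp (err r w) (err r w)).
  by apply: measurable_fun_ler => //; exact: measurable_dotp.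
by have := mb measurableT [set true] I; rewrite setTI.
Qed.

Let pg r w := candidate_pg X df st rho r w.

Let ratio_ok r w c := (weight_sum (st r w) k == 0) ||
  (enorm (pg (sel w) w) ^+ 2
    <= 8 * Q_ est (st r w) k hatL (diam X) l sigma alpha / weight_sum (st r w) k + c).

(** A maximum is reached by one of the runs. *)
Lemma bound_met w c :
  ((enorm (pg (sel w) w) ^+ 2)%:E
     <= ratio_bound est st k hatL (diam X) l sigma alpha w + c%:E)%E
  <-> exists r, ratio_ok r w c.
Proof.
have hL := hatL_ge0 O.
have q0 r : 0 < 8 * Q_ est (st r w) k hatL (diam X) l sigma alpha.
  by rewrite mulr_gt0// (Q_gt0 _ hp)// (so_sigma_gt0 O).
have E r : ((enorm (pg (sel w) w) ^+ 2)%:E <=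
    (8 * Q_ est (st r w) k hatL (diam X) l sigma alpha)%:E / (M_ (st r w) k)%:E + c%:E)%E
    = ratio_ok r w c.
  rewrite (segment_sum (run_seg r w) k0).
  by rewrite le_ratio_add// (weight_sum_ge0 (run_seg r w)).
rewrite /ratio_bound -leeBlDr//; split.
  move=> /bigmax_geP[|[r _]]; first by rewrite leeNy_eq.
  by rewrite leeBlDr// E => h; exists r.
move=> [r h]; apply/bigmax_geP; right; exists r => //.
by rewrite leeBlDr// E.
Qed.

Lemma bound_measurable c : measurable [set w |
  ((enorm (pg (sel w) w) ^+ 2)%:E
     <= ratio_bound est st k hatL (diam X) l sigma alpha w + c%:E)%E].
Proof.
have -> : [set w | ((enorm (pg (sel w) w) ^+ 2)%:E
     <= ratio_bound est st k hatL (diam X) l sigma alpha w + c%:E)%E] =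
    \bigcup_r [set w | ratio_ok r w c].
  by apply/seteqP; split => w /= => [/bound_met[r h]|[r _ h]];
    [exists r|apply/bound_met; exists r].
apply: fin_bigcup_measurable => // r _.
have mM : measurable_fun setT (fun w => weight_sum (st r w) k).
  exact: (measurable_weight_sum (mst r) (run_seg r)).
have mpg : measurable_fun setT (fun w => enorm (pg (sel w) w) ^+ 2).
  apply: (measurable_select (f := fun r w => enorm (pg r w) ^+ 2) msel) => r'.
  apply: (measurable_select (c := rho r') (f := fun t w => sq_pg X df (st r' w) t.+1)) => // t.
  exact: (measurable_sq_pg hp (mst r') (run_seg r') (run_in r')).
have mb : measurable_fun setT (fun w => ratio_ok r w c).
  apply: measurable_or; first exact: measurable_fun_eqr.
  apply: measurable_fun_ler => //; apply: measurable_funD => //.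
  apply: measurable_funM; last by apply: measurable_inv => // w; exact: weight_sum_ge0.
  by apply: measurable_funM => //; exact: (measurable_Q l (mst r)).
by have := mb measurableT [set true] I; rewrite setTI.
Qed.

(** The bound can fail only if all runs fail or one of the post-optimization errors is
    large: otherwise the selected candidate is compared with that of a run that did
    not fail, whose ratio is infinite if its weights vanish. *)
Lemma two_phase_prob lambda : 0 < lambda ->
  ((1 - (1 / 2) ^+ N - N%:R / lambda)%:E <=
   P [set w | ((enorm (pg (sel w) w) ^+ 2)%:E <= ratio_bound est st k hatL (diam X) l sigma alpha w
       + (6 * lambda * sigma ^+ 2 / K%:R)%:E)%E])%E.
Proof.
move=> l0.
pose bad r := run_fails X df l F G sigma hatL est Lbar0 alpha b' x0 k (xi r) (xib r) (rho r).
have ebad r : run_events (Y r) (rho r) (bad r).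
  exact: (run_fails_event hp O Lbar0_gt0 Xx0 (tp_output rnd r)).
have mbad r : measurable (bad r) := @run_events_measurable r _ (ebad r).
have Pbad r : (P (bad r) <= (1 / 2)%:E)%E.
  exact: (run_fails_prob hp O Lbar0_gt0 Lbar0_le alpha_gt0 Xx0 b'_gt0 hest
    (tp_run_iid rnd r) (tp_output rnd r)).
have merr r : measurable (large_error lambda r).
  exact: large_error_measurable.
pose B := (\bigcap_r bad r) `|` \big[setU/set0]_r large_error lambda r.
have mcap : measurable (\bigcap_r bad r) by exact: fin_bigcap_measurable.
have mcup : measurable (\big[setU/set0]_r large_error lambda r) by exact: bigsetU_measurable.
have mB : measurable B by exact: measurableU.
have PB : (P B <= ((1 / 2) ^+ N + N%:R / lambda)%:E)%E.
  apply: (le_trans (measureU2 _ mcap mcup)); rewrite EFinD; apply: leeD.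
    apply: (all_runs_fail (tp_independent rnd)) => //.
  apply: (le_trans (prob_union_le _ _ merr)).
  apply: (@le_trans _ _ (\sum_(r < N) (lambda^-1)%:E)%E).
    by apply: lee_sum => r _; exact: large_error_prob.
  by rewrite sumEFin sumr_const card_ord mulr_natl.
apply: (@le_trans _ _ (P (~` B))).
  rewrite probability_setC// -addrA -opprD EFinB.
  exact: leeB.
apply: le_measure; rewrite ?inE.
- exact: measurableC.
- exact: bound_measurable.
move=> w /=; rewrite /B => /not_orP[nbad nerr].
apply/bound_met.
have [r nr] : exists r, ~ bad r w.
  by apply/existsNP => h; apply: nbad => r _; exact: h.
exists r; rewrite /ratio_ok.
have [->//|M0] := eqVneq (weight_sum (st r w) k) 0; rewrite /=.
have Mp : 0 < weight_sum (st r w) k by rewrite lt_def M0 (weight_sum_ge0 (run_seg r w)).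
have small r' : enorm (err r' w) ^+ 2 <= lambda * (sigma ^+ 2 / K%:R).
  rewrite enorm_sqr leNgt; apply/negP => h; apply: nerr.
  by rewrite -bigcup_seq; exists r'; [rewrite /= mem_index_enum|exact: ltW h].
pose noisy r' := candidate_pg X (post_grad G zeta w) st rho r' w.
have close r' : enorm (pg r' w - noisy r') <= enorm (err r' w).
  rewrite /err /post_error -(enormB (df _)).
  apply: (proj_grad_lipschitz _ _ (sp_convex hp) (sp_compact hp)); first exact: run_in.
  exact: gam_gt0 (run_seg r' w) _.
apply: (le_trans (selection_bound (best w r) (close (sel w)) (close r) (small _) (small _))).
have -> : 6 * lambda * sigma ^+ 2 / K%:R = 6 * (lambda * (sigma ^+ 2 / K%:R)) by rewrite !mulrA.
rewrite lerD2r ler_pdivlMr//.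
have : ~~ failing X df (st r w) k (Q_ est (st r w) k hatL (diam X) l sigma alpha) (rho r w).+1.
  by apply/negP => h; apply: nr.
by rewrite /failing -leNgt mulrA [leLHS]mulrAC.
Qed.

End TwoPhaseBound.

Theorem theorem5 (R : realType) (n : nat)
    (dXi : measure_display) (Xi : measurableType dXi) (Pxi : probability Xi R)
    (X : set 'rV[R]_n) (f : 'rV[R]_n -> R) (df : 'rV[R]_n -> 'rV[R]_n)
    (L l : R) (hprob : smooth_problem X f df L l)
    (F : 'rV[R]_n -> Xi -> R) (G : 'rV[R]_n -> Xi -> 'rV[R]_n)
    (Lxi : Xi -> R) (sigma hatL barL : R)
    (horacle : stochastic_oracle Pxi X f df F G Lxi sigma hatL barL)
    (Lbar0 : R) (hLbar0 : 0 < Lbar0) (hLbar0_le : Lbar0 <= hatL)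
    (alpha : R) (halpha : 0 < alpha)
    (x0 : 'rV[R]_n) (hx0 : X x0)
    (N K k : nat) (hK : (1 <= K)%N)
    (est : estimator) (b' : nat -> nat)
    (hb' : forall t, (1 <= t <= k)%N -> (1 <= b' t)%N)
    (hest : estimator_condition est b' k (beta Pxi X f df F G Lbar0))
    (d : measure_display) (Omega : measurableType d) (P : probability Omega R)
    (xi xib : 'I_N -> nat -> nat -> Omega -> Xi) (rho : 'I_N -> Omega -> nat)
    (zeta : 'I_K -> Omega -> Xi)
    (st : 'I_N -> Omega -> nat -> state R n)
    (hst : st = trajectory X F G est Lbar0 alpha b' x0 xi xib)
    (hrand : two_phase_randomness P Pxi k xi xib rho zeta st)
    (sel : Omega -> 'I_N)
    (hsel_meas : forall r, measurable [set w | sel w = r])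
    (hsel : selects_best X G zeta st rho sel) :
  let g_out w := candidate_pg X df st rho (sel w) w in
  let bound w := ratio_bound est st k hatL (diam X) l sigma alpha w in
  [/\ forall r w,
        (k%:R - (nseg (st r w) k)%:R) ^+ 2 / (128 * Lhat (st r w k.-1))
          <= M_ (st r w) k,
      forall lambda : R, 0 < lambda ->
        ((1 - (1 / 2) ^+ N - N%:R / lambda)%:E
          <= P [set w | (enorm (g_out w) ^+ 2)%:E
                 <= bound w + (6 * lambda * sigma ^+ 2 / K%:R)%:E])%E
    & forall delta : R, 0 < delta < 1 -> N%:Z = ceil_log2 (2 / delta) ->
        ((1 - delta)%:E
          <= P [set w | (enorm (g_out w) ^+ 2)%:E
                 <= bound w + (12 * (ceil_log2 (2 / delta))%:~R * sigma ^+ 2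
                               / (delta * K%:R))%:E])%E].
Proof.
move=> g_out bound.
rewrite {}hst in hrand hsel g_out bound *.
have k0 := iterations_gt0 hrand sel.
have prob lambda : 0 < lambda -> _ := two_phase_prob hprob horacle hLbar0 hLbar0_le halpha hx0
  hK hb' hest hrand hsel_meas hsel (lambda := lambda).
split => [r w|lambda l0|delta /andP[d0 d1] NE].
- have sg : segmented (trajectory X F G est Lbar0 alpha b' x0 xi xib r w).
    exact: (sample_run_segmented X F G est alpha b' x0 hLbar0 (xi r) (xib r)).
  by rewrite (segment_sum sg k0); exact: (weight_sum_ge sg k0).
- exact: prob.
have N0 : (0 < N)%N by case: (N) (sel point) => [[]|].
have Nn0 : N%:R != 0 :> R by rewrite pnatr_eq0 -lt0n.
have l0 : 0 < 2 * N%:R / delta by rewrite divr_gt0// mulr_gt0// ltr0n.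
have := prob _ l0.
have -> : 6 * (2 * N%:R / delta) * sigma ^+ 2 / K%:R
    = 12 * (ceil_log2 (2 / delta))%:~R * sigma ^+ 2 / (delta * K%:R).
  rewrite -NE -pmulrn; field.
  by rewrite pnatr_eq0 -lt0n hK gt_eqF.
apply: le_trans; rewrite lee_fin.
have -> : N%:R / (2 * N%:R / delta) = delta / 2 by field; rewrite Nn0 gt_eqF.
by have := ceil_log2_power d0 NE; lra.
Qed.
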